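(* Let $G$ be a finite solvable group. Then $\ell_{\mathbf{F}}(G)\leq \frac{1}{2}\left(|\mathrm{cod}(G)|+2\right)$.
   Context: All characters are complex; $\mathrm{Irr}(G)$ is the set of irreducible complex characters of $G$. For $\chi\in\mathrm{Irr}(G)$, the codegree of $\chi$ is $\mathrm{cod}(\chi)=|G:\ker(\chi)|/\chi(1)$, where $\ker(\chi)=\{g\in G:\chi(g)=\chi(1)\}$, and $\mathrm{cod}(G)=\{\mathrm{cod}(\chi):\chi\in\mathrm{Irr}(G)\}$ is the set (without multiplicity) of irreducible character codegrees. $\ell_{\mathbf{F}}(G)$ denotes the Fitting height of the solvable group $G$: the least $n\geq 0$ with $\mathbf{F}_n(G)=G$, where $\mathbf{F}_0(G)=1$ and $\mathbf{F}_{i+1}(G)/\mathbf{F}_i(G)=\mathbf{F}(G/\mathbf{F}_i(G))$, with $\mathbf{F}(\cdot)$ the Fitting subgroup (largest nilpotent normal subgroup). In particular $\ell_{\mathbf{F}}(1)=0$. *)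

(* Defs.v *)
From mathcomp Require Import all_boot all_order all_algebra.
From mathcomp Require Import all_fingroup all_solvable all_field all_character.

Set Implicit Arguments.
Unset Strict Implicit.
Unset Printing Implicit Defensive.

Import GroupScope GRing.Theory.

Section Codegree.

Variables (gT : finGroupType) (G : {group gT}).

(* By [cfkerEirr], [cfker 'chi_i] is the set of the [x] such that
   ['chi_i x = 'chi_i 1]. *)
Definition codegree (chi : 'CF(G)) : algC :=
  (#|G : cfker chi|%:R / chi 1%g)%R.

(* Duplicate-free, so that its size is the number of distinct codegrees. *)
Definition codegrees : seq algC := undup [seq codegree ('chi_i)%R | i : Iirr G].

Lemma codegreesP x :
  reflect (exists i : Iirr G, x = codegree ('chi_i)%R) (x \in codegrees).
Proof.
rewrite mem_undup; apply: (iffP imageP) => [[i _ ->] | [i ->]]; by exists i.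
Qed.

Lemma codegrees_uniq : uniq codegrees.
Proof. exact: undup_uniq. Qed.

End Codegree.

Section FittingHeight.

Variable gT : finGroupType.

Definition fitting_series (A : {set gT}) (n : nat) : {set gT} :=
  iter n (fun B => coset B @*^-1 'F(A / B)) 1.

(* The least [n] such that [fitting_series A n = A]; the junk value [#|A|] does
   not occur for solvable groups, by [fitting_heightP]. *)
Definition fitting_height (A : {set gT}) : nat :=
  index A (mkseq (fitting_series A) #|A|).

Implicit Type G : {group gT}.

Lemma fitting_seriesS (A : {set gT}) n :
  fitting_series A n.+1 =
    coset (fitting_series A n) @*^-1 'F(A / fitting_series A n).
Proof. by []. Qed.

Lemma fitting_series_normal_group G n :
  exists2 H : {group gT}, fitting_series G n = H & H <| G.
Proof.
elim: n => [|n [H eqH nHG]]; first by exists 1%G; rewrite // normal1.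
rewrite fitting_seriesS eqH.
exists (coset H @*^-1 'F(G / H))%G => //=.
by rewrite -{2}(quotientGK nHG) cosetpre_normal Fitting_normal.
Qed.

Lemma fitting_series_normal G n : fitting_series G n <| G.
Proof. by have [H ->] := fitting_series_normal_group G n. Qed.

Lemma fitting_series_quotient G n :
  fitting_series G n.+1 / fitting_series G n = 'F(G / fitting_series G n).
Proof.
by have [H eqH _] := fitting_series_normal_group G n;
   rewrite fitting_seriesS eqH cosetpreK.
Qed.

Lemma fitting_series_proper G n :
    solvable G -> fitting_series G n != G ->
  fitting_series G n \proper fitting_series G n.+1.
Proof.
move=> solG; rewrite fitting_seriesS.
have [H -> nHG] := fitting_series_normal_group G n => neqHG.
rewrite properEneq sub_cosetpre andbT.
apply: contra neqHG => /eqP eqH.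
have: 'F(G / H) == 1 by rewrite -(cosetpreK 'F(G / H)) -eqH trivg_quotient.
rewrite trivg_Fitting ?quotient_sol // => /eqP GH1.
by rewrite eqEsubset normal_sub //= -quotient_sub1 ?normal_norm //= GH1.
Qed.

Lemma fitting_heightP G :
    solvable G ->
  fitting_series G (fitting_height G) = G
  /\ forall n, fitting_series G n = G -> fitting_height G <= n.
Proof.
move=> solG; set s := mkseq (fitting_series G) #|G|.
have ss : size s = #|G| by rewrite size_mkseq.
have Gs : (G : {set gT}) \in s.
  apply: contraT => Gs.
  have card_gt n : n < #|G| -> n < #|fitting_series G n|.
    elim: n => [|n IHn] ltnG; first by rewrite cards1.
    apply: leq_ltn_trans (IHn (ltnW ltnG)) _; apply: proper_card.
    apply: fitting_series_proper => //; apply: contra Gs => /eqP eqG.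
    by apply/mapP; exists n => //; rewrite mem_iota add0n (ltnW ltnG).
  have lt1 : #|G|.-1 < #|G| by rewrite prednK ?cardG_gt0.
  have := card_gt _ lt1; rewrite prednK ?cardG_gt0 // => leG.
  case/negP: Gs; apply/mapP; exists #|G|.-1; first by rewrite mem_iota add0n.
  by apply/esym/eqP; rewrite eqEcard leG normal_sub ?fitting_series_normal.
have lth : fitting_height G < #|G| by rewrite -[X in _ < X]ss index_mem.
split; first by rewrite -[RHS](nth_index 1 Gs) nth_mkseq.
move=> n eqG; rewrite leqNgt; apply/negP => ltnh.
have := before_find 1 ltnh.
by rewrite nth_mkseq ?(ltn_trans ltnh) //= eqG eqxx.
Qed.

End FittingHeight.

(* Main.v *)
Require Import Defs.
From mathcomp Require Import all_boot all_order all_algebra.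
From mathcomp Require Import all_fingroup all_solvable all_field all_character.
From mathcomp Require Import closed_field ring lra zify.

Set Implicit Arguments.
Unset Strict Implicit.
Unset Printing Implicit Defensive.

Import GroupScope GRing.Theory Num.Theory.

(** Write [l(G)] for the Fitting height and [cod(G)] for the set of codegrees.
    The bound [2 l(G) <= |cod(G)| + 2] is proved by induction on [#|G|],
    together with [l(G) < |cod(G)|] when [l(G) <= 3] ([codegree_bound]).

    A codegree of a quotient of [G] is a codegree of [G], so all proper
    quotients of [G] may be assumed to have smaller height.  If [l(G) >= 2],
    then [G] is a semidirect product [N ><| H], where [N] is the unique minimal normal
    subgroup, ['C_G(N) = N] and [l(G) = l(H) + 1] ([primitive_structure]).  A
    nonprincipal character of [N] extends to its inertia group [T], and
    inducing the extension to [G] gives a faithful irreducible character of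
    codegree [#|T|] ([inertia_codegree]).  The orbit of the character has fewer
    than [#|N|] elements, so [#|T| > #|H|] and this codegree is not in
    [cod(H)]; all of [cod(H)] lies in [cod(G)].  One new codegree suffices
    when [l(G) <= 3].

    Let [l(G) >= 4].  Two different values of [#|T|] give two new codegrees,
    which suffices.  Otherwise [H] acts on the dual group of [N] in such a way
    that all stabilizers of nonzero vectors have the same order.  For odd [q]
    this forces the normal [q]-subgroups of [H] to be cyclic
    ([odd_normal_pgroup_cyclic]), and it forces a nontrivial normal elementary
    abelian 2-subgroup of [H] to have order 2, because [l(H) >= 3] and [H] would
    otherwise be an extension of two nilpotent groups ([even_normal_abelem]).
    Let [M] be maximal among the normal subgroups of [H] with
    [l(H / M) = l(H)].  If [cod(H)] is larger than [cod(H / M)], then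
    induction applied to [H / M] gives the two codegrees that are required.

    It remains to see that [cod(H)] cannot be equal to [cod(H / M)]
    ([not_codegrees_sub]).  The group [H / M] is again primitive, with a
    noncyclic socle [V] that is the image of ['O_q(H)] for some prime [q].
    Hence [q = 2], and [H] has a central involution [z], which lies in [M].
    Let [L] be maximal among the normal subgroups without [z].  Then [H / L]
    has a faithful character whose degree is a power of 2 and is small
    ([small_primary_degree]).  A character [theta] of [H / M] with the same
    codegree has the property that [#|cfker theta| * theta 1] is a power of 2
    that is too small for [primary_weight_bound], which is a consequence of a
    bound for the Sylow 2-subgroups of [H / M] ([index_part2_le]). *)

(** * Fitting height and iterated nilpotent residuals *)

Section NilpotentLength.

(** For [m >= #|A|] each step takes the nilpotent residual.  With the same [m]
    at every step and in every quotient, the series commutes with morphisms. *)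
Definition nil_series (gT : finGroupType) m n (A : {set gT}) : {set gT} :=
  iter n (fun B : {set gT} => 'L_m(B)) A.

Section OneGroup.
Variable gT : finGroupType.
Implicit Types G H K L : {group gT}.

Lemma nil_series_group_set m n G : group_set (nil_series m n G).
Proof.
suffices [H ->]: exists H : {group gT}, nil_series m n G = H by apply: groupP.
by elim: n => [|n [H eqH]]; [exists G | exists 'L_m(H)%G; rewrite /= -eqH].
Qed.
Canonical nil_series_group m n G := Group (nil_series_group_set m n G).

Lemma nil_seriesS m n (A : {set gT}) :
  nil_series m n.+1 A = 'L_m(nil_series m n A).
Proof. by []. Qed.

Lemma nil_seriesD m a b (A : {set gT}) :
  nil_series m (a + b) A = nil_series m b (nil_series m a A).
Proof. by rewrite addnC /nil_series iterD. Qed.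

Lemma nil_series_char m n G : nil_series m n G \char G.
Proof.
elim: n => [|n IHn]; first exact: char_refl.
exact: char_trans (lcn_char _ _) IHn.
Qed.

Lemma nil_seriesS_sub m n H G :
  H \subset G -> nil_series m n H \subset nil_series m n G.
Proof. by move=> sHG; elim: n => // n IHn; rewrite !nil_seriesS /= lcnS. Qed.

Lemma nil_series_morphim (rT : finGroupType) m n G (D : {group gT})
    (f : {morphism D >-> rT}) : G \subset D ->
  f @* nil_series m n G = nil_series m n (f @* G).
Proof.
move=> sGD; elim: n => // n IHn; rewrite nil_seriesS [RHS]/= -IHn morphim_lcn //.
exact: subset_trans (char_sub (nil_series_char m n G)) sGD.
Qed.

Lemma nil_series_quo m n G K : G \subset 'N(K) ->
  nil_series m n G / K = nil_series m n (G / K).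
Proof. by move=> nKG; rewrite /quotient nil_series_morphim. Qed.

Lemma lcn_eq1 m G : #|G| <= m -> nilpotent G -> 'L_m(G) = 1.
Proof.
case: m => [|m]; first by rewrite leqNgt cardG_gt0.
move=> leGm nilG; apply/(lcn_nil_classP m nilG).
by move: nilG; rewrite nilpotent_class => lt_n; rewrite -ltnS (leq_trans lt_n).
Qed.

Lemma lcn1_nil m G : 'L_m(G) = 1 -> nilpotent G.
Proof.
case: m => [|m] L1; first by rewrite -[gval G]/('L_0(G)) L1 nilpotent1.
by apply/lcnP; exists m.
Qed.

End OneGroup.

Section FittingSeries.
Variable gT : finGroupType.
Implicit Types G H K L : {group gT}.

Lemma fitting_series_pre G n (H : {group gT}) :
  fitting_series G n = H -> fitting_series G n.+1 = coset H @*^-1 'F(G / H).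
Proof. by rewrite fitting_seriesS => ->. Qed.

Lemma nil_series_fitting G n m : #|G| <= m -> fitting_series G n = G ->
  nil_series m n G = 1.
Proof.
move=> leGm eqFG; suffices sub i : i <= n ->
    nil_series m i G \subset fitting_series G (n - i).
  by apply/trivgP; rewrite (subset_trans (sub n (leqnn n))) // subnn.
elim: i => [|i IHi] ltin; first by rewrite subn0 eqFG.
have [H eqH nHG] := fitting_series_normal_group G (n - i.+1).
have:= IHi (ltnW ltin); rewrite -[n - i]subnSK // (fitting_series_pre eqH) eqH => sub_i.
have sLG := char_sub (nil_series_char m i G).
have nHL: nil_series m i G \subset 'N(H).
  exact: subset_trans sLG (normal_norm nHG).
rewrite nil_seriesS -quotient_sub1 ?(subset_trans (lcn_sub _ _)) //=.
have ->: 'L_m(nil_series m i G) / H = 'L_m(nil_series m i G / H).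
  exact: morphim_lcn.
rewrite lcn_eq1 ?sub1G //.
  by rewrite (leq_trans (leq_quotient _ _)) // (leq_trans (subset_leq_card sLG)).
apply: nilpotentS (Fitting_nil (G / H)).
by rewrite sub_morphim_pre.
Qed.

Lemma fitting_nil_series G n m : nil_series m n G = 1 ->
  fitting_series G n = G.
Proof.
move=> L1; suffices sub i : i <= n ->
    nil_series m (n - i) G \subset fitting_series G i.
  apply/eqP; rewrite eqEsubset normal_sub ?fitting_series_normal //=.
  by have := sub n (leqnn n); rewrite subnn.
elim: i => [|i IHi] ltin; first by rewrite subn0 L1.
have [H eqH nHG] := fitting_series_normal_group G i.
rewrite (fitting_series_pre eqH).
have sLG k := char_sub (nil_series_char m k G).
have nHL k: nil_series m k G \subset 'N(H).
  exact: subset_trans (sLG k) (normal_norm nHG).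
rewrite -(@sub_morphim_pre _ _ _ _ (nil_series m (n - i.+1) G)) // Fitting_max //.
  by rewrite quotient_normal // char_normal ?nil_series_char.
apply: (@lcn1_nil _ m).
have <-: 'L_m(nil_series m (n - i.+1) G) / H = 'L_m(nil_series m (n - i.+1) G / H).
  exact: morphim_lcn (nHL _).
apply/trivgP; rewrite quotient_sub1; last first.
  exact: subset_trans (lcn_sub _ _) (nHL _).
by have := IHi (ltnW ltin); rewrite -eqH -[n - i]subnSK.
Qed.

(** The Fitting series ascends and the series of nilpotent residuals descends
    with nilpotent factors, each as fast as possible, so both need the same
    number of steps.  All bounds on heights are read off the second series. *)
Lemma fitting_height_leP G n m : solvable G -> #|G| <= m ->
  reflect (nil_series m n G = 1) (fitting_height G <= n).
Proof.
move=> solG leGm; have [eqF minF] := fitting_heightP solG.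
apply: (iffP idP) => [le_hn | L1]; last exact/minF/(fitting_nil_series L1).
rewrite -(subnKC le_hn) nil_seriesD (nil_series_fitting leGm eqF).
elim: (n - _) => //= k ->.
by case: m {leGm} => [|m]; rewrite ?lcn0 //; apply/trivgP/lcn_sub.
Qed.

End FittingSeries.

Section HeightTheory.
Variable gT : finGroupType.
Implicit Types G H K L : {group gT}.

Lemma fitting_height_morphim (rT : finGroupType) G (D : {group gT})
    (f : {morphism D >-> rT}) : solvable G -> G \subset D ->
  fitting_height (f @* G) <= fitting_height G.
Proof.
move=> solG sGD.
apply/(fitting_height_leP _ (morphim_sol f solG) (leq_morphim f G)).
have /(fitting_height_leP _ solG (leqnn _)) L1 := leqnn (fitting_height G).
by rewrite -nil_series_morphim // L1 morphim1.
Qed.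

Lemma fitting_height_quo G K : solvable G -> K <| G ->
  fitting_height (G / K) <= fitting_height G.
Proof. by move=> solG nKG; apply: fitting_height_morphim; rewrite ?normal_norm. Qed.

Lemma fitting_height_quo_leP G K n m : solvable G -> K <| G -> #|G| <= m ->
  reflect (nil_series m n G \subset K) (fitting_height (G / K) <= n).
Proof.
move=> solG nKG leGm.
have sLN: nil_series m n G \subset 'N(K).
  exact: subset_trans (char_sub (nil_series_char m n G)) (normal_norm nKG).
apply: (iffP (fitting_height_leP _ (quotient_sol K solG) (leq_trans (leq_quotient _ _) leGm))).
  by rewrite -nil_series_quo ?normal_norm // => L1; rewrite -quotient_sub1 ?L1.
by rewrite -nil_series_quo ?normal_norm // -quotient_sub1 // => /trivgP.
Qed.

(** The residual series of [G] reaches both [K] and [L] within [n] steps. *)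
Lemma fitting_height_capI G K L n : solvable G -> K <| G -> L <| G ->
  K :&: L = 1 -> fitting_height (G / K) <= n -> fitting_height (G / L) <= n ->
  fitting_height G <= n.
Proof.
move=> solG nKG nLG tiKL hK hL.
apply/(fitting_height_leP _ solG (leqnn _))/trivgP; rewrite -tiKL subsetI.
by apply/andP; split; apply/fitting_height_quo_leP.
Qed.

Lemma fitting_height_ext G K : solvable G -> K <| G ->
  fitting_height G <= fitting_height (G / K) + fitting_height K.
Proof.
move=> solG nKG; apply/(fitting_height_leP _ solG (leqnn _))/trivgP.
rewrite /= nil_seriesD; have sKG := normal_sub nKG.
have /(fitting_height_leP _ (solvableS sKG solG) (subset_leq_card sKG))<- := 
  leqnn (fitting_height K).
by apply: nil_seriesS_sub; apply/fitting_height_quo_leP.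
Qed.

Lemma fitting_height_eq0 G : solvable G -> (fitting_height G == 0) = (G :==: 1).
Proof.
move=> solG; rewrite -leqn0.
by apply/(fitting_height_leP 0 solG (leqnn _))/eqP.
Qed.

Lemma fitting_height_nil G : nilpotent G -> fitting_height G <= 1.
Proof.
move=> nilG; apply/(fitting_height_leP 1 (nilpotent_sol nilG) (leqnn _)).
exact: lcn_eq1.
Qed.

Lemma fitting_height_quo_nil G K n : solvable G -> K <| G -> nilpotent K ->
  fitting_height (G / K) <= n -> fitting_height G <= n.+1.
Proof.
move=> solG nKG nilK le_n; apply: leq_trans (fitting_height_ext solG nKG) _.
by rewrite -addn1 leq_add // fitting_height_nil.
Qed.

(** The [n]-th term of the residual series is a nilpotent normal subgroup. *)
Lemma fitting_height_quo_Fitting G n : solvable G ->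
  fitting_height G <= n.+1 -> fitting_height (G / 'F(G)) <= n.
Proof.
move=> solG /(fitting_height_leP _ solG (leqnn _)) L1.
apply/(fitting_height_quo_leP _ solG (Fitting_normal G) (leqnn _)).
have nLG := char_normal (nil_series_char #|G| n G).
exact: Fitting_max nLG (@lcn1_nil _ #|G| (nil_series_group _ _ _) L1).
Qed.

End HeightTheory.

Lemma fitting_height_isog (gT rT : finGroupType) (G : {group gT}) (H : {group rT}) :
  solvable G -> G \isog H -> fitting_height G = fitting_height H.
Proof.
move=> solG isoGH; have solH: solvable H by rewrite -(isog_sol isoGH).
apply/eqP; rewrite eqn_leq; apply/andP; split.
  by have /isogP[f _ <-] := isog_symr isoGH; apply: fitting_height_morphim.
by have /isogP[f _ <-] := isoGH; apply: fitting_height_morphim.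
Qed.

End NilpotentLength.

(** * Half-transitive actions on finite modules *)

Lemma index_le_image (aT : finGroupType) (G K : {group aT}) (rT : finType)
    (f : aT -> rT) (S : {set rT}) : K \subset G ->
  {in G &, forall h k, f h = f k -> h * k^-1 \in K} ->
  (forall h, h \in G -> f h \in S) -> #|G : K| <= #|S|.
Proof.
move=> sKG fK fS.
have rep C : C \in rcosets K G -> repr C \in G /\ K :* repr C = C.
  case/rcosetsP=> x Gx ->; split; last by rewrite rcoset_repr.
  by case: repr_rcosetP => y Ky; rewrite groupM // (subsetP sKG).
rewrite /indexg -(card_in_imset (f := f \o repr)) => [|C D].
  by apply/subset_leq_card/subsetP=> _ /imsetP[C /rep[GC _] ->]; apply: fS.
move=> /rep[GC {2}<-] /rep[GD {2}<-] /= eqf.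
by apply/rcoset_eqP; rewrite mem_rcoset fK.
Qed.

Lemma index2_mem (aT : finGroupType) (G K : {group aT}) g h :
  #|G : K| = 2 -> K \subset G -> g \in G -> g \notin K -> h \in G ->
  h \notin K -> h * g^-1 \in K.
Proof.
move=> iK sKG Gg Kg Gh Kh; rewrite -mem_rcoset.
have sU: K :|: K :* g \subset G.
  rewrite subUset sKG; apply/subsetP=> _ /rcosetP[k Kk ->].
  by rewrite groupM // (subsetP sKG).
have dis: [disjoint K & K :* g].
  rewrite -setI_eq0; apply/set0Pn=> -[x /setIP[Kx]].
  by rewrite mem_rcoset groupMl // groupV (negPf Kg).
have /eqP eqU: K :|: K :* g == G.
  rewrite eqEcard sU -(Lagrange sKG) iK muln2 -addnn -{2}(card_rcoset K g).
  by rewrite -cardsUI disjoint_setI0 // cards0 addn0 /=.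
by move: Gh; rewrite -eqU inE (negPf Kh) /=.
Qed.

Lemma card2_eq (aT : finGroupType) (D : {group aT}) x y : #|D| = 2 ->
  x \in D -> x != 1 -> y \in D -> y != 1 -> y = x.
Proof.
move=> oD Dx ntx Dy nty; have /eqP defD: [set 1; x] == D.
  by rewrite eqEcard oD cards2 eq_sym ntx subUset !sub1set group1 Dx.
by move: Dy; rewrite -defD !inE (negPf nty) => /eqP.
Qed.

(** The group [H] acts on the right on the finite abelian group [V]; later
    [V] is the dual of a minimal normal subgroup. *)
Section HalfTransitive.

Variables (V : finZmodType) (gT : finGroupType) (H : {group gT}).
Variable act : V -> gT -> V.
Implicit Types (u v w : V) (x y : gT) (A B D E K : {group gT}).

Hypothesis act_add : forall x, x \in H -> {morph act^~ x : u v / (u + v)%R}.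
Hypothesis actM : forall v, {in H &, forall x y, act v (x * y) = act (act v x) y}.
Hypothesis act1 : forall v, act v 1 = v.

Definition stab v : {set gT} := [set x in H | act v x == v].

Lemma stabP v x : reflect (x \in H /\ act v x = v) (x \in stab v).
Proof. by rewrite inE; apply: (iffP andP) => -[Hx /eqP]. Qed.

Lemma stab_sub v : stab v \subset H.
Proof. by apply/subsetP=> x /stabP[]. Qed.

Lemma stab_group_set v : group_set (stab v).
Proof.
apply/group_setP; split=> [|x y /stabP[Hx vx] /stabP[Hy vy]].
  by apply/stabP; rewrite act1.
by apply/stabP; rewrite groupM // actM // vx.
Qed.
Canonical stab_group v := Group (stab_group_set v).

Lemma act0 x : x \in H -> act 0%R x = 0%R.
Proof. by move=> Hx; apply: (addrI (act 0%R x)); rewrite -act_add // !addr0. Qed.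

Lemma act_opp v x : x \in H -> act (- v)%R x = (- act v x)%R.
Proof. by move=> Hx; apply: (addrI (act v x)); rewrite -act_add // !subrr act0. Qed.

Lemma act_sub u v x : x \in H -> act (u - v)%R x = (act u x - act v x)%R.
Proof. by move=> Hx; rewrite act_add ?act_opp. Qed.

Lemma act_muln v n x : x \in H -> act (v *+ n)%R x = (act v x *+ n)%R.
Proof. by move=> Hx; elim: n => [|n IHn]; rewrite ?act0 // !mulrS act_add ?IHn. Qed.

Lemma act_sum (I : finType) (P : pred I) (F : I -> V) x : x \in H ->
  act (\sum_(i | P i) F i)%R x = (\sum_(i | P i) act (F i) x)%R.
Proof.
move=> Hx.
exact: (big_morph (act^~ x) (fun u v => act_add Hx u v) (act0 Hx)).
Qed.

Lemma actK v x : x \in H -> act (act v x) x^-1 = v.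
Proof. by move=> Hx; rewrite -actM ?groupV // mulgV act1. Qed.

Lemma actKV v x : x \in H -> act (act v x^-1) x = v.
Proof. by move=> Hx; rewrite -actM ?groupV // mulVg act1. Qed.

Lemma act_inj x : x \in H -> injective (act^~ x).
Proof. by move=> Hx u v /= eq_uv; rewrite -(actK u Hx) eq_uv actK. Qed.

Lemma act_eq0 v x : x \in H -> (act v x == 0%R) = (v == 0%R).
Proof. by move=> Hx; rewrite -{1}(act0 Hx) (inj_eq (act_inj Hx)). Qed.

Lemma stabJ v x : x \in H -> stab (act v x) = stab v :^ x.
Proof.
move=> Hx; apply/setP=> y; rewrite mem_conjg.
apply/stabP/stabP=> -[Hy vy]; split.
- by rewrite groupJ ?groupV.
- rewrite conjgE invgK !actM ?groupM ?groupV //.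
  by rewrite vy actK.
- by rewrite -(groupJr _ (groupVr Hx)).
have Hyx := Hy; rewrite groupJr ?groupV // in Hyx.
apply: (act_inj (groupVr Hx)) => /=; rewrite actK // -!actM ?groupM ?groupV //.
by rewrite -[RHS]vy conjgE invgK !mulgA.
Qed.

Lemma act_fix A v x : A \subset stab v -> x \in A -> act v x = v.
Proof. by move=> /subsetP fixA /fixA/stabP[]. Qed.

Lemma fix_cent A v x : A \subset stab v -> x \in H -> x \in 'C(A) ->
  A \subset stab (act v x).
Proof.
move=> fixA Hx cAx; rewrite stabJ //.
by rewrite -(normP (subsetP (cent_sub A) x cAx)) conjSg.
Qed.

Lemma fixD A u v : A \subset stab u -> A \subset stab v ->
  A \subset stab (u + v)%R.
Proof.
move=> /subsetP fu /subsetP fv; apply/subsetP=> x Ax.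
have [[Hx ux] [_ vx]] := (stabP u x (fu x Ax), stabP v x (fv x Ax)).
by apply/stabP; rewrite act_add // ux vx.
Qed.

Lemma fix0 A : A \subset H -> A \subset stab 0%R.
Proof.
by move=> /subsetP sAH; apply/subsetP=> x /sAH Hx; apply/stabP; rewrite act0.
Qed.

Lemma fix_muln A v n : A \subset stab v -> A \subset stab (v *+ n)%R.
Proof.
move=> /subsetP fv; apply/subsetP=> x /fv/stabP[Hx vx].
by apply/stabP; rewrite act_muln ?vx.
Qed.

Lemma fix_opp A v : A \subset stab v -> A \subset stab (- v)%R.
Proof.
move=> /subsetP fv; apply/subsetP=> x /fv/stabP[Hx vx].
by apply/stabP; rewrite act_opp ?vx.
Qed.

(** The norm map of [<[c]>] if [c ^+ n = 1].  The sum runs over exponents so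
    that the norms of the elements [c * z ^+ i] have matching terms. *)
Definition pi n c v : V := (\sum_(i < n) act v (c ^+ i))%R.

Section Pi.
Variables (n : nat) (c : gT).
Hypothesis Hc : c \in H.

Lemma pi_fix v : c ^+ n = 1 -> act (pi n c v) c = pi n c v.
Proof.
rewrite /pi; case: n => [|m] cn1; first by rewrite big_ord0 act0.
rewrite act_sum // [LHS]big_ord_recr [RHS]big_ord_recl /= addrC.
rewrite -actM ?groupX // -expgSr cn1 expg0 act1; congr (_ + _)%R; apply: eq_bigr => i _.
by rewrite -actM ?groupX // -expgSr.
Qed.

Lemma pi_cent v : act v c = v -> pi n c v = (v *+ n)%R.
Proof.
move=> vc; rewrite /pi (eq_bigr (fun=> v)) => [|i _].
  by rewrite sumr_const card_ord.
have Sc: c \in stab v by apply/stabP.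
by have /stabP[] := groupX i Sc.
Qed.

Lemma pi_add u v : pi n c (u + v)%R = (pi n c u + pi n c v)%R.
Proof. by rewrite -big_split; apply: eq_bigr => i _; rewrite act_add ?groupX. Qed.

Lemma pi_opp v : pi n c (- v)%R = (- pi n c v)%R.
Proof. by rewrite -sumrN; apply: eq_bigr => i _; rewrite act_opp ?groupX. Qed.

Lemma pi_muln v m : pi n c (v *+ m)%R = (pi n c v *+ m)%R.
Proof. by rewrite -sumrMnl; apply: eq_bigr => i _; rewrite act_muln ?groupX. Qed.

Lemma pi_act v x : x \in H -> act (pi n c v) x = pi n (c ^ x) (act v x).
Proof.
move=> Hx; rewrite /pi act_sum //; apply: eq_bigr => i _.
by rewrite -!actM ?groupX ?groupJ // -conjXg -conjgC.
Qed.

Lemma pi_tel v : c ^+ n = 1 -> pi n c (v - act v c)%R = 0%R.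
Proof.
move=> cn1; rewrite pi_add pi_opp -{1}(pi_fix v cn1) pi_act //.
by rewrite conjgE mulKg subrr.
Qed.

Lemma fix_pi A v : c \in 'N(A) -> A \subset stab v -> A \subset stab (pi n c v).
Proof.
move=> nAc fv; apply/subsetP=> x Ax; have /stabP[Hx _] := subsetP fv x Ax.
apply/stabP; split=> //; rewrite act_sum //; apply: eq_bigr => i _.
have nAci: c ^+ i \in 'N(A) by rewrite groupX.
have: x \in stab (act v (c ^+ i)).
  rewrite stabJ ?groupX //; rewrite -(normP nAci) in Ax.
  by apply: subsetP Ax; rewrite conjSg.
by case/stabP.
Qed.

End Pi.

Lemma pi_exp q m z w : prime q -> z \in H -> z ^+ q = 1 -> coprime q m ->
  pi q (z ^+ m) w = pi q z w.
Proof.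
move=> pr_q Hz zq1 co_m; have q_gt0 := prime_gt0 pr_q.
pose h (i : 'I_q) := Ordinal (ltn_pmod (i * m) q_gt0).
have h_inj: injective h.
  move=> i j /(congr1 val)/= eq_ij; wlog le_ij: i j eq_ij / i <= j.
    by move=> IH; case/orP: (leq_total i j) => le_ij; [|symmetry]; apply: IH.
  move/esym/eqP: eq_ij; rewrite eqn_mod_dvd ?leq_mul // -mulnBl Gauss_dvdl //.
  have lt_ji: j - i < q by rewrite (leq_ltn_trans (leq_subr _ _)).
  rewrite /dvdn modn_small // subn_eq0 => le_ji.
  by apply/val_inj/eqP; rewrite eqn_leq le_ij.
rewrite /pi [RHS](reindex_inj h_inj); apply: eq_bigr => i _ /=.
by rewrite expg_mod // mulnC expgM.
Qed.

(** The terms of exponent [0 < m] add up to a translate of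
    [pi q (z ^+ m) w = pi q z w = 0], those of exponent 0 to [w *+ q].  So a
    vector killed by the norm of [z] is, up to the factor [q], a sum of
    vectors fixed by the elements [c * z ^+ i]. *)
Lemma pi_sum q c z w : prime q -> c \in H -> z \in H -> commute c z ->
    z ^+ q = 1 -> pi q z w = 0%R ->
  (\sum_(i < q) pi q (c * z ^+ i)%g w)%R = (w *+ q)%R.
Proof.
move=> pr_q Hc Hz ccz zq1 piz0; have q_gt0 := prime_gt0 pr_q.
rewrite exchange_big /= (bigD1 (Ordinal q_gt0)) //= [X in (_ + X)%R]big1 => [|m nz_m].
  rewrite addr0 (eq_bigr (fun=> w)) => [|i _]; last by rewrite expg0 act1.
  by rewrite sumr_const card_ord.
have co_m: coprime q m.
  rewrite prime_coprime // gtnNdvd ?ltn_ord // lt0n.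
  by apply: contra nz_m => /eqP m0; apply/eqP/val_inj.
transitivity (act (pi q (z ^+ m) w) (c ^+ m)); last first.
  by rewrite pi_exp // piz0 act0 ?groupX.
rewrite act_sum ?groupX //; apply: eq_bigr => i _.
rewrite -actM ?groupX // expgMn; last exact: commuteX.
rewrite -!expgM mulnC; congr (act w _).
by apply: commuteX; apply/commute_sym/commuteX/commute_sym.
Qed.

(** A subgroup of index [q] will be called a hyperplane.  If [E] fixes no
    nonzero vector, then [V] is generated, up to division by [q], by vectors
    that are fixed by hyperplanes.  Indeed, if [w] is fixed by a [D] of larger
    index, take [z] and [c] in [E] independent modulo [D].  Then [w *+ q] is
    the sum of [pi q z w], which is fixed by [D <*> <[z]>], and of a vector
    killed by the norm of [z], to which [pi_sum] applies. *)
Lemma abelem_ind q E (P : V -> Prop) : prime q -> q.-abelem E -> E \subset H ->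
    (forall v, E \subset stab v -> v = 0%R) -> P 0%R ->
    (forall u v, P u -> P v -> P (u + v)%R) -> (forall v, P (v *+ q)%R -> P v) ->
    (forall D v, D \subset E -> #|E : D| = q -> D \subset stab v -> P v) ->
  forall v, P v.
Proof.
move=> pr_q abE sEH fpf P0 PD Pq PI v.
have /abelemP[//|cEE expE] := abE.
suffices IH m D w : #|E| < m + #|D| -> D \subset E -> D \subset stab w -> P w.
  by apply: (IH #|E| 1%G); rewrite ?sub1G // cards1 addn1.
elim: m D w => [|m IHm] D w lt_m sDE fw.
  by rewrite ltnNge subset_leq_card in lt_m.
have [sED | /subsetPn[z Ez Dz]] := boolP (E \subset D).
  by rewrite (fpf w) // (subset_trans sED).
have Hz := subsetP sEH z Ez.
have zq1 := expE z Ez.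
have oz: #[z] = q.
  apply/prime_nt_dvdP; rewrite ?order_dvdn ?zq1 // order_eq1.
  by apply: contraNneq Dz => ->.
have cent_E x y : x \in E -> y \in E -> commute x y.
  by move=> Ex Ey; apply: (centsP cEE).
have nE x A : x \in E -> A \subset E -> x \in 'N(A).
  move=> Ex sAE; apply: (subsetP (cent_sub A)); apply/centP=> y Ay.
  by apply: cent_E => //; apply: (subsetP sAE).
have IHx x u : x \in E -> x \notin D -> D \subset stab u -> act u x = u -> P u.
  move=> Ex Dx fu ux; apply: (IHm (D <*> <[x]>)%G).
  - apply: leq_trans lt_m _; rewrite addSnnS leq_add2l.
    rewrite proper_card // properE joing_subl; apply: contra Dx => /subsetP-> //.
    by rewrite mem_gen // inE cycle_id orbT.
  - by rewrite join_subG sDE cycle_subG.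
  rewrite join_subG fu cycle_subG; apply/stabP; split=> //.
  exact: subsetP sEH x Ex.
have [/eqP idx | neq_q] := boolP (#|E : D| == q); first exact: PI idx fw.
have: ~~ (E \subset D <*> <[z]>).
  apply: contra neq_q => sEDz; have nDz: <[z]> \subset 'N(D) by rewrite cycle_subG nE.
  have defE: E :=: D <*> <[z]>.
    by apply/eqP; rewrite eqEsubset sEDz join_subG sDE cycle_subG.
  have tiDz: D :&: <[z]> = 1.
    by rewrite setIC prime_TIg -?orderE ?oz // cycle_subG.
  rewrite -divgS // defE norm_joinEr // TI_cardMg // -orderE oz.
  by rewrite mulKn ?cardG_gt0.
case/subsetPn=> c Ec Dzc; have Hc := subsetP sEH c Ec.
have Pz u : D \subset stab u -> P (pi q z u).
  move=> fu; apply: (IHx z) => //; first exact: fix_pi (nE _ _ Ez sDE) fu.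
  exact: pi_fix.
suffices: P (w *+ q - pi q z w)%R.
  by move=> Pw; apply: Pq; rewrite -[(_ *+ _)%R](subrK (pi q z w)); apply: PD; auto.
apply: (Pq); rewrite -(pi_sum pr_q Hc Hz (cent_E c z Ec Ez) zq1); last first.
  by rewrite pi_add // pi_opp // pi_muln // (pi_cent q Hz (pi_fix Hz w zq1)) subrr.
set w' := (_ - _)%R.
have fw': D \subset stab w'.
  apply: fixD; first exact: fix_muln.
  by apply: fix_opp; apply: fix_pi (nE _ _ Ez sDE) fw.
elim/big_ind: _ => // i _.
have Eci: c * z ^+ i \in E by rewrite groupM ?groupX.
have Hci := subsetP sEH _ Eci.
apply: (IHx _ _ Eci).
- apply: contra Dzc => Dci; rewrite -(mulgK (z ^+ i) c).
  by rewrite groupM ?groupV ?groupX // mem_gen // inE ?Dci ?cycle_id ?orbT.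
- exact: fix_pi (nE _ _ Eci sDE) fw'.
by apply: pi_fix => //; rewrite expE.
Qed.

Definition nrm (A : {set gT}) v : V := (\sum_(a in A) act v a)%R.

Lemma nrm_act A v x : A \subset H -> x \in H ->
  act (nrm A v) x = nrm (A :^ x) (act v x).
Proof.
move=> /subsetP sAH Hx; rewrite /nrm act_sum // [RHS](reindex_inj (conjg_inj x)) /=.
apply: eq_big => [a|a /sAH Ha]; first by rewrite memJ_conjg.
by rewrite -!actM ?groupJ // -conjgC.
Qed.

Lemma fix_nrm A v : A \subset H -> A \subset stab (nrm A v).
Proof.
move=> sAH; apply/subsetP=> x Ax; have Hx := subsetP sAH x Ax.
apply/stabP; split=> //; rewrite /nrm act_sum // [RHS](reindex_inj (mulIg x)) /=.
apply: eq_big => [a|a Aa]; first by rewrite groupMr.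
by rewrite -actM ?(subsetP sAH).
Qed.

Lemma nrm_cent A v : A \subset stab v -> nrm A v = (v *+ #|A|)%R.
Proof.
move=> fv; rewrite /nrm (eq_bigr (fun=> v)) ?sumr_const // => a Aa.
exact: act_fix Aa.
Qed.

Section Primes.

Hypothesis faith : forall x, x \in H -> (forall v, act v x = v) -> x = 1.
Hypothesis fpf : forall K, K <| H -> K :!=: 1 ->
  forall v, K \subset stab v -> v = 0%R.
Hypothesis half : forall u v, u <> 0%R -> v <> 0%R -> #|stab u| = #|stab v|.

Variable q : nat.
Hypothesis pr_q : prime q.
Hypothesis divq : forall v, (v *+ q)%R = 0%R -> v = 0%R.

Lemma divqX v n : (v *+ (q ^ n))%R = 0%R -> v = 0%R.
Proof.
elim: n => [|n IHn]; first by rewrite expn0.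
by rewrite expnS mulnC mulrnA => /divq.
Qed.

Lemma divq_group A v : q.-group A -> (v *+ #|A|)%R = 0%R -> v = 0%R.
Proof. by move=> qA; rewrite (card_pgroup qA) => /divqX. Qed.

(** A Sylow [q]-subgroup of the stabilizer of [u] is as large as a [q]-group
    fixing a nonzero vector can be. *)
Lemma stab_Sylow_max u v (P R : {group gT}) : u <> 0%R -> v <> 0%R ->
  q.-Sylow(stab u) P -> q.-group R -> R \subset stab v -> P \subset R ->
  R \subset P.
Proof.
move=> nz_u nz_v sylP qR sRv sPR; have [S sylS sRS] := Sylow_superset sRv qR.
have/eqP eqPR: P :==: R; last by rewrite eqPR.
rewrite eqEcard sPR (leq_trans (subset_leq_card sRS)) //.
by rewrite (card_Hall sylS) (card_Hall sylP) (half nz_u nz_v).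
Qed.

Section NormalAbelem.

Variable E : {group gT}.
Hypotheses (nEH : E <| H) (abE : q.-abelem E) (ntE : E :!=: 1).

Let sEH := normal_sub nEH.
Let cEE := abelem_abelian abE.
Let qE := abelem_pgroup abE.

Lemma index_q_eq D K : D \subset K -> K \subset E -> #|E : D| = q ->
  ~~ (K \subset D) -> K :=: E.
Proof.
move=> sDK sKE iD nsKD; apply/eqP; rewrite eqEsubset sKE /=.
have sDE := subset_trans sDK sKE.
have iKD: (#|E : K| * #|K : D|)%N = q by rewrite Lagrange_index.
have : #|K : D| != 1%N by rewrite indexg_eq1.
have/primeP[_ /(_ #|K : D|)] := pr_q.
rewrite -{1}iKD dvdn_mull // => /(_ isT)/orP[/eqP-> // | /eqP eq_q _].
move: iKD; rewrite eq_q -{2}(mul1n q) => /eqP; rewrite eqn_pmul2r ?prime_gt0 //.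
by rewrite indexg_eq1.
Qed.

(** Two different hyperplanes generate [E]. *)
Lemma hyper_disjoint D D' v : D \subset E -> D' \subset E ->
  #|E : D| = q -> #|E : D'| = q -> D :!=: D' ->
  D \subset stab v -> D' \subset stab v -> v = 0%R.
Proof.
move=> sDE sD'E iD iD' neqD fD fD'; apply: (fpf nEH ntE).
rewrite -(@index_q_eq D (D <*> D')%G) ?joing_subl ?join_subG ?sDE ?fD //.
apply: contra neqD => /andP[_ sD'D]; rewrite eq_sym eqEcard sD'D /=.
by rewrite -(leq_pmul2r (prime_gt0 pr_q)) -{1}iD -{1}iD' !Lagrange /= ?leqnn.
Qed.

(** For [D != D'] the norm is fixed by both hyperplanes. *)
Lemma nrm_hyper D D' v : D \subset E -> D' \subset E ->
  #|E : D| = q -> #|E : D'| = q -> D \subset stab v ->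
  nrm D' v = (if D :==: D' then v *+ #|D'| else 0)%R.
Proof.
move=> sDE sD'E iD iD' fD; case: ifPn => [/eqP eqD | neqD].
  by rewrite nrm_cent // -eqD.
have sD'H := subset_trans sD'E sEH.
apply: (hyper_disjoint sDE sD'E) => //; last exact: fix_nrm.
apply: (big_ind (fun w => D \subset stab w)) => [|u w|a D'a].
- exact: fix0 (subset_trans sDE sEH).
- exact: fixD.
apply: fix_cent; rewrite ?(subsetP sD'H) //.
by apply: (subsetP (centSS sD'E sDE cEE)).
Qed.

(** By [nrm_hyper] the norm over [D i] extracts [l i *+ #|D i|] from the sum of
    the [l j], so an element fixing the sum permutes its components. *)
Lemma hyper_perm (I : finType) (D : I -> {group gT}) (l : I -> V) h i :
    (forall i, [/\ D i \subset E, #|E : D i| = q, D i \subset stab (l i) & l i <> 0%R]) ->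
    (forall i j, D i :=: D j -> i = j) ->
    h \in stab (\sum_i l i)%R ->
  exists2 j, D i :^ h = D j & act (l i) h = l j.
Proof.
move=> hD injD /stabP[Hh fh]; have [sDE iD fD nzl] := hD i.
have nEh: h \in 'N(E) by apply: (subsetP (normal_norm nEH)).
have sDhE: D i :^ h \subset E by rewrite -(normP nEh) conjSg.
have iDh: #|E : D i :^ h| = q by rewrite -{1}(normP nEh) indexJg.
have nrm_l (K : {group gT}) : K \subset E -> #|E : K| = q ->
    nrm K (\sum_j l j)%R = (\sum_(j | D j :==: K) l j *+ #|K|)%R.
  move=> sKE iK; rewrite [RHS]big_mkcond /nrm.
  transitivity (\sum_j nrm K (l j))%R.
    rewrite exchange_big /=; apply: eq_bigr => a Ka.
    by rewrite act_sum // (subsetP (subset_trans sKE sEH)).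
  by apply: eq_bigr => j _; have [? ? ? _] := hD j; apply: nrm_hyper.
have def_l: act (l i *+ #|D i|)%R h = nrm (D i :^ h) (\sum_j l j)%R.
  rewrite -[in RHS]fh -nrm_act ?(subset_trans sDE) // nrm_l //.
  rewrite (big_pred1 i) // => j /=; apply/eqP/eqP=> [/injD | -> //] //.
have nz_li: act (l i *+ #|D i|)%R h <> 0%R.
  move/eqP; rewrite act_eq0 // => /eqP/(divq_group (pgroupS sDE qE)).
  exact: nzl.
have [j /eqP eqDj | noj] := pickP (fun j => D j :==: D i :^ h); last first.
  by case: nz_li; rewrite def_l (nrm_l (D i :^ h)%G) // big_pred0.
exists j => //; move: def_l; rewrite (nrm_l (D i :^ h)%G) //= (big_pred1 j) => [|k]; last first.
  by rewrite /= -eqDj; apply/eqP/eqP=> [/injD | -> //].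
rewrite act_muln // cardJg => eql; apply/eqP; rewrite -subr_eq0; apply/eqP.
apply: (divq_group (pgroupS sDE qE)); rewrite mulrnBl eql subrr //.
Qed.

(** Otherwise [e] would fix all vectors that are fixed by some hyperplane, and
    then all of [V] by [abelem_ind]. *)
Lemma hyper_exists e : e \in E -> e != 1 ->
  exists D v, [/\ D \subset E, #|E : D| = q, D \subset stab v & v <> 0%R]
           /\ e \notin D.
Proof.
move=> Ee nte; pose good := [exists D : {group gT}, exists v : V,
  [&& D \subset E, #|E : D| == q, D \subset stab v, v != 0%R & e \notin D]].
have [/existsP[D /existsP[v /and5P[sDE /eqP iD fD /eqP nzv De]]] | bad] := boolP good.
  by exists D, v.
have He := subsetP sEH e Ee.
case/eqP: nte; apply: faith => //.
apply: (abelem_ind pr_q abE sEH) => [v|||v|D v sDE iD fD].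
- exact: fpf.
- exact: act0.
- by move=> u v eu ev; rewrite act_add // eu ev.
- rewrite act_muln // => eqv; apply/eqP; rewrite -subr_eq0; apply/eqP/divq.
  by rewrite mulrnBl eqv subrr.
have [-> | nzv] := eqVneq v 0%R; first exact: act0.
have [De | De] := boolP (e \in D); first exact: act_fix De.
case/negP: bad; apply/existsP; exists D; apply/existsP; exists v.
by rewrite sDE iD eqxx fD nzv.
Qed.

Lemma two_hypers : #|E| != q ->
  exists D1 D2 v1 v2,
    [/\ [/\ D1 \subset E, #|E : D1| = q, D1 \subset stab v1 & v1 <> 0%R],
        [/\ D2 \subset E, #|E : D2| = q, D2 \subset stab v2 & v2 <> 0%R]
      & ~~ (D1 \subset D2)].
Proof.
move=> neqE; have [e1 Ee1 nt1] := trivgPn _ ntE.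
have [D1 [v1 [[sD1 iD1 fD1 nzv1] D1e1]]] := hyper_exists Ee1 nt1.
have /trivgPn[e2 D1e2 nt2]: D1 :!=: 1.
  by apply: contra neqE => /eqP D11; rewrite -iD1 D11 indexg1.
have [D2 [v2 [[sD2 iD2 fD2 nzv2] D2e2]]] := hyper_exists (subsetP sD1 _ D1e2) nt2.
exists D1, D2, v1, v2; split=> //; apply: contra D2e2 => /subsetP-> //.
Qed.

Lemma hyper_perm2 D1 D2 v1 v2 h :
    [/\ D1 \subset E, #|E : D1| = q, D1 \subset stab v1 & v1 <> 0%R] ->
    [/\ D2 \subset E, #|E : D2| = q, D2 \subset stab v2 & v2 <> 0%R] ->
    D1 :!=: D2 -> h \in stab (v1 + v2)%R ->
    [/\ D1 :^ h = D1, D2 :^ h = D2, act v1 h = v1 & act v2 h = v2]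
 \/ [/\ D1 :^ h = D2, D2 :^ h = D1, act v1 h = v2 & act v2 h = v1].
Proof.
move=> hD1 hD2 neqD fh.
pose D (b : bool) := if b then D1 else D2; pose l (b : bool) := if b then v1 else v2.
have sum_l: (\sum_b l b = v1 + v2)%R by rewrite big_bool.
have hD b : [/\ D b \subset E, #|E : D b| = q, D b \subset stab (l b) & l b <> 0%R].
  by case: b.
have injD b c : D b :=: D c -> b = c.
  by case: b c => -[] //= eqD; case/eqP: neqD.
have fl: h \in stab (\sum_b l b)%R by rewrite sum_l.
have [b1 /= Db1 lb1] := hyper_perm true hD injD fl.
have [b2 /= Db2 lb2] := hyper_perm false hD injD fl.
have neqb: b1 != b2.
  apply: contra neqD => /eqP eqb; move: Db1; rewrite eqb -Db2.
  by move/conjsg_inj=> ->.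
by case: b1 b2 neqb Db1 lb1 Db2 lb2 => -[] //= _ -> -> -> ->; [left | right].
Qed.

(** Let [v1] and [v2] be nonzero vectors fixed by different hyperplanes [D1] and
    [D2].  A Sylow [q]-subgroup [P] of the stabilizer of [v1 + v2] permutes
    [v1] and [v2], so it fixes both, as [q] is odd.  Then [P <*> D1] is a
    [q]-group fixing [v1], and it is contained in [P] by [stab_Sylow_max].
    Thus [D1] fixes [v2], and so does [D1 <*> D2 = E]. *)
Lemma odd_normal_abelem : odd q -> #|E| = q.
Proof.
move=> odd_q; apply/eqP/idPn=> /two_hypers[D1 [D2 [v1 [v2 [hD1 hD2 nsD12]]]]].
have neqD: D1 :!=: D2 by apply: contra nsD12 => /eqP->.
have [[sD1 iD1 fD1 nzv1] [sD2 iD2 fD2 nzv2]] := (hD1, hD2).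
have nzv: (v1 + v2)%R <> 0%R.
  move/eqP; rewrite addr_eq0 => /eqP eqv; apply: nzv1.
  apply: (hyper_disjoint sD1 sD2) => //; rewrite eqv; exact: fix_opp.
have [P sylP] := Sylow_exists q (stab_group (v1 + v2)%R).
have [sPT qP _] := and3P sylP.
have Pfix h : h \in P -> [/\ D1 :^ h = D1, act v1 h = v1 & act v2 h = v2].
  move=> Ph; have Th := subsetP sPT h Ph.
  have [[] // | [D1h D2h v1h v2h]] := hyper_perm2 hD1 hD2 neqD Th.
  have Hh: h \in H by case/stabP: Th.
  have: h \in <[h ^+ 2]>.
    have -> : <[h ^+ 2]> = <[h]>; last exact: cycle_id.
    apply/esym/eqP; rewrite -[_ == _]/(generator <[h]> (h ^+ 2)) generator_coprime.
    have qh: q.-elt h := mem_p_elt qP Ph.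
    have [n ->] := p_natP qh.
    by rewrite coprimeXl // coprimen2.
  have v1hh: h ^+ 2 \in stab v1.
    by apply/stabP; rewrite groupX // expgS actM ?expg1 // v1h v2h.
  rewrite -cycle_subG in v1hh; move/(subsetP v1hh)=> /stabP[_ v1h1].
  case: nzv1; apply: (hyper_disjoint sD1 sD2) => //.
  by rewrite -v1h1 v1h.
have nD1P: P \subset 'N(D1) by apply/subsetP=> h /Pfix[? _ _]; apply/normP.
have sD1P: P <*> D1 \subset P.
  apply: (@stab_Sylow_max _ _ P (P <*> D1)%G nzv nzv1 sylP) (joing_subl _ _).
    rewrite /= norm_joinEl // pgroupM qP (pgroupS sD1) //.
  rewrite join_subG fD1 andbT; apply/subsetP=> h Ph.
  have [_ v1h _] := Pfix h Ph; apply/stabP; split=> //.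
  by apply: (subsetP (subset_trans sPT _)) Ph; apply: stab_sub.
case: nzv2; apply: (hyper_disjoint sD1 sD2) => //; apply/subsetP=> h D1h.
have Ph: h \in P by rewrite (subsetP sD1P) // mem_gen // inE D1h orbT.
have [_ _ v2h] := Pfix h Ph; apply/stabP; split=> //.
exact: (subsetP (subset_trans sD1 sEH)).
Qed.

Section Even.

Hypothesis q2 : q = 2.

Let hyper D v := [/\ D \subset E, #|E : D| = q, D \subset stab v & v <> 0%R].

Let inH e : e \in E -> e \in H. Proof. exact: subsetP. Qed.

Let ccE d e : d \in E -> e \in E -> commute d e.
Proof. by move=> Ed Ee; apply: (centsP cEE). Qed.

Let addvv v : (v + v)%R = 0%R -> v = 0%R.
Proof. by rewrite -mulr2n -[in X in (_ *+ X)%R]q2; apply: divq. Qed.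

Let opp_neq v : v <> 0%R -> v <> (- v)%R.
Proof. by move=> nzv vv; apply/nzv/addvv; rewrite {2}vv subrr. Qed.

(** The vector [v + act v e] is fixed by [D] and by the involution [e], which
    generate [E]. *)
Let hyper_neg D v e : D \subset E -> #|E : D| = q -> D \subset stab v ->
  e \in E -> e \notin D -> act v e = (- v)%R.
Proof.
move=> sDE iD fD Ee De; have e2 : e ^+ 2 = 1 by case/abelemP: abE => // _; rewrite q2; apply.
suffices: pi 2 e v = 0%R.
  rewrite /pi !big_ord_recr big_ord0 /= add0r expg0 act1 expg1 => /eqP.
  by rewrite addrC addr_eq0 => /eqP.
apply: (fpf nEH ntE).
rewrite -(@index_q_eq D (D <*> <[e]>)%G) ?joing_subl ?join_subG ?sDE ?cycle_subG //.
  rewrite fix_pi ?inH //=; first by apply/stabP; rewrite pi_fix ?inH.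
  by apply: (subsetP (cent_sub D)); apply/centP=> d Dd; apply: ccE Ee (subsetP sDE d Dd).
by rewrite negb_and De orbT.
Qed.

Section Pair.

Variables (D1 D2 : {group gT}).
Hypothesis neqD : D1 :!=: D2.

Section Vectors.
Variables v1 v2 : V.
Hypotheses (hD1 : hyper D1 v1) (hD2 : hyper D2 v2).

Let T12 := (stab v1 :&: stab v2)%G.

Let ex_d : exists2 d, d \in D1 & d \notin D2.
Proof.
have [[sD1 iD1 _ _] [sD2 iD2 _ _]] := (hD1, hD2).
apply/subsetPn; apply: contra neqD => sD12; rewrite eqEcard sD12.
by rewrite -(leq_pmul2r (prime_gt0 pr_q)) -{1}iD2 -{1}iD1 !Lagrange ?leqnn.
Qed.

Let nzv12 : (v1 + v2)%R <> 0%R.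
Proof.
have [[sD1 iD1 fD1 nzv1] [sD2 iD2 fD2 nzv2]] := (hD1, hD2).
move/eqP; rewrite addr_eq0 => /eqP eqv; apply: nzv1.
apply: (hyper_disjoint sD1 sD2) => //; rewrite eqv; exact: fix_opp.
Qed.

(** The stabilizer of [v1 + v2] permutes [v1] and [v2], so the pointwise
    stabilizer of both has index at most 2 in it.  By half-transitivity this
    index is also [#|stab v1 : stab v1 :&: stab v2|], which is at least 2,
    because an element of [D1] outside [D2] negates [v2]. *)
Lemma pair_index : #|stab v1 : stab v1 :&: stab v2| = 2 /\
  exists g, [/\ g \in stab (v1 + v2)%R, act v1 g = v2 & act v2 g = v1].
Proof.
have [[sD1 iD1 fD1 nzv1] [sD2 iD2 fD2 nzv2]] := (hD1, hD2).
have [d D1d D2d] := ex_d.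
have sT12: T12 \subset stab_group (v1 + v2)%R.
  apply/subsetP=> h /setIP[/stabP[Hh h1] /stabP[_ h2]].
  by apply/stabP; rewrite act_add // h1 h2.
have le2: #|stab_group (v1 + v2)%R : T12| <= 2.
  apply: (@leq_trans #|[set v1; v2]|); last by rewrite cards2; case: (_ != _).
  apply: (@index_le_image _ (stab_group _) T12 _ (act v1)) => [//|h k Th Tk | h Th].
    have [[Hh fh] [Hk fk]] := (stabP _ _ Th, stabP _ _ Tk).
    move=> eqf; have v1hk: act v1 (h * k^-1) = v1.
      by rewrite actM ?groupV // eqf actK.
    apply/setIP; split; apply/stabP; split; rewrite ?groupM ?groupV //.
    apply: (addrI v1); rewrite -{1}v1hk -act_add ?groupM ?groupV //.
    by rewrite actM ?groupV // fh -{1}fk actK.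
  rewrite !inE; have [[_ _ -> _]|[_ _ -> _]] := hyper_perm2 hD1 hD2 neqD Th.
    by rewrite eqxx.
  by rewrite eqxx orbT.
have eqT: #|stab_group (v1 + v2)%R : T12| = #|stab_group v1 : T12|.
  by rewrite -!divgS ?subsetIl //= (half nzv12 nzv1).
have ge2: 1 < #|stab_group v1 : T12|.
  rewrite indexg_gt1; apply/subsetPn; exists d; first exact: subsetP fD1 d D1d.
  rewrite inE (subsetP fD1) //=; apply/negP=> /stabP[Hd]; 
  rewrite (hyper_neg sD2 iD2 fD2) ?(subsetP sD1) // => /esym.
  exact: opp_neq.
split; first by apply/eqP; rewrite eqn_leq -[X in _ && X]/(1 < #|stab_group v1 : T12|) ge2
   -[X in X <= 2]/(#|stab_group v1 : T12|) -eqT le2.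
have: ~~ (stab_group (v1 + v2)%R \subset T12) by rewrite -indexg_gt1 eqT.
case/subsetPn=> g Tg T12g; exists g.
have [[_ _ h1 h2]|[_ _ h1 h2]] := hyper_perm2 hD1 hD2 neqD Tg; last by split.
case/negP: T12g; have [Hg _] := stabP _ _ Tg.
by apply/setIP; split; apply/stabP.
Qed.

(** Modulo [stab v1 :&: stab v2], [h] is trivial or equal to an element of [D1]
    outside [D2], which negates [v2]. *)
Lemma pair_sign h : h \in stab v1 -> act v2 h = v2 \/ act v2 h = (- v2)%R.
Proof.
move=> Th; have [[sD1 iD1 fD1 nzv1] [sD2 iD2 fD2 nzv2]] := (hD1, hD2).
have [iT _] := pair_index; have [d D1d D2d] := ex_d.
have Td := subsetP fD1 d D1d; have Ed := subsetP sD1 d D1d.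
have v2d := hyper_neg sD2 iD2 fD2 Ed D2d.
have [T12h | T12h] := boolP (h \in T12); first by left; case/setIP: T12h => _ /stabP[].
right; have nT12: T12 <| stab_group v1 by rewrite index2_normal ?subsetIl.
have T12d: d \notin T12.
  rewrite inE Td /=; apply/negP=> /stabP[_]; rewrite v2d => /esym.
  exact: opp_neq.
have [Hh _] := stabP _ _ Th; have Hd := inH Ed.
have : h * d^-1 \in T12 by apply: index2_mem iT _ _ _ _ _ => //; apply: subsetIl.
case/setIP=> _ /stabP[_]; rewrite actM ?groupV // => eqh.
by rewrite -v2d -{2}eqh actKV.
Qed.

End Vectors.

(** By [pair_sign], [h] otherwise negates [mu].  But it fixes or negates
    [v2 + mu] as well, while it fixes [v2]. *)
Lemma pair_fix v1 v2 h mu : hyper D1 v1 -> hyper D2 v2 ->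
  h \in stab v1 -> h \in stab v2 -> D2 \subset stab mu -> act mu h = mu.
Proof.
move=> hD1 hD2 Th1 Th2 fmu; have [sD2 iD2 fD2 nzv2] := hD2.
have [Hh h2] := stabP _ _ Th2.
have [-> | nzmu] := eqVneq mu 0%R; first exact: act0.
have [|//|mu_h] := pair_sign hD1 (v2 := mu) _ Th1; first by split=> //; apply/eqP.
have [s0 | nzs] := eqVneq (v2 + mu)%R 0%R.
  have -> : mu = (- v2)%R by apply/eqP; rewrite -addr_eq0 addrC s0.
  by rewrite act_opp // h2.
have hs: hyper D2 (v2 + mu)%R by split=> //; [apply: fixD | apply/eqP].
have [] := pair_sign hD1 hs Th1; rewrite act_add // h2 mu_h.
  by move/addrI/esym/opp_neq=> nz; case: nz; apply/eqP.
by rewrite opprD => /addIr/opp_neq.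
Qed.

End Pair.

(** If some element fixes [v1] and [v2] but not [v3], then the pointwise
    stabilizer [K] of the three vectors has index 4 in [stab v1], so also in
    the stabilizer of [lam = v1 + v2 + v3].  But the latter permutes the three
    vectors with kernel [K], and 4 does not divide the order of the symmetric
    group of degree 3. *)
Lemma triple_fix D1 D2 D3 v1 v2 v3 h :
    hyper D1 v1 -> hyper D2 v2 -> hyper D3 v3 ->
    D1 :!=: D2 -> D1 :!=: D3 -> D2 :!=: D3 ->
  h \in stab v1 -> h \in stab v2 -> act v3 h = v3.
Proof.
move=> hD1 hD2 hD3 n12 n13 n23 Th1 Th2.
pose T12 := (stab v1 :&: stab v2)%G; pose K := (T12 :&: stab v3)%G.
have [[sD1 iD1 fD1 nzv1] [sD2 iD2 fD2 nzv2]] := (hD1, hD2).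
have [sD3 iD3 fD3 nzv3] := hD3.
have [sT12K | /subsetPn[h0 T12h0 Kh0]] := boolP (T12 \subset K).
  have /setIP[_ /stabP[]//]: h \in K by apply: (subsetP sT12K); apply/setIP.
have [Th01 Th02] := setIP T12h0; have [Hh0 _] := stabP _ _ Th01.
have neq_v D D' v v' : hyper D v -> hyper D' v' -> D :!=: D' -> v <> v'.
  move=> [sD iD fD nzv] [sD' iD' fD' nzv'] neqDD' eqv; apply: nzv'.
  by apply: (hyper_disjoint sD sD') => //; rewrite -eqv.
pose Dd (i : option bool) := if i is Some b then (if b then D1 else D2) else D3.
pose l (i : option bool) := if i is Some b then (if b then v1 else v2) else v3.
have hD i : [/\ Dd i \subset E, #|E : Dd i| = q, Dd i \subset stab (l i) & l i <> 0%R].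
  by case: i => [[]|].
have injD i j : Dd i :=: Dd j -> i = j.
  case: i j => [[]|] [[]|] //= eqD; by move: n12 n13 n23; rewrite eqD ?eqxx.
have injl i j : l i = l j -> i = j.
  have [//|neq eql] := eqVneq i j.
  case: (@neq_v (Dd i) (Dd j) (l i) (l j)) => //.
  by apply: contra neq => /eqP/injD->.
pose lam := (\sum_i l i)%R.
have permT k i : k \in stab lam -> exists j, act (l i) k = l j.
  by move=> Tk; have [j _ lj] := hyper_perm i hD injD Tk; exists j.
have nzlam : lam <> 0%R.
  have [d D3d D1d]: exists2 d, d \in D3 & d \notin D1.
    apply/subsetPn; apply: contra n13 => sD31; rewrite eq_sym eqEcard sD31.
    by rewrite -(leq_pmul2r (prime_gt0 pr_q)) -{1}iD1 -{1}iD3 !Lagrange ?leqnn.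
  have Ed := subsetP sD3 d D3d; have Hd := inH Ed.
  have v1d := hyper_neg sD1 iD1 fD1 Ed D1d.
  have v3d := act_fix fD3 D3d.
  have -> : lam = (v1 + v2 + v3)%R.
    rewrite /lam (bigD1 (Some true)) //= (bigD1 (Some false)) //= (bigD1 None) //=.
    by rewrite big1 ?addr0 ?addrA // => -[[]|].
  move/eqP; rewrite addr_eq0 => /eqP eqv; apply: nzv3.
  suffices s0: (v1 + v2)%R = 0%R by rewrite -[v3]opprK -eqv s0 oppr0.
  have sd: act (v1 + v2)%R d = (v1 + v2)%R by rewrite eqv act_opp // v3d.
  move: sd; rewrite act_add // v1d; have [D2d | D2d] := boolP (d \in D2).
    by rewrite (act_fix fD2 D2d) => /addIr/esym/opp_neq[].
  by rewrite (hyper_neg sD2 iD2 fD2 Ed D2d) -opprD => eqs; apply: addvv; rewrite -{2}eqs subrr.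
have fixl k i : k \in K -> act (l i) k = l i.
  by case/setIP=> /setIP[/stabP[_ h1] /stabP[_ h2]] /stabP[_ h3]; case: i => [[]|].
have sKT: K \subset stab_group lam.
  apply/subsetP=> k Kk; have [Hk _] : k \in H /\ true.
    by case/setIP: Kk => _ /stabP[].
  by apply/stabP; rewrite act_sum //; split=> //; apply: eq_bigr => i _; apply: fixl.
pose S11 := (stab lam :&: stab v1)%G.
have sKS : K \subset S11.
  by rewrite subsetI sKT; apply/subsetP=> k /setIP[/setIP[]].
have lamK k : k \in S11 -> act v2 k = v2 -> k \in K.
  case/setIP=> Tk Tk1 k2; have [Hk lk] := stabP _ _ Tk.
  have [j k3] := permT k None Tk.
  have j3 : j = None.
    case: j k3 => [[]|] //= k3; have [_ k1] := stabP _ _ Tk1.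
      by have := act_inj Hk (etrans k3 (esym k1)) => /(injl None (Some true)).
    by have := act_inj Hk (etrans k3 (esym k2)) => /(injl None (Some false)).
  apply/setIP; split; first by apply/setIP; split=> //; apply/stabP.
  by apply/stabP; split=> //; rewrite j3 in k3.
have i11K: #|S11 : K| <= 2.
  apply: (@leq_trans #|[set v2; v3]|); last by rewrite cards2; case: (_ != _).
  apply: (@index_le_image _ S11 K _ (act v2)) => [//|k k' Sk Sk' eqk | k Sk].
    have [/setIP[/stabP[Hk _] _] /setIP[/stabP[Hk' _] _]] := (Sk, Sk').
    apply: lamK; first by rewrite groupM ?groupV.
    by rewrite actM ?groupV // eqk actK.
  have /setIP[Tk /stabP[Hk k1]] := Sk; have [j kj] := permT k (Some false) Tk.
  case: j kj => [[]|] /= kj; rewrite !inE kj ?eqxx ?orbT //.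
  by have := act_inj Hk (etrans kj (esym k1)) => /(injl (Some false) (Some true)).
have iT11: #|stab_group lam : S11| <= 3.
  apply: (@leq_trans #|v1 |: [set v2; v3]|); last first.
    by rewrite cardsU1 cards2; case: (_ \notin _); case: (_ != _).
  apply: (@index_le_image _ (stab_group lam) S11 _ (act v1)) => [|k k' Tk Tk' eqk | k Tk].
  - exact: subsetIl.
  - have [[Hk _] [Hk' _]] := (stabP _ _ Tk, stabP _ _ Tk').
    rewrite inE groupM ?groupV //=; apply/stabP; rewrite groupM ?groupV //.
    by split=> //; rewrite actM ?groupV // eqk actK.
  have [j kj] := permT k (Some true) Tk.
  by case: j kj => [[]|] /= kj; rewrite !inE kj eqxx ?orbT.
have [i12 _] := pair_index n12 hD1 hD2.
have i12K: #|T12 : K| = 2.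
  apply/eqP; rewrite eqn_leq indexg_gt1; apply/andP; split; last first.
    by apply/subsetPn; exists h0.
  apply: (@leq_trans #|[set v3; (- v3)%R]|); last by rewrite cards2; case: (_ != _).
  apply: (@index_le_image _ T12 K _ (act v3)) => [|k k' Tk Tk' eqk | k Tk].
  - exact: subsetIl.
  - have [/setIP[/stabP[Hk _] _] /setIP[/stabP[Hk' _] _]] := (Tk, Tk').
    rewrite inE groupM ?groupV //=; apply/stabP; rewrite groupM ?groupV //.
    by split=> //; rewrite actM ?groupV // eqk actK.
  have /setIP[Tk1 _] := Tk.
  by case: (pair_sign n13 hD1 hD3 Tk1) => ->; rewrite !inE eqxx ?orbT.
have cardT: #|stab lam| = (2 * (2 * #|K|))%N.
  rewrite (half nzlam nzv1) -[in LHS](Lagrange (subsetIl (stab v1) (stab v2))) i12.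
  by rewrite -[in LHS](Lagrange (subsetIl T12 (stab v3))) /= i12K; ring.
have cardT': #|stab lam| = (#|stab_group lam : S11| * (#|S11 : K| * #|K|))%N.
  by rewrite [(#|S11 : K| * _)%N]mulnC Lagrange // mulnC Lagrange ?subsetIl.
have [iT2 iS2]: #|stab_group lam : S11| = 2 /\ #|S11 : K| = 2.
  move: cardT'; rewrite cardT !mulnA => /eqP; rewrite eqn_pmul2r ?cardG_gt0 //.
  by move: #|_ : S11| #|S11 : K| iT11 i11K => [|[|[|[|]]]] // [|[|[|]]] //.
have nST: S11 <| stab_group lam by rewrite index2_normal ?subsetIl.
have [k Tk Sk]: exists2 k, k \in stab_group lam & k \notin S11.
  by apply/subsetPn; rewrite -indexg_gt1 iT2.
have [s Ss Ks]: exists2 s, s \in S11 & s \notin K.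
  by apply/subsetPn; rewrite -indexg_gt1 iS2.
have [/setIP[Ts Ts1] [Hk lk]] := (Ss, stabP _ _ Tk).
have [Hs _] := stabP _ _ Ts; have [_ s1] := stabP _ _ Ts1.
have [j kj] := permT k (Some true) Tk.
have sj: act (l j) s = l j.
  have: s \in S11 :^ k by rewrite (normP (subsetP (normal_norm nST) k Tk)).
  case/imsetP=> s' /setIP[_ /stabP[Hs' s'1]] ->.
  by rewrite -kj -actM ?groupJ // -conjgC actM // s'1.
have s2: act v2 s = v3.
  have [i si] := permT s (Some false) Ts.
  case: i si => [[]|] //= si.
    by have := act_inj Hs (etrans si (esym s1)) => /(injl (Some false) (Some true)).
  by case/negP: Ks; apply: lamK.
case: j kj sj => [[]|] /= kj sj.
- by case/negP: Sk; apply/setIP; split=> //; apply/stabP.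
- by have /(injl (Some false) None) := etrans (esym sj) s2.
by have := act_inj Hs (etrans sj (esym s2)) => /(injl None (Some false)).
Qed.

(** By [pair_fix] and [triple_fix], [h] fixes every vector that is fixed by a
    hyperplane, hence all of [V]. *)
Lemma pair_stab1 D1 D2 v1 v2 h : hyper D1 v1 -> hyper D2 v2 -> D1 :!=: D2 ->
  h \in stab v1 -> h \in stab v2 -> h = 1.
Proof.
move=> hD1 hD2 neqD Th1 Th2; have [Hh h1] := stabP _ _ Th1.
apply: faith => //; apply: (abelem_ind pr_q abE sEH) => [v|||v|D v sDE iD fD].
- exact: fpf.
- exact: act0.
- by move=> u v hu hv; rewrite act_add // hu hv.
- rewrite act_muln // => hqv; apply/eqP; rewrite -subr_eq0; apply/eqP/divq.
  by rewrite mulrnBl hqv subrr.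
have [-> | /eqP nzv] := eqVneq v 0%R; first exact: act0.
have [/val_inj eqD | neqD1] := eqVneq (D1 : {set gT}) D.
  by apply: (@pair_fix D2 D1 _ v2 v1) => //; rewrite 1?eq_sym // eqD.
have [/val_inj eqD | neqD2] := eqVneq (D2 : {set gT}) D.
  by apply: (@pair_fix D1 D2 _ v1 v2) => //; rewrite eqD.
by apply: (triple_fix (D1 := D1) (D2 := D2) (D3 := D) (v1 := v1) (v2 := v2)).
Qed.

(** If [#|E| != 2], then [pair_index] and [pair_stab1] show that stabilizers of
    nonzero vectors have order 2, that [E] has order 4, and that exactly two
    hyperplanes [D1] and [D2] of [E] fix nonzero vectors.  The normalizer [I]
    of [D1] in [H] has index at most 2 and centralizes [E].  The involution
    that exchanges [v1] and [v2] inverts [I] modulo [E], so [I / E] is abelian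
    and [I] is nilpotent. *)
Lemma even_normal_abelem : #|E| = q \/
  exists I : {group gT}, [/\ I <| H, nilpotent I & nilpotent (H / I)].
Proof.
have [/eqP | neqE] := boolP (#|E| == q); first by left.
right; have [D1 [D2 [v1 [v2 [hD1 hD2 nsD12]]]]] := two_hypers neqE.
have neqD: D1 :!=: D2 by apply: contra nsD12 => /eqP->.
have [[sD1 iD1 fD1 nzv1] [sD2 iD2 fD2 nzv2]] := (hD1, hD2).
have stab2 v : v <> 0%R -> #|stab v| = 2.
  move=> nzv; rewrite (half nzv nzv1); have [i12 _] := pair_index neqD hD1 hD2.
  rewrite -(Lagrange (subsetIl (stab v1) (stab v2))) i12 /=.
  suffices T1: stab v1 :&: stab v2 = 1 by rewrite T1 cards1.
  apply/trivgP/subsetP=> h /setIP[Th1 Th2]; rewrite inE; apply/eqP.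
  exact: pair_stab1 hD1 hD2 neqD Th1 Th2.
have oD D v : hyper D v -> #|D| = 2.
  case=> sD iD fD nzv; apply/eqP; rewrite eqn_leq -{1}(stab2 v nzv) subset_leq_card //=.
  have ->: #|D| = #|D1|.
    apply/eqP; rewrite -(eqn_pmul2r (prime_gt0 pr_q)) -{1}iD -{1}iD1.
    by rewrite !Lagrange.
  by rewrite cardG_gt1; apply: contra nsD12 => /eqP->; apply: sub1G.
have stab_eq D v : hyper D v -> D :=: stab v.
  move=> hD; have [sD iD fD nzv] := hD.
  by apply/eqP; rewrite eqEcard fD (stab2 v nzv) (oD D v).
have hyperJ D v h : hyper D v -> h \in H -> hyper (D :^ h)%G (act v h).
  case=> sD iD fD nzv Hh; have nEh := subsetP (normal_norm nEH) h Hh.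
  split; last by apply/eqP; rewrite act_eq0 //; apply/eqP.
  - by rewrite -(normP nEh) conjSg.
  - by rewrite -{1}(normP nEh) indexJg.
  by rewrite stabJ // conjSg.
have conjD D v e : hyper D v -> e \in E -> D :^ e = D.
  case=> sD iD fD nzv Ee; apply/normP/(subsetP (cent_sub D)).
  by apply: (subsetP (subset_trans cEE (centS sD))).
have inv D v g : v <> 0%R -> g \in stab v -> g ^+ 2 = 1.
  by move=> nzv Tg; apply/eqP; rewrite -order_dvdn -(stab2 v nzv) order_dvdG.
have sum_nz D D' v v' : hyper D v -> hyper D' v' -> D :!=: D' -> (v + v')%R <> 0%R.
  move=> [sD iD fD nzv] [sD' iD' fD' nzv'] neqDD' /eqP; rewrite addr_eq0 => /eqP eqv.
  by apply: nzv; apply: (hyper_disjoint sD sD') => //; rewrite eqv; apply: fix_opp.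
have nt D v : hyper D v -> exists2 d, d \in D & d != 1.
  by move=> hD; apply/trivgPn; rewrite -cardG_gt1 (oD D v).
have oE: #|E| = 4 by rewrite -(Lagrange sD1) iD1 (oD D1 v1 hD1) q2.
have [d1 D1d1 nt1] := nt D1 v1 hD1; have [d2 D2d2 nt2] := nt D2 v2 hD2.
have D1d2 : d2 \notin D1.
  apply: contra nt2 => D1d2; apply/eqP.
  by apply: (pair_stab1 hD1 hD2 neqD); [apply: (subsetP fD1) | apply: (subsetP fD2)].
have Ed1 := subsetP sD1 d1 D1d1; have Ed2 := subsetP sD2 d2 D2d2.
(* An involution [g] that exchanges [v2] and [v] exchanges [d2] and [d], so it
   fixes [d1 = d2 * d].  Then it negates [v1], so [g * d2] fixes [v1] and [g]
   would lie in [E]. *)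
have only D v : hyper D v -> D :=: D1 \/ D :=: D2.
  move=> hD; have [ | neqD1] := eqVneq (D : {set gT}) D1; first by left.
  have [ | neqD2] := eqVneq (D : {set gT}) D2; first by right.
  have [d Dd ntd] := nt D v hD; have [sD iD fD nzv] := hD.
  rewrite eq_sym in neqD2.
  have [_ [g [Tg v2g vg]]] := pair_index neqD2 hD2 hD.
  have [Hg _] := stabP _ _ Tg.
  have g2 := inv D _ g (sum_nz _ _ _ _ hD2 hD neqD2) Tg.
  have Eg: g \notin E.
    apply: contra neqD2 => Eg; rewrite -(conjD D2 v2 g hD2 Eg).
    by rewrite (stab_eq _ _ hD2) -stabJ // v2g -(stab_eq _ _ hD).
  have d2g: d2 ^ g = d.
    apply: (@card2_eq _ D) => //; first exact: oD hD.
      by rewrite (stab_eq _ _ hD) -v2g stabJ // memJ_conjg -(stab_eq _ _ hD2).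
    by rewrite conjg_eq1.
  have dg: d ^ g = d2.
    apply: (@card2_eq _ D2) => //; first exact: oD hD2.
      by rewrite (stab_eq _ _ hD2) -vg stabJ // memJ_conjg -(stab_eq _ _ hD).
    by rewrite conjg_eq1.
  have Ed := subsetP sD d Dd.
  have neq_d i j (Di Dj : {group gT}) vi vj : hyper Di vi -> hyper Dj vj ->
      Di :!=: Dj -> i \in Di -> i != 1 -> j \in Dj -> i != j.
    move=> hi hj nij Di_i nti Dj_j; apply: contra nti => /eqP eqij; apply/eqP.
    have [[_ _ fi _] [_ _ fj _]] := (hi, hj).
    apply: (pair_stab1 hi hj nij); first exact: (subsetP fi).
    by rewrite eqij; apply: (subsetP fj).
  have n12 := neq_d _ _ _ _ _ _ hD1 hD2 neqD D1d1 nt1 D2d2.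
  have n1: d1 != d by apply: (neq_d _ _ _ _ _ _ hD1 hD) => //; rewrite eq_sym.
  have n2: d2 != d by apply: (neq_d _ _ _ _ _ _ hD2 hD).
  have defE: E :=: [set 1; d1; d2; d].
    apply/esym/eqP; rewrite eqEcard oE !subUset !sub1set group1 Ed1 Ed2 Ed /=.
    rewrite -!setUA !cardsU1 cards1 !inE !negb_or.
    by rewrite ![1 == _]eq_sym nt1 nt2 ntd n12 n1 n2.
  have d_inv x : x \in E -> x * x = 1.
    by move=> Ex; case/abelemP: abE => // _; rewrite q2 => /(_ x Ex); rewrite expgS expg1.
  have d1E: d1 = d2 * d.
    have: d2 * d \in E by rewrite groupM.
    rewrite defE !inE -!orbA => /or4P[] /eqP.
    - by move=> eqd; case/negP: n2; rewrite -(inj_eq (mulgI d2)) eqd d_inv.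
    - by [].
    - by move=> eqd; case/eqP: ntd; apply: (mulgI d2); rewrite eqd mulg1.
    by move=> eqd; case/eqP: nt2; apply: (mulIg d); rewrite eqd mul1g.
  have d1g: d1 ^ g = d1 by rewrite d1E conjMg d2g dg; apply: ccE.
  have D1g: D1 :^ g = D1.
    apply/eqP; rewrite eq_sym eqEcard cardJg leqnn andbT.
    apply/subsetP=> y D1y; have [-> | nty] := eqVneq y 1; first by rewrite group1.
    have ->: y = d1 by apply: (@card2_eq _ D1) => //; apply: oD hD1.
    by rewrite -d1g memJ_conjg.
  have fv1g: D1 \subset stab (act v1 g).
    by rewrite stabJ // -(stab_eq _ _ hD1) D1g.
  have v1g: act v1 g = (- v1)%R.
    apply/eqP; rewrite -addr_eq0 addrC; apply: contraNT Eg => /eqP nzw.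
    have hw: hyper D1 (v1 + act v1 g)%R by split=> //; apply: fixD.
    apply: (subsetP sD1); rewrite (stab_eq _ _ hw); apply/stabP; split=> //.
    rewrite act_add // addrC; congr (_ + _)%R.
    by rewrite -actM // -[g * g](expgS g 1) g2 act1.
  have v1d2: act v1 d2 = (- v1)%R by apply: (hyper_neg sD1).
  case/negP: Eg; rewrite -(groupMr g Ed2); apply: (subsetP sD1).
  rewrite (stab_eq _ _ hD1); apply/stabP; split; first by rewrite groupM ?(inH Ed2).
  by rewrite actM ?(inH Ed2) // v1g act_opp ?(inH Ed2) // v1d2 opprK.
pose I := 'N_H(D1)%G.
have conj_only h : h \in H -> D1 :^ h = D1 \/ D1 :^ h = D2.
  by move=> Hh; apply: (only (D1 :^ h)%G (act v1 h)); apply: hyperJ.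
have iI: #|H : I| <= 2.
  apply: (@leq_trans #|[set (D1 : {set gT}); (D2 : {set gT})]|).
    apply: (@index_le_image _ H I _ (fun h => D1 :^ h)) => [|h k Hh Hk eqhk|h Hh].
    - exact: subsetIl.
    - apply/setIP; split; first by rewrite groupM ?groupV.
      by apply/normP; rewrite conjsgM eqhk -conjsgM mulgV conjsg1.
    by rewrite !inE; case: (conj_only h Hh) => ->; rewrite eqxx ?orbT.
  by rewrite cards2; case: (_ != _).
have nIH: I <| H.
  move: iI; rewrite leq_eqVlt => /orP[/eqP i2 | lt2]; first by rewrite index2_normal ?subsetIl.
  suffices sHI: H \subset I by rewrite /normal subsetIl (subset_trans sHI) ?normG.
  by rewrite -indexg_eq1 eqn_leq -ltnS lt2 indexg_gt0.
exists I; split=> //; last first.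
  apply: abelian_nil; apply: cyclic_abelian.
  have oHI: #|H / I| <= 2 by rewrite card_quotient ?normal_norm.
  move: oHI; rewrite leq_eqVlt => /orP[/eqP i2 | ]; first by rewrite prime_cyclic ?i2.
  by rewrite ltnS => le1; have/card_le1_trivg-> := le1; apply: cyclic1.
have ID h : h \in I -> [/\ h \in H, D1 :^ h = D1 & D2 :^ h = D2].
  case/setIP=> Hh nDh; split=> //; first exact/normP.
  have: D2 :^ h = D1 \/ D2 :^ h = D2 by apply: (only (D2 :^ h)%G (act v2 h)); apply: hyperJ.
  by case=> // eqD; case/eqP: neqD; apply: (@conjsg_inj _ h); rewrite eqD; apply/normP.
have fixd D v d h : hyper D v -> d \in D -> d != 1 -> h \in H -> D :^ h = D ->
    d ^ h = d.
  move=> hD Dd ntd Hh Dh; apply: (@card2_eq _ D) => //; first exact: oD hD.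
    by rewrite -Dh memJ_conjg.
  by rewrite conjg_eq1.
have defE: E \subset <<[set d1; d2]>>.
  have sG: <<[set d1; d2]>> \subset E by rewrite gen_subG subUset !sub1set Ed1.
  have sD1G: D1 \subset <<[set d1; d2]>>.
    apply/subsetP=> y D1y; have [-> | nty] := eqVneq y 1; first exact: group1.
    have ->: y = d1 by apply: (@card2_eq _ D1) => //; apply: oD hD1.
    by rewrite mem_gen // !inE eqxx.
  rewrite (@index_q_eq D1 <<[set d1; d2]>>%G) //.
  apply/subsetPn; exists d2 => //.
  by rewrite mem_gen // !inE eqxx orbT.
have cEI: E \subset 'C(I).
  rewrite (subset_trans defE) // gen_subG; apply/subsetP=> d.
  rewrite !inE => /orP[] /eqP->; apply/centP=> h /ID[Hh D1h D2h]; apply/commgP/conjg_fixP.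
    exact: (fixd _ _ _ _ hD1).
  exact: (fixd _ _ _ _ hD2).
have [_ [g0 [Tg0 v1g0 v2g0]]] := pair_index neqD hD1 hD2.
have [Hg0 _] := stabP _ _ Tg0.
have g0g0: g0 * g0 = 1.
  by rewrite -[g0 * g0](expgS g0 1) (inv D1 _ _ (sum_nz _ _ _ _ hD1 hD2 neqD) Tg0).
have nEg0 := subsetP (normal_norm nEH) g0 Hg0.
(* Some involution [k] exchanges [act v1 h] and [v2].  So [h] and [g0 * k] agree
   on [v1], and [g0] inverts the product of involutions [g0 * k]. *)
have inv_g0 h : h \in I -> exists2 e, e \in E & h ^ g0 = h^-1 * e.
  case/ID=> Hh D1h D2h.
  have hDh: hyper D1 (act v1 h).
    by have := hyperJ _ _ _ hD1 Hh; case; rewrite /= D1h.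
  have [_ [k [Tk hk kh]]] := pair_index neqD hDh hD2.
  have [Hk _] := stabP _ _ Tk.
  have kk: k * k = 1.
    by rewrite -[k * k](expgS k 1) (inv D1 _ _ (sum_nz _ _ _ _ hDh hD2 neqD) Tk).
  have Dd: h * (g0 * k)^-1 \in D1.
    rewrite (stab_eq _ _ hD1); apply/stabP; split; first by rewrite groupM ?groupV ?groupM.
    rewrite actM ?groupV ?groupM //; apply: (act_inj (groupM Hg0 Hk)) => /=.
    by rewrite actKV ?groupM // actM // v1g0 kh.
  set d := h * _ in Dd; have Ed := subsetP sD1 d Dd.
  have hE: h = d * (g0 * k) by rewrite /d mulgKV.
  clearbody d.
  have Edg: d ^ g0 \in E by rewrite memJ_norm.
  have cdh: commute (d ^ g0) h^-1.
    by apply/commuteV; apply: (centP (subsetP cEI _ Edg)); apply/setIP; split=> //; apply/normP.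
  exists (d ^ g0 * d); first by rewrite groupM.
  have gk: (g0 * k) ^ g0 = h^-1 * d.
    have g0V: g0^-1 = g0 by apply/eqP; rewrite eq_invg_mul g0g0.
    have kV: k^-1 = k by apply/eqP; rewrite eq_invg_mul kk.
    by rewrite hE invMg mulgKV conjgE -(mulgA g0) mulKg invMg g0V kV.
  by rewrite {1}hE conjMg gk (mulgA (d ^ g0)) cdh -mulgA.
have sEI: E \subset I.
  by apply/subsetP=> e Ee; apply/setIP; split; [apply: inH | apply/normP; apply: conjD hD1 Ee].
have sEZ: E \subset 'Z(I) by rewrite subsetI sEI.
rewrite -quotient_center_nil abelian_nil // sub_der1_abelian // (subset_trans _ sEZ) //.
rewrite gen_subG; apply/subsetP=> _ /imset2P[h k Ih Ik ->].
have cE e x : e \in E -> x \in I -> commute e x.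
  by move=> Ee; apply: (centP (subsetP cEI e Ee)).
have [e1 Ee1 h1] := inv_g0 h Ih; have [e2 Ee2 k1] := inv_g0 k Ik.
have [e3 Ee3 hk1] := inv_g0 (h * k) (groupM Ih Ik).
have: h^-1 * k^-1 * (e1 * e2) = (h * k)^-1 * e3.
  rewrite -hk1 conjMg h1 k1 !mulgA; congr (_ * _); rewrite -!mulgA; congr (_ * _).
  by rewrite (cE e1) ?groupV.
move=> eqhk; have -> : [~ h, k] = (h * k)^-1 * (e3 * (e1 * e2)^-1) * (h * k).
  by rewrite (mulgA (h * k)^-1) -eqhk mulgK commgEl conjgE !mulgA.
have Ee: e3 * (e1 * e2)^-1 \in E by rewrite groupM ?groupV ?groupM.
move: (e3 * _) Ee => e Ee.
by rewrite -mulgA (cE e _ Ee (groupM Ih Ik)) mulKg.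
Qed.

End Even.

End NormalAbelem.

Section ExtraspecialLike.

Variables (E Z0 : {group gT}).
Hypotheses (odd_q : odd q) (nEH : E <| H) (qE : q.-group E).
Hypothesis expE : forall x, x \in E -> x ^+ q = 1.
Hypotheses (defZ : 'Z(E) = Z0) (oZ : #|Z0| = q) (sE'Z : [~: E, E] \subset Z0).

Let sEH := normal_sub nEH.
Let HE x : x \in E -> x \in H := fun Ex => subsetP sEH x Ex.
Let q_gt0 := prime_gt0 pr_q.

Let sZE : Z0 \subset E. Proof. by rewrite -defZ center_sub. Qed.

Let nZH : Z0 <| H.
Proof. by rewrite -defZ (char_normal_trans (center_char E)). Qed.

Let ZE x : x \in Z0 -> x \in E. Proof. exact: subsetP sZE x. Qed.

Let ccZ a x : a \in Z0 -> x \in E -> commute a x.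
Proof. by rewrite -defZ => /centerP[_ cEa] Ex; apply: cEa. Qed.

Let Z_neq1 : Z0 :!=: 1.
Proof. by rewrite trivg_card1 oZ neq_ltn prime_gt1 ?orbT. Qed.

Let genZ a : a \in Z0 -> a != 1 -> <[a]> = Z0.
Proof.
move=> Za nta; apply/eqP; rewrite eqEcard cycle_subG Za /= oZ -orderE.
suffices ->: #[a] = q by [].
apply/prime_nt_dvdP; rewrite ?order_dvdn ?expE ?ZE //.
by rewrite order_eq1.
Qed.

Let conjE x g : x \in E -> g \in E -> exists2 a, a \in Z0 & x ^ g = x * a.
Proof.
move=> Ex Eg; exists [~ x, g]; last by rewrite -conjg_mulR.
by apply: (subsetP sE'Z); apply: mem_commg.
Qed.

(** A nontrivial element generates the normal subgroup [Z0], which acts fixed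
    point freely. *)
Let fixZ a v : a \in Z0 -> a != 1 -> act v a = v -> v = 0%R.
Proof.
move=> Za nta va; apply: (fpf nZH Z_neq1); rewrite -(genZ Za nta) cycle_subG.
by apply/stabP; rewrite HE ?ZE.
Qed.

Let stabZ a v : v <> 0%R -> a \in Z0 -> a \in stab v -> a = 1.
Proof.
move=> nzv Za /stabP[_ va]; apply/eqP/negP=> /negP nta; exact/nzv/(fixZ Za).
Qed.

Let piZ a v : a \in Z0 -> a != 1 -> pi q a v = 0%R.
Proof.
move=> Za nta; apply: (fixZ Za nta); apply: pi_fix; rewrite ?HE ?ZE //.
by rewrite expE ?ZE.
Qed.

Let pi_mul_stab c y v : c \in H -> y \in stab v -> commute y c ->
  pi q (y * c) v = pi q c v.
Proof.
move=> Hc /[dup] sty /stabP[Hy vy] cyc; apply: eq_bigr => i _.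
rewrite expgMn // actM ?groupX //.
by have /stabP[_ ->] := groupX i sty.
Qed.

Let pi_stabZ u y a : y \in E -> y \in stab u -> a \in Z0 ->
  pi q (y * a) u = (if a == 1%g then u *+ q else 0)%R.
Proof.
move=> Ey sty Za; rewrite pi_mul_stab ?HE ?ZE //; last exact/commute_sym/ccZ.
case: eqP => [-> | /eqP nta]; last exact: piZ.
by rewrite pi_cent ?act1.
Qed.

(** By [pi_sum] with [z] in [Z0]: the norms of the [c * z ^+ i] add up to
    [v *+ q]. *)
Let pi_some c v : c \in E -> v <> 0%R ->
  exists2 a, a \in Z0 & pi q (c * a) v <> 0%R.
Proof.
move=> Ec nzv; have [z Zz ntz] := trivgPn _ Z_neq1.
have [/existsP[i /eqP nzi] | /existsPn zero] := 
    boolP [exists i : 'I_q, pi q (c * z ^+ i) v != 0%R].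
  by exists (z ^+ i); rewrite ?groupX.
case: nzv; apply: divq; rewrite -(pi_sum (c := c) (z := z)) ?(HE Ec) ?(HE (ZE Zz)) ?(expE (ZE Zz)) //.
- by rewrite big1 // => i _; apply/eqP; move: (zero i); rewrite negbK.
- exact/commute_sym/ccZ.
exact: piZ.
Qed.

Section MaximalStabilizer.

Variable u : V.
Hypothesis nzu : u <> 0%R.
Let Y := (E :&: stab u)%G.
Hypothesis maxY : forall v, v <> 0%R -> #|E :&: stab v| <= #|Y|.

Let Ystab y : y \in Y -> y \in stab u. Proof. by case/setIP. Qed.
Let YE y : y \in Y -> y \in E. Proof. by case/setIP. Qed.

Let comm_stab v x y : v <> 0%R -> x \in E -> y \in E -> x \in stab v ->
  y \in stab v -> commute x y.
Proof.
move=> nzv Ex Ey vx vy; apply/commgP/eqP; apply: (stabZ nzv).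
  by apply: (subsetP sE'Z); apply: mem_commg.
by rewrite groupR.
Qed.

(** The centralizer of [Y] in [E] is [Y * Z0]: some norm [pi q (c * a) u] is
    nonzero, it is fixed by [Y] and by [c * a], and [Y] is a stabilizer of
    maximal order. *)
Let centY c : c \in E -> (forall y, y \in Y -> commute c y) ->
  exists2 a, a \in Z0 & c * a \in Y.
Proof.
move=> Ec cYc; have [a Za nzpi] := pi_some Ec nzu.
have Eca: c * a \in E by rewrite groupM // ZE.
exists a => //; set u' := pi _ _ _ in nzpi.
have cYca: c * a \in 'C(Y).
  apply/centP=> y Yy; apply/commute_sym/commuteM.
    exact/commute_sym/cYc.
  exact/commute_sym/ccZ/YE.
have sYu': Y \subset E :&: stab u'.
  rewrite subsetI subsetIl fix_pi ?HE //; last exact: subsetIr.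
  exact: (subsetP (cent_sub Y)).
have/eqP eqY: Y :==: E :&: stab u' by rewrite eqEcard sYu' maxY.
suffices: c * a \in E :&: stab u' by rewrite -eqY.
apply/setIP; split=> //; apply/stabP; split; first exact: HE.
by apply: pi_fix; rewrite ?HE ?expE.
Qed.

(** Otherwise [Y] would be central, hence trivial by [stabZ], and [centY] would
    give [E = Z0]. *)
Lemma exists_noncommuting : E :!=: Z0 ->
  exists e x, [/\ e \in E, x \in Y & ~ commute x e].
Proof.
move=> neqEZ; have [sYZ | /subsetPn[x Yx Zx]] := boolP (Y \subset Z0).
  case/eqP: neqEZ; apply/eqP; rewrite eqEsubset sZE andbT.
  have Y1 y : y \in Y -> y = 1.
    by move=> Yy; apply: (stabZ nzu (subsetP sYZ y Yy)); apply: Ystab.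
  apply/subsetP=> c Ec; have [|a Za /Y1 ca1] := @centY c Ec.
    by move=> y /Y1->; apply: commute1.
  by rewrite -[c](mulgK a) ca1 mul1g groupV.
have: ~~ [forall e in E, x * e == e * x].
  apply: contra Zx => /forall_inP cxE; rewrite -defZ; apply/centerP.
  by split=> [|e Ee]; [apply: YE | apply/eqP/cxE].
by case/forall_inPn=> e Ee /eqP ncxe; exists e, x.
Qed.

Variable e x : gT.
Hypotheses (Ee : e \in E) (Yx : x \in Y) (ncxe : ~ commute x e).

Let Ex := YE Yx.

(* Since [e] moves the element [x] of [Y], the stabilizer of [lam] in [E] is
   only ['C_Y[e]]; but the orders of the stabilizers in [H] do not change. *)
Let lam := (u - act u e)%R.
Let Y' := 'C_Y[e]%G.

Let Y'Y y : y \in Y' -> y \in Y. Proof. by case/setIP. Qed.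
Let Y'e y : y \in Y' -> commute y e. Proof. by case/setIP=> _ /cent1P. Qed.

Let conjVe y : y \in E -> exists b, [/\ b \in Z0, y ^ e^-1 = y * b &
  (b == 1) = (y ^ e == y)].
Proof.
move=> Ey; have [b Zb yb] := conjE Ey (groupVr Ee); exists b; split=> //.
rewrite -{1}(can_eq (mulKg y)) mulg1 -yb.
by rewrite -(inj_eq (conjg_inj e)) conjgKV eq_sym.
Qed.

Let pi_ue y b a : y \in Y -> y ^ e^-1 = y * b -> b \in Z0 -> a \in Z0 ->
  pi q (y * a) (act u e) = (if (b * a == 1)%g then act u e *+ q else 0)%R.
Proof.
move=> Yy yb Zb Za; have Ey := YE Yy.
have He := HE Ee; have Hya: y * a \in H by rewrite HE ?groupM // ?ZE.
have ->: y * a = ((y * (b * a)) ^ e)%g.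
  have ae: a ^ e = a by apply/conjg_fixP/commgP/ccZ.
  by rewrite mulgA conjMg ae -yb conjgKV.
rewrite -pi_act ?HE // ?groupM // ?ZE // pi_stabZ ?groupM ?Ystab //.
by case: ifP => _; rewrite ?act0 ?act_muln.
Qed.

Let pi_lam y b a : y \in Y -> y ^ e^-1 = y * b -> b \in Z0 -> a \in Z0 ->
  pi q (y * a) lam = ((if a == 1%g then u *+ q else 0)
                     - (if (b * a == 1)%g then act u e *+ q else 0))%R.
Proof.
move=> Yy yb Zb Za; have Ey := YE Yy.
have Hya: y * a \in H by rewrite HE ?groupM // ?ZE.
by rewrite /lam pi_add // pi_opp // pi_stabZ ?Ystab // (pi_ue Yy yb).
Qed.

Let nz_uq : (u *+ q)%R <> 0%R. Proof. by move/divq. Qed.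

Let nz_ueq : (act u e *+ q)%R <> 0%R.
Proof. by move/divq/eqP; rewrite act_eq0 ?HE // => /eqP. Qed.

(** Let [b = [~ y, e^-1]].  Among the vectors [pi q (y * a) lam] for [a] in
    [Z0] only those with [a = 1] and [a = b^-1] are nonzero.  Acting by [g]
    multiplies the index [a] by [s = [~ y, g]], and as [q] is odd, a set of
    two elements of [Z0] is invariant under multiplication by [s] only if
    [s = 1].  Comparing the vectors of index 1 shows that [g] fixes [u]. *)
Let lam_cent y g : y \in Y -> ~ commute y e -> g \in E -> g \in stab lam ->
  commute g y /\ act u g = u.
Proof.
move=> Yy ncye Eg /stabP[Hg lamg]; have Ey := YE Yy.
have [b [Zb yb b1]] := conjVe Ey.
have ntb: b != 1.
  by rewrite b1; apply/eqP=> ye; apply: ncye; apply/commgP/conjg_fixP.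
have [s Zs ys] := conjE Ey Eg.
have shift a : a \in Z0 -> act (pi q (y * a) lam) g = pi q (y * (s * a)) lam.
  move=> Za; rewrite pi_act ?HE // ?groupM // ?ZE // lamg conjMg ys -mulgA.
  by have -> : a ^ g = a by apply/conjg_fixP/commgP/ccZ.
have f1: pi q (y * 1) lam = (u *+ q)%R.
  by rewrite (pi_lam Yy yb) ?group1 // eqxx mulg1 (negPf ntb) subr0.
have fb: pi q (y * b^-1) lam = (- (act u e *+ q))%R.
  by rewrite (pi_lam Yy yb) ?groupV // mulgV eqxx eq_invg1 (negPf ntb) sub0r.
have nzf a : a \in Z0 -> pi q (y * a) lam <> 0%R -> (a == 1) || (a == b^-1).
  move=> Za; rewrite (pi_lam Yy yb) //; case: (a == 1) => //=.
  by rewrite [a == _]eq_sym eq_invg_mul; case: ifP => // _; rewrite subr0.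
suffices s1: s = 1.
  split; first by apply/commute_sym/commgP/conjg_fixP; rewrite ys s1 mulg1.
  have := shift 1 (group1 _); rewrite s1 mul1g f1 act_muln // => eq_uq.
  by apply/eqP; rewrite -subr_eq0; apply/eqP/divq; rewrite mulrnBl eq_uq subrr.
have: (s * 1 == 1) || (s * 1 == b^-1).
  apply: nzf; first by rewrite mulg1.
  by rewrite -shift // f1; apply/eqP; rewrite act_eq0 //; apply/eqP.
rewrite mulg1 => /orP[/eqP // | /eqP sb].
have: (s * b^-1 == 1) || (s * b^-1 == b^-1).
  apply: nzf; first by rewrite groupM ?groupV.
  rewrite -shift ?groupV // fb; apply/eqP; rewrite act_eq0 // oppr_eq0.
  exact/eqP.
case/orP; last by rewrite -{2}[b^-1]mul1g => /eqP/mulIg.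
rewrite sb -invMg eq_invg1 -expg2 -order_dvdn => o2.
have: #[b] %| q by rewrite order_dvdn expE ?ZE.
move: (dvdn_leq (isT : 0 < 2) o2) ntb; rewrite -order_eq1.
case: #[b] o2 => [|[|[|]]] // _ _ _; rewrite dvdn2 odd_q //.
Qed.

Let lam_neq0 : lam <> 0%R.
Proof.
move/eqP; rewrite subr_eq0 => /eqP ue; apply: ncxe.
apply: (comm_stab nzu) => //; first exact: Ystab.
by apply/stabP; rewrite HE.
Qed.

Let Y_split y : y \in Y -> exists k, y * x ^+ k \in Y'.
Proof.
move=> Yy; have [b Zb xb] := conjE Ex Ee; have [c Zc yc] := conjE (YE Yy) Ee.
have ntb: b != 1.
  by apply: contra_not_neq ncxe => b1; apply/commgP/conjg_fixP; rewrite xb b1 mulg1.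
have: c^-1 \in <[b]> by rewrite (genZ Zb ntb) groupV.
case/cycleP=> k ck; exists k; apply/setIP; split; first by rewrite groupM ?groupX.
apply/cent1P/commgP/conjg_fixP; rewrite conjMg conjXg yc xb expgMn; last first.
  exact/commute_sym/ccZ.
rewrite -ck -mulgA; congr (_ * _).
have ccx: commute c (x ^+ k) by apply: ccZ; rewrite ?groupX.
by rewrite mulgA ccx -mulgA mulgV mulg1.
Qed.

Let E_lam g : g \in E -> g \in stab lam -> g \in Y'.
Proof.
move=> Eg lamg; have [_ ug] := lam_cent Yx ncxe Eg lamg.
have [Hg lg] := stabP lam g lamg.
have Yg: g \in Y by apply/setIP; split=> //; apply/stabP.
apply/setIP; split=> //; apply/cent1P/commgP/conjg_fixP.
have [b [Zb gb b1]] := conjVe Eg; apply/eqP; rewrite -b1; apply/eqP.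
apply: (stabZ nzu Zb); rewrite -(groupMl b (Ystab Yg)) -gb.
have ueg: act (act u e) g = act u e.
  by move: lg; rewrite /lam act_sub // ug => /addrI/oppr_inj.
apply/stabP; split; first by rewrite groupJ ?groupV ?HE.
by rewrite conjgE invgK !actM ?groupM ?groupV ?HE // ueg actK ?HE.
Qed.

Let Y'E : Y' \subset E. Proof. by apply/subsetP=> y /Y'Y/YE. Qed.

Let Y'lam : Y' \subset stab lam.
Proof.
apply/subsetP=> y Y'y; have Yy := Y'Y Y'y; have Hy := HE (YE Yy).
have /stabP[_ uy] := Ystab Yy.
apply/stabP; split=> //; rewrite /lam act_sub // uy -actM ?(HE Ee) //.
by rewrite -(Y'e Y'y) actM ?(HE Ee) // uy.
Qed.

Let E_lam_eq : E :&: stab lam = Y'.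
Proof.
apply/eqP; rewrite eqEsubset subsetI Y'E Y'lam !andbT.
by apply/subsetP=> g /setIP[Eg]; apply: E_lam.
Qed.

Let R := 'C_E(Y')%G.

Let RE c : c \in R -> c \in E. Proof. by case/setIP. Qed.
Let RY' c y : c \in R -> y \in Y' -> commute c y.
Proof. by case/setIP=> _ /centP cY; apply: cY. Qed.

(** If [c] commutes with [x], it lies in [Y * Z0] and at most two of the
    [q > 2] norms are nonzero, by [pi_lam].  Otherwise a power of [c] acts on
    [x] as [e] does, so it agrees with [e] up to an element of [Y * Z0].  Then
    [lam = u - act u w] for a generator [w] of some [<[c * a]>], and the norm
    of [w] kills it. *)
Let lam_vanish c : c \in R -> exists2 a, a \in Z0 & pi q (c * a) lam = 0%R.
Proof.
move=> Rc; have Ec := RE Rc.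
have [/eqP cxc | ncxc] := boolP (c * x == x * c).
  have [|a1 Za1 Yca1] := @centY c Ec.
    move=> y Yy; have [k Y'yk] := Y_split Yy.
    rewrite -[y](mulgK (x ^+ k)); apply: commuteM; first exact: RY'.
    exact/commuteV/commuteX.
  have [b [Zb cb _]] := conjVe (YE Yca1).
  have [a Za]: exists2 a, a \in Z0 & (a != 1) && (b * a != 1).
    have: ~~ (Z0 \subset [set 1; b^-1]).
      apply/negP=> /subset_leq_card; rewrite oZ cards2.
      by move/(leq_trans (odd_prime_gt2 odd_q pr_q)); case: (_ != _).
    case/subsetPn=> a Za; rewrite !inE negb_or => /andP[nta nab]; exists a => //.
    by rewrite nta; apply: contra nab; rewrite -eq_invg_mul eq_sym.
  case/andP=> nta ntba; exists (a1 * a); first by rewrite groupM.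
  by rewrite mulgA (pi_lam Yca1 cb) // (negPf nta) (negPf ntba) subrr.
have [b Zb xb] := conjE Ex Ec; have [d Zd xd] := conjE Ex Ee.
have ntb: b != 1.
  apply: contra ncxc => /eqP b1; rewrite eq_sym; apply/eqP.
  by apply/commgP/conjg_fixP; rewrite xb b1 mulg1.
have ntd: d != 1.
  by apply: contra_not_neq ncxe => d1; apply/commgP/conjg_fixP; rewrite xd d1 mulg1.
have /cycleP[k dk]: d \in <[b]> by rewrite (genZ Zb ntb).
have co_k: coprime q k.
  rewrite prime_coprime //; apply: contra ntd => /dvdnP[m km].
  by rewrite dk km mulnC expgM expE ?ZE // expg1n.
have xck: x ^ (c ^+ k) = x * d.
  rewrite dk; elim: (k) => [|m IHm]; first by rewrite !expg0 conjg1 mulg1.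
  have bc: b ^ c = b by apply/conjg_fixP/commgP/ccZ.
  by rewrite !expgSr conjgM IHm conjMg xb conjXg bc -mulgA -expgS -expgSr.
pose g := e * (c ^+ k)^-1.
have Eg: g \in E by rewrite groupM ?groupV ?groupX.
have cgx: commute g x.
  by apply/commute_sym/commgP/conjg_fixP; rewrite conjgM xd -xck -conjgM mulgV conjg1.
have [|a Za Yga] := @centY g Eg.
  move=> y Yy; have [m Y'ym] := Y_split Yy.
  rewrite -[y](mulgK (x ^+ m)); apply: commuteM; last exact/commuteV/commuteX.
  apply/commute_sym/commuteM; first exact: Y'e.
  by apply/commuteV/commuteX/commute_sym/RY'.
pose a' := a^-1 ^+ expg_invn Z0 k.
have Za': a' \in Z0 by rewrite groupX ?groupV.
have a'k: a' ^+ k = a^-1.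
  by rewrite /a' expgAC expgK ?groupV // oZ.
exists a' => //; have Eca: c * a' \in E by rewrite groupM // ZE.
rewrite -(pi_exp _ pr_q (HE Eca) (expE Eca) co_k).
rewrite expgMn; last exact/commute_sym/ccZ.
rewrite a'k; set w := c ^+ k * a^-1.
have Ew: w \in E by rewrite groupM ?groupX // groupV ZE.
have uw: act u e = act u w.
  have ->: e = (g * a) * w.
    have cca: commute a (c ^+ k) by apply: ccZ; rewrite ?groupX.
    by rewrite /g /w -!mulgA [a * _]mulgA cca -mulgA mulgV mulg1 mulVg mulg1.
  by have /stabP[Hga uga] := Ystab Yga; rewrite [LHS]actM ?(HE Ew) // uga.
by rewrite /lam uw pi_tel ?HE ?expE.
Qed.

(** Let [D] be a Sylow [q]-subgroup of [stab lam].  It normalizes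
    [R = 'C_E(Y')], which contains [x] and so is larger than [Y' * Z0].  As
    [R] is normal in the [q]-group [R <*> D], it meets the centre of the latter
    modulo [Y' * Z0], so [D] centralizes modulo [Y' * Z0] some [c] in [R] that
    lies outside [Y' * Z0].
    If [D] even centralizes [c] modulo [Y'], then [D] and [c * a] fix a nonzero
    vector [pi q (c * a) lam], so [c * a] lies in [D] by [stab_Sylow_max], and
    then in [Y'] by [E_lam].
    Otherwise an element of [D] permutes the vectors [pi q (c * a) lam] for
    [a] in [Z0] transitively, and all vanish by [lam_vanish], against
    [pi_some]. *)
Lemma no_maximal_stabilizer : False.
Proof.
have [D sylD] := Sylow_exists q (stab_group lam).
have [sDT qD _] := and3P sylD; have sDH := subset_trans sDT (stab_sub lam).
have HD d : d \in D -> d \in H := fun Dd => subsetP sDH d Dd.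
have Dlam d : d \in D -> act lam d = lam by move/(subsetP sDT)/stabP=> [].
have nED: D \subset 'N(E) := subset_trans sDH (normal_norm nEH).
have nY'T: stab lam \subset 'N(Y').
  rewrite -E_lam_eq normsI ?normG //.
  exact: subset_trans (stab_sub lam) (normal_norm nEH).
have nY'D := subset_trans sDT nY'T.
have sY'D: Y' \subset D.
  have nY': Y' <| stab_group lam by rewrite /normal Y'lam.
  by rewrite (normal_sub_max_pgroup (Hall_max sylD)) // (pgroupS Y'E).
have nRD: D \subset 'N(R) by rewrite normsI ?norms_cent.
have nZD: D \subset 'N(Z0) := subset_trans sDH (normal_norm nZH).
have cZD d a : d \in D -> a \in Z0 -> a ^ d = a.
  move=> Dd Za; have qZD: q.-group (Z0 <*> D).
    by rewrite norm_joinEr // pgroupM qD (pgroupS sZE).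
  have: Z0 \subset 'Z(Z0 <*> D).
    apply: contraR Z_neq1 => nsZ; apply/eqP.
    apply: (TI_center_nil (pgroup_nil qZD)).
      by rewrite /normal joing_subl join_subG normG.
    by rewrite prime_TIg ?oZ.
  move/subsetP=> /(_ a Za)/centerP[_ /(_ d)].
  by rewrite mem_gen ?inE ?Dd ?orbT // => /(_ isT)/commgP/conjg_fixP.
pose YZ := (Y' <*> Z0)%G.
have cYZ: Z0 \subset 'C(Y').
  by apply/centsP=> a Za y Y'y; apply: ccZ => //; apply: (subsetP Y'E).
have YZP g : g \in YZ -> exists y a, [/\ y \in Y', a \in Z0 & g = y * a].
  rewrite /= cent_joinEr // => /mulsgP[y a Y'y Za ->]; by exists y, a.
have mulYZ y a : y \in Y' -> a \in Z0 -> y * a \in YZ.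
  by move=> Y'y Za; rewrite groupM ?mem_gen // inE ?Y'y ?Za ?orbT.
have sY'R: Y' \subset R.
  rewrite subsetI Y'E; apply/centsP=> y1 Y'y1 y2 Y'y2.
  by apply: (comm_stab nzu); rewrite ?YE ?Ystab ?Y'Y.
have sZR: Z0 \subset R by rewrite subsetI sZE.
have sYZR: YZ \subset R by rewrite join_subG sY'R.
have Rx: x \in R.
  apply/setIP; split=> //; apply/centP=> y Y'y.
  exact: (comm_stab nzu Ex (YE (Y'Y Y'y)) (Ystab Yx) (Ystab (Y'Y Y'y))).
have YZx: x \notin YZ.
  apply/negP=> /YZP[y [a [Y'y Za def_x]]].
  have a1: a = 1.
    apply: (stabZ nzu Za); rewrite -(groupMl a (Ystab (Y'Y Y'y))) -def_x.
    exact: Ystab.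
  by apply: ncxe; rewrite def_x a1 mulg1; apply: Y'e.
have qR: q.-group R := pgroupS (subsetIl _ _) qE.
have qL: q.-group (R <*> D) by rewrite norm_joinEr // pgroupM qR.
have nYZL: R <*> D \subset 'N(YZ).
  rewrite join_subG; apply/andP; split.
    apply: subset_trans (normsY _ _); last 2 first.
    - exact: (cents_norm (subsetIr E 'C(Y'))).
    - apply: subset_trans (normal_norm nZH); exact: subset_trans (subsetIl _ _) sEH.
    by [].
  by rewrite normsY.
have [c Rc [YZc cD]]: exists2 c, c \in R & c \notin YZ /\
    forall d, d \in D -> [~ c, d] \in YZ.
  have ntR: R / YZ != 1.
    rewrite -subG1 quotient_sub1; first by apply/subsetPn; exists x.
    exact: subset_trans (joing_subl R D) nYZL.
  have [|cb /setIP[/morphimP[c nYZc Rc ->{cb}] /centerP[_ cL]] ntc] := 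
      trivgPn (R / YZ :&: 'Z(R <*> D / YZ))%G _.
    apply: contra ntR => /eqP tiRZ; apply/eqP.
    apply: (@TI_center_nil _ (R <*> D / YZ)%G (R / YZ)%G) => //.
      by rewrite quotient_nil // (pgroup_nil qL).
    by rewrite quotient_normal // /normal joing_subl join_subG normG.
  exists c => //; split.
    by apply: contra ntc => YZc; apply/eqP/coset_id.
  move=> d Dd; have Ld: d \in R <*> D by rewrite mem_gen // inE Dd orbT.
  have nYZd := subsetP nYZL d Ld.
  apply: coset_idr; first by rewrite groupR.
  by rewrite morphR //; apply/eqP/commgP/cL/mem_quotient.
have Ec := RE Rc.
have cdP d : d \in D -> exists y s, [/\ y \in Y', s \in Z0 & c ^ d = y * (c * s)].
  move=> Dd; have [y [s [Y'y Zs def_cd]]] := YZP _ (cD d Dd).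
  exists y, s; split=> //; rewrite conjg_mulR def_cd !mulgA.
  by rewrite (RY' Rc Y'y).
pose f a := pi q (c * a) lam.
have shift d y s a : d \in D -> y \in Y' -> s \in Z0 -> c ^ d = y * (c * s) ->
    a \in Z0 -> act (f a) d = f (s * a).
  move=> Dd Y'y Zs cd Za; have Eca: c * a \in E by rewrite groupM // ZE.
  rewrite /f pi_act ?(HE Eca) ?(HD d Dd) // Dlam // conjMg cd cZD // -!mulgA pi_mul_stab //.
  - by rewrite HE ?groupM // ZE.
  - exact: subsetP Y'lam y Y'y.
  apply: commuteM; first exact/commute_sym/RY'.
  apply/commute_sym; apply: ccZ; last exact: (subsetP Y'E).
  by rewrite groupM.
have [triv | /forall_inPn[d Dd]] := boolP [forall d in D, c ^ d * c^-1 \in Y'].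
  have [a Za nzv] := pi_some Ec lam_neq0; set v := pi _ _ _ in nzv.
  pose w := c * a; have Ew: w \in E by rewrite groupM // ZE.
  have wD d : d \in D -> exists2 y, y \in Y' & c ^ d = y * (c * 1).
    move=> Dd; exists (c ^ d * c^-1); first exact: (forall_inP triv).
    by rewrite mulg1 mulgKV.
  have sDv: D \subset stab v.
    apply/subsetP=> d Dd; have [y Y'y cd] := wD d Dd.
    apply/stabP; split; first exact: HD.
    by rewrite -[v]/(f a) (shift _ _ _ _ Dd Y'y _ cd) // mul1g.
  have nDw: <[w]> \subset 'N(D).
    rewrite cycle_subG; apply/normP/eqP; rewrite eqEcard cardJg leqnn andbT.
    apply/subsetP=> _ /imsetP[d Dd ->]; have [y Y'y cd] := wD d Dd.
    have wd: w ^ d = y * w by rewrite /w conjMg cd mulg1 cZD // mulgA.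
    have cyw: commute y w.
      apply: commuteM; first exact/commute_sym/RY'.
      by apply/commute_sym/ccZ => //; apply: (subsetP Y'E).
    have ->: d ^ w = d * y^-1.
      apply: (mulIg y); rewrite mulgKV.
      have ->: d ^ w * y = w^-1 * (d * (y * w)) by rewrite cyw conjgE !mulgA.
      by rewrite -wd -conjgC mulKg.
    by rewrite groupM // groupV (subsetP sY'D).
  have wv: act v w = v by apply: pi_fix; rewrite ?(HE Ew) ?(expE Ew).
  have sDw: D <*> <[w]> \subset D.
    apply: (@stab_Sylow_max _ _ D (D <*> <[w]>)%G lam_neq0 nzv sylD).
    - rewrite /= norm_joinEr // pgroupM qD /=.
      by apply: pgroupS qE; rewrite cycle_subG.
    - by rewrite join_subG sDv cycle_subG; apply/stabP; rewrite (HE Ew).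
    exact: joing_subl.
  have Y'w: w \in Y'.
    apply: E_lam => //; apply: (subsetP sDT); apply: (subsetP sDw).
    by rewrite mem_gen // inE cycle_id orbT.
  case/negP: YZc; rewrite -[c](mulgK a) groupM ?groupV //.
    by rewrite mem_gen // inE Y'w.
  by rewrite mem_gen // inE Za orbT.
move=> nY'cd; have [y [s [Y'y Zs cd]]] := cdP d Dd.
have nts: s != 1.
  by apply: contra nY'cd => /eqP s1; rewrite cd s1 mulg1 mulgK.
have [a0 Za0 fa0] := lam_vanish Rc.
have [a Za nzfa] := pi_some Ec lam_neq0.
case: nzfa; have /cycleP[k ak]: a * a0^-1 \in <[s]>.
  by rewrite (genZ Zs nts) groupM ?groupV.
rewrite -[a](mulgKV a0) ak -/(f _); elim: (k) => [|m IHm].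
  by rewrite expg0 mul1g.
have Za1: s ^+ m * a0 \in Z0 by rewrite groupM ?groupX.
by rewrite expgS -mulgA -(shift _ _ _ _ Dd Y'y Zs cd Za1) IHm act0 ?(HD d Dd).
Qed.

End MaximalStabilizer.

(** If [E] is larger than its centre [Z0], choose [u] with a stabilizer in [E]
    of maximal order and apply [no_maximal_stabilizer]. *)
Lemma extraspecial_trivial : E :=: Z0.
Proof.
apply/eqP/idPn=> neqEZ.
have [v0 nzv0]: exists v0 : V, v0 != 0%R.
  apply/existsP; apply: contraR Z_neq1 => /existsPn V0.
  apply/eqP/trivgP/subsetP=> z Zz; rewrite inE; apply/eqP/faith => [|v].
    exact/HE/ZE.
  have V0' w : w = 0%R by apply/eqP; move: (V0 w); rewrite negbK.
  by rewrite (V0' (act v z)) (V0' v).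
pose u := [arg max_(v > v0 | v != 0%R) #|E :&: stab v|].
have [nzu maxu]: u <> 0%R /\ forall v, v <> 0%R -> #|E :&: stab v| <= #|E :&: stab u|.
  by rewrite /u; case: arg_maxnP => // v /eqP nzv maxv; split=> // w /eqP/maxv.
have [e [x [Ee Yx ncxe]]] := exists_noncommuting nzu maxu neqEZ.
exact: no_maximal_stabilizer nzu maxu _ _ Ee Yx ncxe.
Qed.

End ExtraspecialLike.

(** By [odd_normal_abelem], [Z0 = 'Ohm_1('Z(Q))] has order [q].  Let [W / Z0] be
    the centre of [Q / Z0] and [E = 'Ohm_1(W)].  As [W] has class at most 2
    and [q] is odd, [E] has exponent [q], and its centre is [Z0] by
    [odd_normal_abelem] again.  A noncyclic [Q] has a noncyclic abelian normal
    subgroup, so [E] is larger than [Z0], against [extraspecial_trivial]. *)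
Lemma odd_normal_pgroup_cyclic (Q : {group gT}) : odd q -> q.-group Q -> Q <| H -> cyclic Q.
Proof.
move=> odd_q qQ nQH; have sQH := normal_sub nQH.
have oddQ: odd #|Q| by rewrite (card_pgroup qQ) oddX odd_q orbT.
apply: contraT => ncQ; have ntQ: Q :!=: 1 by apply: contraNneq ncQ => ->; apply: cyclic1.
have nilQ := pgroup_nil qQ.
have [X [nXQ cXX ncX]]: exists X : {group gT}, [/\ X <| Q, abelian X & ~~ cyclic X].
  have [/existsP[X /and3P[nXQ cXX ncX]] | noX] :=
    boolP [exists X : {group gT}, [&& X <| Q, abelian X & ~~ cyclic X]].
    by exists X.
  case: (@normal_rank1_structure _ q Q qQ) => [X nXQ cXX | cQ |].
  - by apply: contraNT noX => ncX; apply/existsP; exists X; rewrite nXQ cXX.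
  - by rewrite cQ in ncQ.
  by rewrite (negPf (odd_not_extremal2 oddQ)) andbF.
have qX: q.-group X := pgroupS (normal_sub nXQ) qQ.
pose Z0 := 'Ohm_1('Z(Q))%G.
have abZ: q.-abelem Z0 by apply: Ohm1_abelem; rewrite ?center_abelian // (pgroupS (center_sub _)).
have chZ: Z0 \char Q by apply: char_trans (center_char Q); apply: Ohm_char.
have nZH: Z0 <| H := char_normal_trans chZ nQH.
have ntZ: Z0 :!=: 1 by rewrite /= Ohm1_eq1 center_nil_eq1.
have oZ: #|Z0| = q := odd_normal_abelem nZH abZ ntZ odd_q.
have sZZQ: Z0 \subset 'Z(Q) := Ohm_sub 1 _.
have nZQ: Q \subset 'N(Z0) := subset_trans sQH (normal_norm nZH).
pose W := (coset Z0 @*^-1 'Z(Q / Z0))%G.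
have nZ_Q : Z0 <| Q by rewrite /normal (char_sub chZ).
have nWH: W <| H.
  rewrite -(quotientGK nZH) cosetpre_normal.
  by rewrite (char_normal_trans (center_char _)) ?quotient_normal.
have sWQ: W \subset Q.
  by rewrite -(quotientGK nZ_Q) cosetpreSK center_sub.
have sZW: Z0 \subset W by rewrite sub_cosetpre.
have sWQZ: [~: W, Q] \subset Z0.
  have nZW := subset_trans sWQ nZQ.
  rewrite -quotient_cents2 // /W cosetpreK.
  by rewrite (subset_trans (subsetIr _ _)).
pose E := 'Ohm_1(W)%G.
have qW: q.-group W := pgroupS sWQ qQ.
have sEW: E \subset W := Ohm_sub 1 _.
have sEQ := subset_trans sEW sWQ.
have nEH: E <| H := char_normal_trans (Ohm_char 1 W) nWH.
have expE x : x \in E -> x ^+ q = 1.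
  apply/exponentP; apply: exponent_Ohm1_class2 => //.
  rewrite nil_class2 (subset_trans (commgS _ sWQ)) // (subset_trans sWQZ) //.
  rewrite subsetI sZW (subset_trans sZZQ) // (subset_trans (subsetIr _ _)) //.
  exact: centS.
have sZE: Z0 \subset E by rewrite -(Ohm1_id abZ) OhmS.
have neqEZ: E :!=: Z0.
  pose X1 := 'Ohm_1(X)%G; have abX1: q.-abelem X1 := Ohm1_abelem qX cXX.
  have nX1Q: X1 <| Q := char_normal_trans (Ohm_char 1 X) nXQ.
  have nsX1Z: ~~ (X1 \subset Z0).
    apply: contra ncX => sX1Z; rewrite abelian_rank1_cyclic // -rank_Ohm1.
    have:= rankS sX1Z; rewrite (rank_abelem abZ) oZ.
    by rewrite -[X in logn q X]expn1 pfactorK.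
  have sX1Q := normal_sub nX1Q; have nZX1 := subset_trans sX1Q nZQ.
  have ntX1Z: X1 / Z0 != 1 by rewrite -subG1 quotient_sub1.
  have [|xb /setIP[/morphimP[x nZx X1x ->{xb}] Zx] ntx] :=
      trivgPn (X1 / Z0 :&: 'Z(Q / Z0))%G _.
    apply: contra ntX1Z => /eqP tiXZ; apply/eqP.
    apply: (@TI_center_nil _ (Q / Z0)%G (X1 / Z0)%G) => //.
      by rewrite quotient_nil.
    by rewrite quotient_normal.
  have Wx: x \in W by apply/morphpreP.
  have Ex: x \in E.
    have /abelemP[//|_ /(_ x X1x) xq1] := abX1.
    by rewrite /= (OhmE 1 qW) mem_gen //; apply/LdivP; rewrite expn1.
  by apply: contraNneq ntx => eqEZ; apply/eqP/coset_id; rewrite -eqEZ.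
have defZ: 'Z(E) = Z0.
  have sZZE: Z0 \subset 'Z(E).
    rewrite subsetI sZE (subset_trans sZZQ) // (subset_trans (subsetIr _ _)) //.
    exact: centS.
  apply/esym/eqP; rewrite eqEcard sZZE oZ /=.
  rewrite -(@odd_normal_abelem 'Z(E)%G) ?leqnn //.
  - exact: char_normal_trans (center_char E) nEH.
  - apply/abelemP=> //; split=> [|x /setIP[Ex _]]; first exact: center_abelian.
    exact: expE.
  by apply: contraNneq ntZ => ZE1; rewrite -subG1 -ZE1.
case/eqP: neqEZ; apply: (extraspecial_trivial odd_q nEH) => //.
  exact: pgroupS sEQ qQ.
exact: subset_trans (commgSS sEW sEQ) sWQZ.
Qed.

End Primes.

End HalfTransitive.

(** * Irreducible characters of small prime power degree *)

(** Up to a factor, ['Ind 'chi_t] is ['Ind ('Res 'chi_i) = 'chi_i * 'Ind 1], the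
    sum of the products of ['chi_i] with the linear characters of [L / N]. *)
Lemma twist_transitive (gT : finGroupType) (L N : {group gT}) (t : Iirr N) (i j : Iirr L) :
    N <| L -> abelian (L / N) -> L \subset 'I['chi_t]%R ->
    i \in irr_constt ('Ind[L] 'chi_t)%R -> j \in irr_constt ('Ind[L] 'chi_t)%R ->
  exists b : Iirr (L / N), ('chi_j = 'chi_i * ('chi_b %% N)%CF)%R.
Proof.
move=> nNL /char_abelianP linQ ItL Ii Ij; have [sNL nNL'] := andP nNL.
have [Ri Rj]: t \in irr_constt ('Res[N] 'chi_i)%R /\ t \in irr_constt ('Res[N] 'chi_j)%R.
  by rewrite -!constt_Ind_Res.
have := Clifford_Res_sum_cfclass nNL Ri; rewrite cfclass_invariant // big_seq1.
set e := '[_, _]%R => defR.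
have ne : (e != 0)%R by move: Ri; rewrite irr_consttE.
have defI : (e *: 'Ind[L] 'chi_t = \sum_b 'chi_i * ('chi[L / N]_b %% N)%CF)%R.
  rewrite -linearZ /= -defR -[('Res[N] _)%R]mul1r cfIndM // cfInd_cfun1 // mulrC -mulr_sumr; congr (_ * _)%R.
  have := cfReg_sum (L / N).
  under eq_bigr => b _ do rewrite lin_char1 ?linQ // scale1r.
  rewrite -linear_sum => <-; apply/cfun_inP=> x Lx.
  rewrite cfModE // cfRegE !cfunE cfuniE // card_quotient // mulr_natr.
  congr (_ *+ _)%R; rewrite (sameP eqP (kerP _ _)) ?(subsetP nNL') // ker_coset //. 
have irrT b : ('chi_i * ('chi[L / N]_b %% N)%CF)%R \in irr L.
  by rewrite mulrC mul_lin_irr ?mem_irr // cfMod_lin_char.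
have := Ij; rewrite irr_consttE -(mulrI_eq0 _ (mulfI ne)) -cfdotZl defI cfdot_suml.
case: (pickP (fun b => 'chi_j == 'chi_i * ('chi[L / N]_b %% N)%CF)%R) => [b /eqP | nob].
  by exists b.
case/negP; rewrite big1 // => b _.
have /irrP[k defk] := irrT b; rewrite defk cfdot_irr; case: eqP => // kj.
by have := nob b; rewrite defk kj eqxx.
Qed.

(** By [twist_transitive] all constituents of ['Ind 'chi_t] have the same degree,
    hence the same multiplicity [e]; compare degrees in ['Ind 'chi_t]. *)
Lemma twist_count (gT : finGroupType) (L N : {group gT}) (t : Iirr N) (i : Iirr L) :
    N <| L -> abelian (L / N) -> L \subset 'I['chi_t]%R ->
    i \in irr_constt ('Ind[L] 'chi_t)%R ->
  exists e : nat, [/\ 'Res[N] 'chi_i = 'chi_t *+ e, 'chi_i 1%g = 'chi_t 1%g *+ e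
    & (#|L : N| = e ^ 2 * #|irr_constt ('Ind[L, N] 'chi_t)|)%N]%R.
Proof.
move=> nNL abQ ItL Ii; have [sNL nNL'] := andP nNL.
have deg j : j \in irr_constt ('Ind[L] 'chi_t)%R -> ('chi_j 1%g = 'chi_i 1%g)%R.
  move=> Ij; have [b ->] := twist_transitive nNL abQ ItL Ii Ij.
  have /char_abelianP linQ := abQ.
  by rewrite cfunE cfMod1 (lin_char1 (linQ b)) mulr1.
have ResE j : j \in irr_constt ('Ind[L] 'chi_t)%R ->
    ('Res[N] 'chi_j = '['Ind[L] 'chi_t, 'chi_j] *: 'chi_t)%R.
  rewrite constt_Ind_Res => Rj.
  have := Clifford_Res_sum_cfclass nNL Rj; rewrite cfclass_invariant // big_seq1.
  by rewrite -cfdot_Res_r cfdotC_char ?cfRes_char ?irr_char.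
have mulE j : j \in irr_constt ('Ind[L] 'chi_t)%R ->
    ('['Ind[L] 'chi_t, 'chi_j] = 'chi_i 1%g / 'chi_t 1%g)%R.
  move=> Ij; rewrite -(deg j Ij) -(cfRes1 N) (ResE j Ij) cfunE mulfK //.
  exact: irr1_neq0.
have /natrP[e def_e] : ('['Ind[L] 'chi_t, 'chi_i] \is a Num.nat)%R.
  by rewrite Cnat_cfdot_char ?irr_char ?cfInd_char ?irr_char.
exists e; have Ri := ResE i Ii; rewrite def_e scaler_nat in Ri.
have deg_i : ('chi_i 1%g = 'chi_t 1%g *+ e)%R.
  by rewrite -(cfRes1 N) Ri -scaler_nat cfunE mulr_natl.
split=> //; apply/eqP; rewrite -(eqr_nat algC).
have := congr1 (fun f : 'CF(L) => f 1%g) (cfun_sum_constt ('Ind[L] 'chi_t)%R).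
rewrite cfInd1 // sum_cfunE.
rewrite (eq_bigr (fun=> 'chi_t 1%g *+ (e ^ 2)))%R; last first.
  move=> j Ij; rewrite cfunE (mulE j Ij) -(mulE i Ii) def_e (deg j Ij) deg_i.
  by rewrite mulr_natl -mulrnA mulnn.
by rewrite sumr_const -mulrnA -[RHS]mulr_natl => /(mulIf (irr1_neq0 t))->.
Qed.

(** Fix a constituent [chi0].  Its conjugate under [k] is [chi0 * a k] for a
    linear character [a k] of [L / N], and [a (k * g)] and [a g * (a k ^ g)]
    agree as factors of [chi0].  As [#|K|] is invertible modulo the exponent
    of the linear characters of [L / N], multiplying [chi0] by the average of
    the [a k] gives a constituent that is invariant under [K]. *)
Lemma coprime_invariant_constt (gT : finGroupType) (X L N K : {group gT}) (t : Iirr N) :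
    N <| X -> L <| X -> N \subset L -> abelian (L / N) -> X \subset 'I['chi_t]%R ->
    K \subset X -> coprime #|L : N| #|K| ->
  exists2 i : Iirr L, i \in irr_constt ('Ind[L] 'chi_t)%R & K \subset 'I['chi_i]%R.
Proof.
move=> nNX nLX sNL abQ ItX sKX coKL; have sLX := normal_sub nLX.
have nNL := normalS sNL sLX nNX.
have ItL := subset_trans sLX ItX.
have [i0 Ii0] := constt_cfInd_irr t sNL; set chi0 := ('chi_i0)%R.
pose b k := odflt 0%R [pick b | (chi0 ^ k)%CF == (chi0 * ('chi[L / N]_b %% N)%CF)%R].
pose a k : 'CF(L) := (('chi[L / N]_(b k))%R %% N)%CF.
have aE k : k \in X -> (chi0 ^ k)%CF = (chi0 * a k)%R.
  move=> Xk; rewrite /a /b; case: pickP => [c /eqP // | nob].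
  have nLk := subsetP (normal_norm nLX) k Xk.
  have [//||c] := @twist_transitive _ L N t i0 (conjg_Iirr i0 k) nNL abQ ItL.
    rewrite constt_Ind_Res conjg_IirrE -(cfConjgRes _ nLX nNX Xk) irr_consttE.
    rewrite -{1}(inertiaJ (subsetP ItX k Xk)) cfConjg_iso.
    by rewrite constt_Ind_Res irr_consttE in Ii0.
  by rewrite conjg_IirrE => eqb; have:= nob c; rewrite eqb eqxx.
have lin_a k : a k \is a linear_char.
  by rewrite cfMod_lin_char //; apply/char_abelianP.
have a_exp k : (a k ^+ #|L : N| = 1)%R.
  rewrite /a -rmorphXn /= -card_quotient ?normal_norm //.
  have lin_b: ('chi_(b k))%R \is a linear_char by apply/char_abelianP.
  by have := cforder_lin_char_dvdG lin_b; rewrite dvdn_cforder => /eqP->; rewrite rmorph1.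
have aRes k : ('Res[N] (a k) = 1)%R.
  have ker_a : N \subset cfker (a k) by apply: cfker_mod.
  apply/cfun_inP=> x Nx; rewrite cfResE // cfun1E Nx.
  by rewrite (cfker1 (subsetP ker_a x Nx)) lin_char1.
have /(coprimeP _ (cardG_gt0 K))[u def_u] : coprime #|K| #|L : N| by rewrite coprime_sym.
have {def_u} mK : (u.1 * #|K| = u.2 * #|L : N| + 1)%N.
  by rewrite -def_u subnKC // ltnW // -subn_gt0 def_u.
(* The inverse of [#|K|] modulo [#|L : N|]. *)
set m := u.1 in mK.
have aX k : (a k ^+ (m * #|K|) = a k)%R.
  by rewrite mK exprD mulnC exprM a_exp expr1n mul1r expr1.
pose B := (\prod_(k in K) a k ^+ m)%R.
have lin_B : B \is a linear_char by rewrite rpred_prod // => k _; rewrite rpredX.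
have irr1 : (chi0 * B)%R \in irr L by rewrite mulrC mul_lin_irr ?mem_irr.
exists (cfIirr (chi0 * B)%R).
  rewrite constt_Ind_Res cfIirrE // irr_consttE rmorphM rmorph_prod /=.
  rewrite big1 => [|k _]; last by rewrite rmorphXn /= aRes expr1n.
  by rewrite mulr1; rewrite constt_Ind_Res irr_consttE in Ii0.
rewrite cfIirrE //; apply/subsetP=> g Kg; have Xg := subsetP sKX g Kg.
have nLg := subsetP (normal_norm nLX) g Xg.
rewrite inE nLg; apply/eqP; rewrite rmorphM rmorph_prod /= aE //.
(* Only the products with [chi0] of [a (k * g)] and [a g * (a k ^ g)] are known
   to be equal, so the factors of [B] are replaced one at a time. *)
have -> : (chi0 * B = chi0 * \prod_(k in K) (a g * (a k ^ g)%CF) ^+ m)%R.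
  rewrite /B (reindex_inj (mulIg g)) /=.
  under eq_bigl => k do rewrite groupMr //.
  apply: (big_rec2 (fun x y : 'CF(L) => chi0 * x = chi0 * y)%R) => // k x y Kk eqxy.
  have Xk := subsetP sKX k Kk.
  have eqk : (chi0 * a (k * g)%g = chi0 * (a g * (a k ^ g)%CF))%R.
    rewrite -aE ?groupM // (cfConjgM chi0 nLX Xk Xg).
    by rewrite aE // rmorphM /= aE // mulrA.
  elim: m {mK aX B lin_B irr1} => [|n IHn]; first by rewrite !expr0 !mul1r.
  rewrite !exprS -![(_ * _ ^+ _ * _)%R]mulrA [LHS]mulrCA IHn [LHS]mulrCA.
  by rewrite mulrA eqk -!mulrA.
under [in RHS]eq_bigr => k _ do rewrite exprMn.
rewrite big_split prodr_const -exprM aX mulrA /=; congr (_ * _)%R.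
by apply: eq_bigr => k _; rewrite rmorphXn.
Qed.

Definition irr_deg (gT : finGroupType) (G : {group gT}) (i : Iirr G) : nat :=
  Num.truncn ('chi_i 1%g)%R.

Lemma irr_degE (gT : finGroupType) (G : {group gT}) (i : Iirr G) :
  ('chi_i 1%g = (irr_deg i)%:R)%R.
Proof. by rewrite /irr_deg truncnK ?Cnat_irr1. Qed.

Lemma irr_deg_gt0 (gT : finGroupType) (G : {group gT}) (i : Iirr G) : 0 < irr_deg i.
Proof. by rewrite -(ltr_nat algC) -irr_degE irr1_gt0. Qed.

Lemma constt_Ind_trans (gT : finGroupType) (X L N : {group gT}) (t : Iirr N)
    (i : Iirr L) (c : Iirr X) : N \subset L -> L \subset X ->
  i \in irr_constt ('Ind[L] 'chi_t)%R -> c \in irr_constt ('Ind[X] 'chi_i)%R ->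
  c \in irr_constt ('Ind[X] 'chi_t)%R.
Proof.
move=> sNL sLX; rewrite !constt_Ind_Res => Ii.
move=> Ic; have /constt_charP := Ic; case=> [|psi Npsi defR]; first by rewrite cfRes_char ?irr_char.
rewrite -(cfResRes _ sNL sLX) defR linearD /= irr_consttE cfdotDl.
have /natrP[a Da] : ('['Res[N] psi, 'chi_t] \is a Num.nat)%R.
  by rewrite Cnat_cfdot_char ?irr_char ?cfRes_char.
move: Ii; rewrite irr_consttE.
have /natrP[b ->] : ('['Res[N] 'chi_i, 'chi_t] \is a Num.nat)%R.
  by rewrite Cnat_cfdot_char ?irr_char ?cfRes_char ?irr_char.
by rewrite Da -natrD !pnatr_eq0 addn_eq0 negb_and => ->.
Qed.

(** Induction along a chief series of [X] above [N], with first factor [L / N].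
    If [L / N] is a [q']-group, the extension of ['chi_t] to [L] with the same
    determinantal order is unique, so it is invariant in [X], and the degree
    does not change.  If [L / N] is a [q]-group, take a constituent ['chi_i]
    over ['chi_t] that is invariant under a Hall [q']-subgroup of [X].  Its
    inertia group [T] then has [q]-power index, and the conjugates of ['chi_i]
    are constituents of ['Ind 'chi_t], so [twist_count] bounds
    [#|X : T| * 'chi_i 1 ^+ 2] by ['chi_t 1 ^+ 2 * #|L : N|].  Apply the
    induction hypothesis in [T] and induce to [X]. *)
Lemma small_primary_degree q n (gT : finGroupType) (X N : {group gT}) (t : Iirr N) :
    prime q -> #|X : N| <= n -> solvable X -> N <| X -> X \subset 'I['chi_t]%R ->
    q.-nat (irr_deg t) -> q.-nat 'o(('chi_t)%R)%CF ->
  exists c : Iirr X, [/\ c \in irr_constt ('Ind[X] 'chi_t)%R, q.-nat (irr_deg c)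
    & irr_deg c ^ 2 <= irr_deg t ^ 2 * #|X : N|`_q].
Proof.
move=> pr_q; elim: n gT X N t => [|n IHn] gT X N t.
  by rewrite leqNgt indexg_gt0.
move=> leXN solX nNX ItX qt qdet.
have [sNX nNX'] := andP nNX.
case: (eqVneq (X : {set gT}) N) => [eqXN | neqXN].
  have {eqXN} /val_inj eqXN : X :=: N by [].
  subst X; exists t; rewrite indexgg partn1 muln1 leqnn; split=> //.
  by rewrite constt_Ind_Res cfRes_id constt_irr inE.
have ntX : X / N != 1.
  by rewrite -subG1 quotient_sub1 //; apply: contra neqXN; rewrite eqEsubset sNX => ->.
have [Lb minL sLb] := minnormal_exists ntX (normG _).
have [_ ntL abL] := minnormal_solvable minL sLb (quotient_sol _ solX).
have nLb : Lb <| X / N by rewrite /normal sLb; case/mingroupP: minL => /andP[].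
have [L defLb sNL nLX] := inv_quotientN nNX nLb.
have sLX := normal_sub nLX.
have nNL := normalS sNL sLX nNX.
have ltNL : #|X : L| <= n.
  rewrite -ltnS (leq_trans _ leXN) // -(Lagrange_index sLX sNL) ltn_Pmulr //.
  by rewrite -card_quotient ?normal_norm // -defLb cardG_gt1.
have oLb : #|L : N| = #|Lb| by rewrite defLb card_quotient ?normal_norm.
have [r pr_r abelL] := is_abelemP abL.
have rLN : r.-nat #|L : N| by rewrite oLb; apply: abelem_pgroup abelL.
have [eq_rq | neq_rq] := eqVneq r q; last first.
  have q'LN : q^'.-nat #|L : N| by apply: sub_in_pnat rLN => s _ /eqnP->; rewrite inE.
  have coLN : coprime #|L : N| ('o(('chi_t)%R)%CF * irr_deg t).
    by rewrite coprime_sym (pnat_coprime _ q'LN) // pnatM qdet.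
  have [c [Rc oc uniqc]] := extend_solvable_coprime_irr nNL
    (quotient_sol N (solvableS sLX solX)) (subset_trans sLX ItX) coLN.
  have dc : irr_deg c = irr_deg t by rewrite /irr_deg -Rc cfRes1.
  have IcX : X \subset 'I['chi_c]%R.
    apply/subsetP=> x Xx; have nLx := subsetP (normal_norm nLX) x Xx.
    rewrite inE nLx -conjg_IirrE (uniqc (conjg_Iirr c x)) ?eqxx //.
      by rewrite conjg_IirrE -(cfConjgRes _ nLX nNX Xx) Rc (inertiaJ (subsetP ItX x Xx)).
    rewrite conjg_IirrE /cfDet_order cfDetConjg cforder_inj_rmorph; last exact: can_inj (cfConjgK x).
    by rewrite -/(cfDet_order _) oc; move: coLN; rewrite coprimeMr => /andP[].
  have [||d [Id qd le_d]] := IHn gT X L c ltNL solX nLX IcX; rewrite ?dc ?oc //.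
  exists d; split=> //.
    apply: constt_Ind_trans Id => //.
    by rewrite constt_Ind_Res Rc constt_irr inE.
  rewrite dc in le_d; rewrite -(Lagrange_index sLX sNL) partnM ?indexg_gt0 //.
  by rewrite (part_p'nat q'LN) muln1.
subst r; have [K hallK] := Hall_exists q^' solX.
have sKX := pHall_sub hallK.
have coK : coprime #|L : N| #|K| by apply: pnat_coprime rLN (pHall_pgroup hallK).
have abLN : abelian (L / N) by rewrite -defLb; apply: abelem_abelian abelL.
have [i Ii IiK] := coprime_invariant_constt nNX nLX sNL abLN ItX sKX coK.
have [e [Ri di count]] := twist_count nNL abLN (subset_trans sLX ItX) Ii.
have di' : irr_deg i = (irr_deg t * e)%N.
  by apply/eqP; rewrite -(eqr_nat algC) natrM -!irr_degE di mulr_natr.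
have qe : q.-nat e.
  by have:= rLN; rewrite count pnatM => /andP[+ _]; rewrite pnatX orbF.
set T := 'I_X['chi_i]%R%G.
have sTX : T \subset X by apply: subsetIl.
have sLT : L \subset T by rewrite subsetI sLX sub_inertia.
have nLT := normalS sLT sTX nLX.
have sKT : K \subset T by rewrite subsetI sKX IiK.
have qXT : q.-nat #|X : T|.
  case/and3P: hallK => _ _; rewrite pnatNK -(Lagrange_index sTX sKT) pnatM.
  by case/andP.
have leXT : #|X : T| <= #|irr_constt ('Ind[L, N] 'chi_t)%R|.
  rewrite -size_cfclass cardE -(size_map (@cfIirr _ L)).
  apply: uniq_leq_size => [|j /mapP[f /cfclassP[x Xx ->] ->]].
    rewrite map_inj_in_uniq ?cfclass_uniq // => f g /cfclassP[x _ ->] /cfclassP[y _ ->].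
    by rewrite -!conjg_IirrE !irrK => ->.
  rewrite mem_enum -conjg_IirrE irrK constt_Ind_Res irr_consttE conjg_IirrE.
  rewrite -(cfConjgRes _ nLX nNX Xx) -{1}(inertiaJ (subsetP ItX x Xx)) cfConjg_iso.
  by rewrite constt_Ind_Res irr_consttE in Ii.
have [||||||c [Ic qc le_c]] := IHn gT T L i.
- by rewrite (leq_trans _ ltNL) // -(Lagrange_index sTX sLT) leq_pmull ?indexg_gt0.
- exact: solvableS solX.
- by [].
- exact: subsetIr.
- by rewrite di' pnatM qt.
- have qo : q.-nat ('o(('chi_t)%R)%CF * #|L : N|)%N by rewrite pnatM qdet.
  apply: pnat_dvd qo; rewrite dvdn_cforder exprM.
  set d := (cfDet _ ^+ _)%R.
  have lin_d : d \is a linear_char by rewrite rpredX // cfDet_lin_char.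
  have Nd : N \subset cfker d.
    have Rd : ('Res[N] d = 1)%R.
      rewrite /d rmorphXn /= -cfDetRes ?irr_char // Ri cfDetMn ?irr_char //.
      have det1 : (cfDet 'chi_t ^+ 'o(('chi_t)%R)%CF = 1)%R.
        by apply/eqP; rewrite -dvdn_cforder.
      by rewrite -exprM mulnC exprM det1 expr1n.
    apply/subsetP=> x Nx; rewrite cfkerEchar ?lin_charW // inE (subsetP sNL) //=.
    by rewrite -(cfResE d sNL Nx) -(cfResE d sNL (group1 N)) Rd !cfun1E Nx group1.
  rewrite -(cfQuoK nNL Nd) -rmorphXn /= -card_quotient ?normal_norm //.
  have lin_q : (d / N)%CF \is a linear_char by rewrite cfQuo_lin_char.
  by have := cforder_lin_char_dvdG lin_q; rewrite dvdn_cforder => /eqP->; rewrite rmorph1.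
have [irrI _ _ _ _] := constt_Inertia_bijection i nLX.
have {irrI} irrI := irrI c Ic.
have dInd : ('Ind[X] 'chi_c 1%g = (#|X : T| * irr_deg c)%:R)%R.
  by rewrite cfInd1 // irr_degE natrM.
exists (cfIirr ('Ind[X] 'chi_c)%R); rewrite /irr_deg cfIirrE // dInd natrK.
split.
- apply: (constt_Ind_trans sNL sLX Ii).
  apply: (constt_Ind_trans sLT sTX Ic).
  by rewrite irr_consttE cfIirrE // irrWnorm ?oner_eq0. 
- by rewrite pnatM qXT.
rewrite -(Lagrange_index sLX sNL) -(Lagrange_index sTX sLT) !partnM ?muln_gt0 ?indexg_gt0 //.
rewrite (part_pnat_id qXT) (part_pnat_id rLN) count.
rewrite di' in le_c; rewrite expnMn.
apply: leq_trans (leq_mul (leqnn _) le_c) _.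
set A := #|X : T|; set B := partn _ _; set C := #|_|; set dt := irr_deg t.
have -> : (A ^ 2 * ((dt * e) ^ 2 * B) = dt ^ 2 * (A * B * e ^ 2) * A)%N by ring.
have -> : (dt ^ 2 * (A * B * (e ^ 2 * C)) = dt ^ 2 * (A * B * e ^ 2) * C)%N by ring.
by rewrite leq_mul.
Qed.

(** * Sylow 2-subgroups acting on weights *)

Lemma fact_part2_le n : n`!`_2 <= 2 ^ n.
Proof.
rewrite p_part leq_exp2l // logn_fact //.
suffices le_m m : (\sum_(1 <= k < m.+1) n %/ 2 ^ k) + n %/ 2 ^ m <= n.
  exact: leq_trans (leq_addr _ _) (le_m n).
elim: m => [|m IHm]; first by rewrite big_nil divn1.
apply: leq_trans IHm; rewrite big_nat_recr //= -addnA leq_add2l.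
rewrite expnS mulnC divnMA; lia.
Qed.

(** The matrices commute and are killed by the separable polynomial [X^m - 1],
    so they are diagonal in a common basis, the rows of [P]. *)
Lemma weight_basis (K : closedFieldType) (gT : finGroupType) (G A : {group gT}) n m
    (rG : mx_representation K G n.+1) :
    A \subset G -> {in A &, forall a b, rG a *m rG b = rG b *m rG a}%R ->
    {in A, forall a, rG a ^+ m = 1}%R -> (m%:R != 0 :> K)%R ->
  exists2 P : 'M[K]_n.+1, P \in unitmx &
    forall a, a \in A -> exists w : 'rV_n.+1, (P *m rG a = diag_mx w *m P)%R.
Proof.
move=> sAG commA expA nz_m.
have diag a : a \in A -> diagonalizable (rG a).
  move=> Aa; apply/diagonalizableP.
  have [s defs] := closed_field_poly_normal ('X^m - 1 : {poly K})%R.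
  have m_gt0 : 0 < m by rewrite lt0n; apply: contraNneq nz_m => ->.
  rewrite (monicP (monicXnsubC 1%R m_gt0)) scale1r in defs.
  exists s; first by rewrite -separable_prod_XsubC -defs separable_Xn_sub_1.
  rewrite -defs mxminpoly_min // rmorphB rmorphXn /= horner_mx_X expA // horner_mx_C.
  by rewrite subrr.
pose fs := [seq rG a | a in A].
have [|P Pu /allP simP] := (codiagonalizableP fs).1.
  split=> [_ _ /imageP[a Aa ->] /imageP[b Ab ->] | f /imageP[a Aa ->]].
    exact: commA.
  exact: diag.
exists P => // a Aa; have /simP := image_f (fun a => rG a) Aa.
by case/diag_mxP=> w defw; exists w; exact/(simmxP Pu)/eqP.
Qed.

Section Weights.

Variables (K : closedFieldType) (gT : finGroupType) (G A V : {group gT}) (n : nat).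
Variable rG : mx_representation K G n.+1.
Hypotheses (nAG : A <| G) (nVG : V <| G) (sVA : V \subset A).
Hypothesis kerV : rker rG = V.
Hypotheses (abAV : abelian (A / V)) (nz_A : (#|(A / V)%g|%:R != 0 :> K)%R).
Hypothesis V2 : 2.-group V.
Hypotheses (oddAV : odd #|A / V|) (cAV : 'C_(G / V)(A / V) \subset A / V).

Lemma repr_coset_eq x y : x \in G -> y \in G -> coset V x = coset V y -> rG x = rG y.
Proof.
move=> Gx Gy eqV; have nV := subsetP (normal_norm nVG).
have [z Vz ->] := kercoset_rcoset (nV x Gx) (nV y Gy) eqV.

have: z \in rker rG by rewrite kerV.
case/rkerP=> Gz rz; rewrite repr_mxM // rz.
by rewrite mul1mx.
Qed.

(** The action of [A] in the basis of [weight_basis] is given by at most [n.+1]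
    different functions on [A], the weights, and [G] permutes them.  An
    element of [G] that fixes all weights centralizes [A / V], so it lies in
    [A].  Hence a Sylow 2-subgroup of [G / V] acts faithfully on the weights,
    and its order divides [n.+1`!]. *)
Lemma weight_count : #|G : V|`_2 <= 2 ^ n.+1.
Proof.
have sAG := normal_sub nAG; have nVA := normalS sVA sAG nVG.
have nV := subsetP (normal_norm nVG); have sG := subsetP sAG.
have commA : {in A &, forall a b, rG a *m rG b = rG b *m rG a}%R.
  move=> a b Aa Ab; rewrite -!repr_mxM ?sG //; apply: repr_coset_eq; rewrite ?groupM ?sG //.
  rewrite !morphM ?nV ?sG //; apply: (centsP abAV); exact: mem_quotient.
have expA : {in A, forall a, rG a ^+ #|(A / V)%g| = 1}%R.
  move=> a Aa; rewrite -repr_mxX ?sG // -[RHS](repr_mx1 rG); apply: repr_coset_eq; rewrite ?groupX ?sG //.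
  rewrite morphX ?nV ?sG // morph1.
  by apply/eqP; rewrite -order_dvdn order_dvdG ?mem_quotient.
have [P Pu diagP] := weight_basis sAG commA expA nz_A.
pose w i a : K := (P *m rG a *m invmx P)%R i i.
have eW i a : a \in A -> (row i P *m rG a = w i a *: row i P)%R.
  move=> Aa; have [d def_d] := diagP a Aa.
  rewrite -row_mul /w def_d mulmxK // mxE eqxx mulr1n.
  by apply/rowP=> j; rewrite mul_diag_mx !mxE.
have wP i p : p \in G -> exists j, forall a, a \in A -> w j a = w i (a ^ p^-1).
  move=> Gp; pose u := (row i P *m rG p)%R; pose c := (u *m invmx P)%R.
  have def_u : (u = c *m P)%R by rewrite mulmxKV.
  have nz_c : (c != 0)%R.
    apply/eqP=> c0; have r0 : (row i P = 0)%R.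
      by rewrite -[row i P](repr_mxK rG Gp) -/u def_u c0 !mul0mx.
    have := row_mul i P (invmx P); rewrite r0 mul0mx mulmxV // row1.
    by move/rowP/(_ i)/eqP; rewrite !mxE !eqxx oner_eq0.
  have [j nz_j] : exists j, (c 0 j != 0)%R.
    apply/existsP; apply: contraNT nz_c => /existsPn c0.
    by apply/eqP/rowP=> j; rewrite [RHS]mxE; apply/eqP; have := c0 j; rewrite negbK.
  exists j => a Aa; have Aap : a ^ p^-1 \in A by rewrite memJ_norm // groupV (subsetP (normal_norm nAG)).
  have: (u *m rG a = w i (a ^ p^-1)%g *: u)%R.
    rewrite /u -mulmxA -repr_mxM ?(sG _ Aa) // (conjgCV p) repr_mxM ?(sG _ Aap) //.
    by rewrite mulmxA eW // scalemxAl.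
  have [d def_d] := diagP a Aa.
  rewrite def_u -mulmxA def_d mulmxA scalemxAl => /(can_inj (mulmxK Pu)) eqc.
  move/rowP/(_ j): eqc; rewrite mul_mx_diag mxE [RHS]mxE mulrC => /(mulIf nz_j) <-.
  by rewrite /w def_d mulmxK // mxE eqxx mulr1n.
(* Weights are extended by 0 outside [A] to make equality of weights on [A] an
   equality of finite functions. *)
pose f i : {ffun gT -> K} := [ffun a => if a \in A then w i a else 0%R].
pose S := undup (codom f); pose T : finType := seq_sub S.
have fS i : f i \in S by rewrite mem_undup codom_f.
pose actW (x : {ffun gT -> K}) p : {ffun gT -> K} := [ffun a => x (a ^ p^-1)].
have actS x p : p \in G -> x \in S -> actW x p \in S.
  rewrite mem_undup => Gp /codomP[i ->]; have [j ij] := wP i p Gp.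
  suffices ->: actW (f i) p = f j by [].
  apply/ffunP=> a; rewrite !ffunE memJ_norm ?groupV ?(subsetP (normal_norm nAG)) //.
  by case: ifP => // /ij->.
pose to (x : T) p : T := if p \in G then insubd x (actW (val x) p) else x.
have toE (x : T) p : p \in G -> val (to x p) = actW (val x) p.
  by move=> Gp; rewrite /to Gp val_insubd actS // (valP x).
have to_act : is_action G to.
  split=> [p x y | x p q Gp Gq].
    case Gp: (p \in G); last by rewrite /to Gp.
    move/(congr1 val); rewrite !toE // => eqxy; apply/val_inj/ffunP=> a.
    by move/ffunP/(_ (a ^ p)): eqxy; rewrite !ffunE conjgK.
  apply: val_inj; rewrite !toE ?groupM //; apply/ffunP=> a.
  by rewrite !ffunE invMg conjgM.
pose h := actperm_morphism (Action to_act).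
have ker_h : 'ker h \subset A.
  apply/subsetP=> p Kp; have Gp := dom_ker Kp; have hp1 := mker Kp.
  have wfix i a : a \in A -> w i (a ^ p^-1) = w i a.
    move=> Aa; have Aap : a ^ p^-1 \in A by rewrite memJ_norm ?groupV ?(subsetP (normal_norm nAG)).
    have := congr1 (fun s : {perm T} => val (s (SeqSub (fS i)))) hp1.
    rewrite /= perm1 actpermE toE //= => /ffunP/(_ a).
    by rewrite !ffunE Aa Aap.
  have cAp : coset V p \in 'C(A / V).
    apply/centP=> _ /morphimP[a na Aa ->].
    have Aap : a ^ p^-1 \in A by rewrite memJ_norm ?groupV ?(subsetP (normal_norm nAG)).
    have eq_r : rG (a ^ p^-1) = rG a.
      apply: (can_inj (mulKmx Pu)); apply/row_matrixP=> i.
      by rewrite !row_mul !eW // wfix.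
    have : a ^ p^-1 * a^-1 \in V.
      rewrite -kerV; apply/rkerP; split; first by rewrite groupM ?groupV ?sG.
      by rewrite repr_mxM ?groupV ?sG // eq_r repr_mxV ?sG // mulmxV // repr_mx_unit ?sG.
    move/coset_id=> c1; have [Ga Gap] := (sG a Aa, sG _ Aap).
    have eqc : coset V (a ^ p^-1) = coset V a.
      move: (a ^ p^-1) c1 Gap => b c1 Gb; rewrite -[b in LHS](mulgKV a).
      by rewrite morphM ?nV //= ?c1 ?mul1g // groupM ?groupV.
    rewrite /commute -!morphM ?nV //= (conjgCV p a).
    by rewrite [LHS]morphM ?[RHS]morphM ?nV //= eqc.
  have : coset V p \in A / V by rewrite (subsetP cAV) // inE mem_quotient.
  by move=> Ap; rewrite -(quotientGK nVA) mem_morphpre ?nV.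
have [Q sylQ] := Sylow_exists 2 G.
have sQG := pHall_sub sylQ.
have sVQ : V \subset Q := normal_sub_max_pgroup (Hall_max sylQ) V2 nVG.
have QA : Q :&: A \subset V.
  rewrite -quotient_sub1; last by rewrite subIset // (subset_trans sQG) ?normal_norm.
  have coQA : coprime #|Q / V| #|A / V|.
    by rewrite (pnat_coprime (quotient_pgroup V (pHall_pgroup sylQ))) -?odd_2'nat.
  by rewrite -(coprime_TIg coQA) quotientI.
have oT : #|T| <= n.+1.
  rewrite card_seq_sub ?undup_uniq // (leq_trans (size_undup _)) //.
  by rewrite size_map -cardE card_ord.
have -> : (#|G : V|`_2 = #|Q : V|)%N.
  apply/eqP; rewrite -(eqn_pmul2l (cardG_gt0 V)) Lagrange // (card_Hall sylQ).
  by rewrite -(Lagrange (normal_sub nVG)) partnM // (part_pnat_id V2).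
have im_dvd : #|h @* Q| %| #|T|`!.
  rewrite -cardsT -(card_perm [set: T]) (_ : #|perm_on _| = #|[set: {perm T}]|).
    exact: cardSg (subsetT _).
  by apply: eq_card => s; rewrite inE; apply/subsetP=> x; rewrite inE.
have le1 : #|Q : V| <= #|h @* Q|.
  rewrite card_morphim /= (setIidPr sQG) -[X in _ <= X]indexgI.
  have sDV : Q :&: 'ker h \subset V := subset_trans (setIS _ ker_h) QA.
  by rewrite -(Lagrange_index sVQ sDV) leq_pmulr ?indexg_gt0.
have le2 : #|h @* Q| <= #|T|`!`_2.
  have im2 : 2.-group (h @* Q) := morphim_pgroup _ (pHall_pgroup sylQ).
  by rewrite dvdn_leq ?part_gt0 // -(part_pnat_id im2) partn_dvd ?fact_gt0.
apply: leq_trans le1 (leq_trans le2 (leq_trans (fact_part2_le _) _)).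
by rewrite leq_exp2l.
Qed.
End Weights.

(** The case of [weight_count] where [V] is viewed as a space over the algebraic
    closure of ['F_2] on which [G] acts by conjugation. *)
Lemma index_part2_le (gT : finGroupType) (G A V : {group gT}) :
    A <| G -> V <| G -> V \subset A -> 2.-abelem V -> V :!=: 1 ->
    'C_G(V) \subset V -> abelian (A / V) -> odd #|A / V| ->
    'C_(G / V)(A / V) \subset A / V ->
  #|G : V|`_2 <= #|V|.
Proof.
move=> nAG nVG sVA abV ntV cVV abA oddA cA.
have [K [f _]] := countable_algebraic_closure 'F_2.
have nVG' := normal_norm nVG.
pose rG := map_repr f (abelem_repr abV ntV nVG').
have kerG : rker rG = V.
  rewrite rker_map rker_abelem; apply/eqP; rewrite eqEsubset cVV subsetI normal_sub //.
  exact: abelem_abelian abV.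
have char2 : (2%:R = 0 :> K)%R.
  by rewrite -(rmorph_nat f) (_ : 2%:R = 0 :> 'F_2)%R ?rmorph0 //; apply/eqP.
have nzA : (#|(A / V)%g|%:R != 0 :> K)%R.
  by rewrite -[#|_|]odd_double_half oddA natrD -mul2n natrM char2 mul0r addr0 oner_eq0.

apply: leq_trans (weight_count nAG nVG sVA kerG abA nzA (abelem_pgroup abV) oddA cA) _.
rewrite (dim_abelemE abV ntV).
by rewrite -p_part (part_pnat_id (abelem_pgroup abV)).
Qed.

(** * Groups whose proper quotients have smaller Fitting height *)

Section Primitive.
Variable gT : finGroupType.
Implicit Types G H K L N R : {group gT}.

(** The centre of [R] meets [N] nontrivially, so it contains [N]. *)
Lemma minnormal_nil_cent N G R :
  minnormal N G -> R <| G -> nilpotent R -> N \subset R -> R \subset 'C(N).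
Proof.
case/mingroupP=> /andP[ntN nNG] minN nRG nilR sNR; have sRG := normal_sub nRG.
have nNR : N <| R by rewrite /normal sNR (subset_trans sRG).
have ntNZ : N :&: 'Z(R) != 1 by apply: meet_center_nil.
have /minN defN : (N :&: 'Z(R) != 1) && (G \subset 'N(N :&: 'Z(R))).
  by rewrite ntNZ normsI // gFnorm_trans ?normal_norm.
rewrite centsC -[gval N](defN (subsetIl _ _)).
exact: subset_trans (subsetIr _ _) (subsetIr _ _).
Qed.

Definition primitive_pair G N := 
  [/\ minnormal N G, N <| G, 'C_G(N) = N & forall K, K <| G -> K :!=: 1 -> N \subset K].

(** The height of [G] is the larger one of the heights of [G / K] and [G / L] if
    [K :&: L = 1], so the minimal normal subgroup [N] is unique.  Let [K / N]
    be the Fitting subgroup of [G / N].  If [K] were nilpotent, the height of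
    [G] would not exceed that of [G / N].  So [K] has a nontrivial Hall
    [p']-subgroup [Q], where [p] is the prime dividing [#|N|].  As [K / N] is
    nilpotent, [N * Q] is normal in [G], so [H = 'N_G(Q)] supplements [N] by
    the Frattini argument.  If [H] met [N], it would contain [N], [Q] would be
    normal in [G] and would contain [N]. *)
Lemma primitive_structure G : solvable G -> 1 < fitting_height G ->
    (forall K, K <| G -> K :!=: 1 -> fitting_height (G / K) < fitting_height G) ->
  exists N H, [/\ primitive_pair G N, N ><| H = G & fitting_height G = (fitting_height H).+1].
Proof.
move=> solG gt1 minG.
have ntG : G :!=: 1 by rewrite -(fitting_height_eq0 solG) -lt0n ltnW.
have [N minN sNG] := minnormal_exists ntG (normG G).
have [nNG' ntN abN] := minnormal_solvable minN sNG solG.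
have nNG : N <| G by apply/andP.
have [p pr_p abelN] := is_abelemP abN; have pN := abelem_pgroup abelN.
have uniqN K : K <| G -> K :!=: 1 -> N \subset K.
  move=> nKG ntK; apply: contraLR (minG K nKG ntK) => not_sNK; rewrite -leqNgt.
  have tiNK : N :&: K = 1.
    apply/eqP; apply: contraNT not_sNK => ntNK; case/mingroupP: minN => _ /(_ (N :&: K)%G).
    rewrite ntNK normsI ?normal_norm //= => /(_ isT (subsetIl _ _)) <-.
    exact: subsetIr.
  rewrite leqNgt; apply/negP=> ltK; case defn: (fitting_height G) => [|n].
    by rewrite defn in gt1.
  have := fitting_height_capI solG nNG nKG tiNK _ _ (n := n).
  rewrite -!(ltnS _ n) -defn ltnn => /(_ (minG N nNG ntN) ltK).
  by [].
have ltN := minG N nNG ntN.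
have defF : fitting_height G = (fitting_height (G / N)).+1.
  apply/eqP; rewrite eqn_leq ltN andbT.
  exact: fitting_height_quo_nil (abelian_nil (abelem_abelian abelN)) (leqnn _).
have [K defK sNK nKG] := inv_quotientN nNG (Fitting_normal (G / N)).
have sKG := normal_sub nKG.
have nilKN : nilpotent (K / N) by rewrite -defK Fitting_nil.
have solK := solvableS sKG solG.
have nilK : ~~ nilpotent K.
  apply/negP=> nilK.
  have : fitting_height (G / N / 'F(G / N)) <= (fitting_height G).-2.
    apply: fitting_height_quo_Fitting; first exact: quotient_sol.
    by move: gt1; rewrite defF; case: (fitting_height _).
  rewrite defK.
  have /isog_symr iso := third_isog sNK nNG nKG.
  rewrite -(fitting_height_isog _ iso) ?quotient_sol // => leK.
  have := fitting_height_quo_nil solG nKG nilK leK.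
  by case: (fitting_height G) gt1 => [|[|n]] //= _; rewrite ltnn.
have [Q hallQ] := Hall_exists p^' solK.
have sQK := pHall_sub hallQ.
have nNQ : Q \subset 'N(N) := subset_trans sQK (subset_trans sKG nNG').
have tiNQ : N :&: Q = 1 by apply: coprime_TIg (pnat_coprime pN (pHall_pgroup hallQ)).
have ntQ : Q :!=: 1.
  apply: contra nilK => /eqP Q1; apply: (@pgroup_nil _ p).
  by have /and3P[_ _] := hallQ; rewrite Q1 indexg1 pnatNK.
have nQNG : N <*> Q <| G.
  have nQ : Q / N <| G / N.
    have /nilpotent_Hall_pcore defQ : p^'.-Hall(K / N) (Q / N) by apply: quotient_pHall.
    by rewrite (defQ nilKN) gFnormal_trans // quotient_normal.
  rewrite norm_joinEr // -(quotientK nNQ) -(quotientGK nNG).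
  by rewrite cosetpre_normal.
have sQNQ : Q \subset N <*> Q := joing_subr _ _.
have sNNQ : N \subset N <*> Q := joing_subl _ _.
have sNQK : N <*> Q \subset K by rewrite join_subG sNK.
have hallQ' := pHall_subl sQNQ sNQK hallQ.
pose H := 'N_G(Q)%G.
have sHG : H \subset G := subsetIl _ _.
have sQH : Q \subset H by rewrite subsetI normG (subset_trans sQK).
have defG : N * H = G.
  have := Hall_Frattini_arg (solvableS sNQK solK) nQNG hallQ'.
  by rewrite /= norm_joinEr // -mulgA (mulSGid sQH).
have nNH := subset_trans sHG nNG'.
have minNI (D : {group gT}) : D \subset N -> D :!=: 1 -> H \subset 'N(D) -> D :=: N.
  move=> sDN ntD nDH; case/mingroupP: minN => _; apply=> //; rewrite ntD -defG mul_subG //.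
  by apply: cents_norm; rewrite (sub_abelian_cent2 (abelem_abelian abelN)).
have tiNH : N :&: H = 1.
  apply/eqP; apply: contraT => ntNH.
  have := minNI (N :&: H)%G (subsetIl _ _) ntNH (normsI nNH (normG H)).
  move/setIidPl=> sNH; have nQN : N \subset 'N(Q) := subset_trans sNH (subsetIr _ _).
  have nQNQ : Q <| N <*> Q by rewrite /normal sQNQ join_subG nQN normG.
  have nQG : Q <| G by rewrite -(normal_Hall_pcore hallQ' nQNQ) gFnormal_trans.
  by have /setIidPl := uniqN Q nQG ntQ; rewrite tiNQ => N1; rewrite -N1 eqxx in ntN.
exists N, H; split.
- split=> //; have cNN : N \subset 'C_G(N) by rewrite subsetI sNG; apply: abelem_abelian abelN.
  have nCG : 'C_G(N) <| G by rewrite /normal subsetIl normsI ?normG ?norms_cent.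
  have : N * (H :&: 'C_G(N)) = 'C_G(N) by rewrite group_modl // defG (setIidPr (subsetIl _ _)).
  have [-> | ntHC <-] := eqVneq (H :&: 'C_G(N)) 1; first by rewrite mulg1.
  have nHC : H :&: 'C_G(N) <| G.
    rewrite /normal subIset ?sHG //= -{1}defG mul_subG //.
      by apply: cents_norm; rewrite centsC (subset_trans (subsetIr _ _)) // subsetIr.
    by rewrite normsI ?normG // (subset_trans sHG) ?normal_norm.
  have := uniqN _ nHC ntHC; rewrite subsetI => /andP[/setIidPl sNH _].
  by rewrite -sNH tiNH eqxx in ntN.
- by rewrite sdprodE.
rewrite defF; congr _.+1; apply/esym/fitting_height_isog; first exact: solvableS sHG solG.
by apply: sdprod_isog; rewrite sdprodE.
Qed.

End Primitive.

(** * New codegrees *)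

Section Codegrees.

Variable gT : finGroupType.
Implicit Types G H K L N : {group gT}.

Lemma codegree_in G (i : Iirr G) : codegree ('chi_i)%R \in codegrees G.
Proof. by apply/codegreesP; exists i. Qed.

Lemma codegree_le G (i : Iirr G) : (codegree 'chi_i <= #|G|%:R)%R.
Proof.
rewrite /codegree ler_pdivrMr ?irr1_gt0 // irr_degE -natrM ler_nat.
rewrite (leq_trans _ (leq_pmulr _ (irr_deg_gt0 i))) //.
by rewrite dvdn_leq ?dvdn_indexg.
Qed.

Lemma codegrees_quo G K : K <| G -> {subset codegrees (G / K) <= codegrees G}.
Proof.
move=> nKG x /codegreesP[i ->]; apply/codegreesP; exists (mod_Iirr i).
rewrite mod_IirrE // /codegree cfMod1; congr (_%:R / _)%R.
rewrite -[cfker ('chi_i)%R](cfker_morph_im (normal_norm nKG)).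
rewrite index_quotient_eq ?cfker_sub ?normal_norm //.
exact: subset_trans (subsetIr _ _) (cfker_mod _ nKG).
Qed.

Lemma size_codegrees_gt0 G : 0 < size (codegrees G).
Proof. by have := codegree_in (0 : Iirr G)%R; case: (codegrees G). Qed.

End Codegrees.

Lemma codegrees_isog (gT rT : finGroupType) (G : {group gT}) (R : {group rT}) :
  G \isog R -> {subset codegrees G <= codegrees R}.
Proof.
case/isogP=> f injf defR; have isoGR : isom G R f by apply/isomP.
move=> x /codegreesP[i ->]; apply/codegreesP; exists (isom_Iirr isoGR i).
rewrite isom_IirrE /codegree cfIsom1 cfker_isom; congr (_%:R / _)%R.
by rewrite -defR index_injm ?cfker_sub.
Qed.

(** The permutation character of [T] on the cosets of [S] restricts to the
    regular character of [N].  So exactly one of its constituents lies over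
    ['chi_t], with multiplicity one, and by Clifford's theorem its restriction
    to [N] is ['chi_t]. *)
Lemma sdprod_lin_extend (gT : finGroupType) (T N S : {group gT}) (t : Iirr N) :
    N ><| S = T -> ('chi_t)%R \is a linear_char -> T \subset 'I['chi_t]%R ->
  exists c : Iirr T, ('Res[N] 'chi_c = 'chi_t)%R.
Proof.
move=> defT lin_t ItT; have [nNT sST mulNS nNS tiNS] := sdprod_context defT.
have sNT := normal_sub nNT.
have RegN : ('Res[N] ('Ind[T] (1 : 'CF(S))) = cfReg N)%R.
  apply/cfun_inP=> x Nx; rewrite cfResE // cfRegE cfIndE //.
  case: (eqVneq x 1) => [-> | ntx].
    rewrite (eq_bigr (fun=> 1%R)) => [|y _]; last by rewrite conj1g cfun11.
    rewrite sumr_const -(sdprod_card defT) mulrC natrM mulfK ?neq0CG //.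
  rewrite mulr0n big1 ?mulr0 // => y Ty; rewrite cfun1E.
  case Sxy: (x ^ y \in S) => //; case/eqP: ntx; apply: (conjg_inj y); rewrite conj1g.
  apply/set1P; rewrite -[[set 1]]/(1 : {set gT}) -tiNS inE Sxy andbT.
  by rewrite memJ_norm // (subsetP (normal_norm nNT)).
have mult1 : ('['Res[N] ('Ind[T] (1 : 'CF(S))), 'chi_t] = 1)%R.
  rewrite RegN cfReg_sum cfdot_suml (bigD1 t) //= big1 => [|i neq_it].
    by rewrite cfdotZl cfnorm_irr lin_char1 // mulr1 addr0.
  by rewrite cfdotZl cfdot_irr (negPf neq_it) mulr0.
set pi := ('Ind[T] (1 : 'CF(S)))%R in mult1.
have char_pi : pi \is a character by rewrite cfInd_char ?rpred1.
have nat_pi c : ('['Res[N] 'chi[T]_c, 'chi_t] \is a Num.nat)%R.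
  by rewrite Cnat_cfdot_char ?irr_char ?cfRes_char ?irr_char.
have nat_c c : ('[pi, 'chi[T]_c] \is a Num.nat)%R by rewrite Cnat_cfdot_char_irr.
have sum1 : (\sum_(c : Iirr T) '[pi, 'chi_c] * '['Res[N] 'chi_c, 'chi_t] = 1)%R.
  rewrite -mult1 {2}(cfun_sum_cfdot pi) linear_sum cfdot_suml.
  by apply: eq_bigr => c _; rewrite linearZ cfdotZl.
have [c nz_c] : exists c : Iirr T, ('[pi, 'chi_c] * '['Res[N] 'chi_c, 'chi_t] != 0)%R.
  apply/existsP; apply: contraT; rewrite negb_exists => /forallP z.
  move: sum1; rewrite big1 => [/eqP|c _]; first by rewrite eq_sym oner_eq0.
  by apply/eqP; have := z c; rewrite negbK.
have le1 : ('[pi, 'chi_c] * '['Res[N] 'chi_c, 'chi_t] <= 1)%R.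
  rewrite -sum1 (bigD1 c) //= lerDl sumr_ge0 // => d _.
  by rewrite mulr_ge0 ?natr_ge0.
have one : ('['Res[N] 'chi_c, 'chi_t] = 1)%R.
  have [a Da] := natrP (nat_c c); have [b Db] := natrP (nat_pi c).
  move: nz_c le1; rewrite Da Db -natrM pnatr_eq0 (ler_nat algC _ 1).
  by case: a b {Da Db} => [|a] [|[|b]] //; rewrite ?muln0.
exists c; have Rc : t \in irr_constt ('Res[N] 'chi_c)%R by rewrite irr_consttE one oner_eq0.
have := Clifford_Res_sum_cfclass nNT Rc; rewrite cfclass_invariant // big_seq1 one.
by rewrite scale1r.
Qed.

Section NewCodegree.

Variables (gT : finGroupType) (G N H : {group gT}).
Hypotheses (primN : primitive_pair G N) (defG : N ><| H = G) (abN : abelian N).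

(** The principal character is not conjugate to ['chi_t]. *)
Lemma index_inertia_lt (t : Iirr N) : t != 0%R -> #|G : 'I_G['chi_t]%R| < #|N|.
Proof.
move=> nz_t; have [_ nNG _ _] := primN.
rewrite -size_cfclass -(card_Iirr_abelian abN) -(size_map (@cfIirr _ N)).
have ltI : #|[set~ (0%R : Iirr N)]| < #|Iirr N|.
  by rewrite cardsC1 ltn_predL; apply/card_gt0P; exists t.
apply: leq_ltn_trans ltI; rewrite cardE; apply: uniq_leq_size.
  rewrite map_inj_in_uniq ?cfclass_uniq // => f g /cfclassP[x _ ->] /cfclassP[y _ ->].
  by rewrite -!conjg_IirrE !irrK => ->.
move=> i /mapP[f /cfclassP[x Gx ->] ->]; rewrite mem_enum !inE -conjg_IirrE irrK.
by rewrite -irr_eq1 conjg_IirrE cfConjg_eq1 irr_eq1.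
Qed.

Lemma inertia_card_gt (t : Iirr N) : t != 0%R -> #|H| < #|'I_G['chi_t]%R|.
Proof.
move=> nz_t; rewrite -(ltn_pmul2l (cardG_gt0 N)) (sdprod_card defG).
rewrite -(Lagrange (subsetIl G 'I['chi_t]%R)) mulnC ltn_pmul2r ?index_inertia_lt //.
Qed.

(** Extend ['chi_t] to its inertia group [T] and induce to [G].  The result is
    irreducible of degree [#|G : T|], and it is faithful because its kernel
    does not contain the unique minimal normal subgroup [N]. *)
Lemma inertia_codegree (t : Iirr N) : t != 0%R ->
  (#|'I_G['chi_t]|%:R)%R \in codegrees G.
Proof.
move=> nz_t; have [minN nNG _ uniqN] := primN.
set T := 'I_G['chi_t]%R%G.
have [_ sHG _ nNH tiNH] := sdprod_context defG.
have sTG : T \subset G by apply: subsetIl.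
have sNT : N \subset T by rewrite subsetI normal_sub // sub_inertia.
have defT : N ><| (H :&: T) = T.
  rewrite sdprodE; first by rewrite group_modl // (sdprodW defG) (setIidPr sTG).
    by rewrite subIset ?nNH.
  by apply/trivgP; rewrite -tiNH setIS ?subsetIl.
have lin_t : ('chi_t)%R \is a linear_char by apply/char_abelianP.
have [c Rc] := sdprod_lin_extend defT lin_t (subsetIr _ _).
have Ic : c \in irr_constt ('Ind[T] 'chi_t)%R.
  by rewrite constt_Ind_Res Rc constt_irr inE.
have [irrI _ _ _ _] := constt_Inertia_bijection t nNG.
have {irrI} irrI : ('Ind[G] 'chi_c)%R \in irr G := irrI c Ic.
have [d def_d] := irrP irrI.
have Id : d \in irr_constt ('Ind[G] 'chi_t)%R.
  apply: (constt_Ind_trans sNT sTG Ic).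
  by rewrite irr_consttE def_d cfnorm_irr oner_eq0.
have ker1 : cfker ('chi_d)%R = 1.
  apply/eqP; apply: contraNT nz_t => nt_ker.
  have sNker := uniqN _ (cfker_normal _) nt_ker.
  rewrite constt_Ind_Res in Id; rewrite -subGcfker.
  apply: subset_trans (cfker_constt (cfRes_char _ (irr_char d)) Id).
  by rewrite cfker_Res ?irr_char ?(normal_sub nNG) // subsetI subxx.
apply/codegreesP; exists d; rewrite /codegree ker1 indexg1 -def_d cfInd1 //.
rewrite -(cfRes1 N) Rc lin_char1 // mulr1 -(Lagrange sTG) natrM mulfK //.
by rewrite pnatr_eq0 -lt0n.
Qed.

Lemma codegrees_compl : {subset codegrees H <= codegrees G}.
Proof.
have [nNG _ _ _ _] := sdprod_context defG.
move=> x /(codegrees_isog (sdprod_isog defG)); exact: codegrees_quo.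
Qed.

Lemma inertia_notin_codegrees (t : Iirr N) : t != 0%R ->
  (#|'I_G['chi_t]|%:R)%R \notin codegrees H.
Proof.
move=> nz_t; apply/codegreesP=> -[i def_i].
have := codegree_le i; rewrite -def_i ler_nat leqNgt.
by rewrite inertia_card_gt.
Qed.

Lemma exists_nonprincipal : N :!=: 1 -> exists t : Iirr N, t != 0%R.
Proof. by move=> ntN; exists (inord 1); apply: Iirr1_neq0. Qed.

Lemma size_codegrees_compl : size (codegrees H) < size (codegrees G).
Proof.
have [/mingroupP[/andP[ntN _] _] _ _ _] := primN.
have [t nz_t] := exists_nonprincipal ntN.
apply: (@uniq_leq_size _ ((#|'I_G['chi_t]|%:R)%R :: codegrees H)).
  by rewrite /= inertia_notin_codegrees // codegrees_uniq.
move=> x; rewrite inE => /predU1P[-> | /codegrees_compl //].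
exact: inertia_codegree.
Qed.

Lemma size_codegrees_compl2 (t u : Iirr N) : t != 0%R -> u != 0%R ->
    #|'I_G['chi_t]%R| != #|'I_G['chi_u]%R| ->
  (size (codegrees H)).+1 < size (codegrees G).
Proof.
move=> nz_t nz_u neq_tu.
apply: (@uniq_leq_size _ [:: (#|'I_G['chi_t]|%:R)%R, (#|'I_G['chi_u]|%:R)%R & codegrees H]).
  by rewrite /= inE negb_or !inertia_notin_codegrees // codegrees_uniq eqr_nat neq_tu.
move=> x; rewrite !inE => /or3P[/eqP-> | /eqP-> | /codegrees_compl //];
exact: inertia_codegree.
Qed.

End NewCodegree.

(** * The dual of the socle as a half-transitive module *)

(** The group of linear characters of [N] in additive notation. *)
Lemma dual_zmodule (gT : finGroupType) (N : {group gT}) : abelian N ->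
  exists (V : finZmodType) (chr : V -> Iirr N) (idx : Iirr N -> V),
  [/\ cancel chr idx, cancel idx chr
    & forall u v, 'chi_(chr (u + v)) = 'chi_(chr u) * 'chi_(chr v)]%R.
Proof.
move=> /char_abelianP linN.
have [linG [cF [injF _ linF onF] [F1 FM _ _ _]]] := lin_char_group N.
have abG : abelian [set: linG].
  by apply/centsP=> u _ v _; apply: injF; rewrite !FM mulrC.
have irrF u : cF u \in irr N by rewrite lin_char_irr.
pose V := FiniteModule.fmod_of abG.
pose chr (v : V) := cfIirr (cF (FiniteModule.fmval v)).
pose idx i : V := odflt 0%R [pick v | chr v == i].
have inj_chr : injective chr.
  move=> u v; rewrite /chr => /(congr1 (fun i => 'chi_i)%R).
  by rewrite !cfIirrE // => /injF /FiniteModule.fmod_inj.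
have idxK : cancel idx chr.
  move=> i; rewrite /idx; case: pickP => [v /eqP // | no_v].
  have [u def_u] := onF _ (linN i).
  have:= no_v (FiniteModule.fmod abG u).
  by rewrite /chr FiniteModule.fmodK ?inE // -def_u irrK eqxx.
exists V, chr, idx; split=> // [|u v].
  by move=> v; apply: inj_chr.
rewrite !cfIirrE //; exact: FM.
Qed.

Section HalfTransitiveDual.

Variables (gT : finGroupType) (G N H : {group gT}) (p : nat).
Hypotheses (primN : primitive_pair G N) (defG : N ><| H = G).
Hypotheses (pr_p : prime p) (abelN : p.-abelem N).
Hypothesis half : forall t u : Iirr N, t != 0%R -> u != 0%R ->
  #|'I_G['chi_t]%R| = #|'I_G['chi_u]%R|.

(** The normal [p]-subgroup [N <*> R] of [G] centralizes [N]. *)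
Lemma pcore_compl_eq1 (R : {group gT}) : R <| H -> p.-group R -> R :=: 1.
Proof.
move=> nRH pR; have [minN nNG cNN _] := primN.
have [_ sHG mulNH nNH tiNH] := sdprod_context defG.
have sRH := normal_sub nRH; have sRG := subset_trans sRH sHG.
have nNR : R \subset 'N(N) := subset_trans sRH nNH.
have nNRG : N <*> R <| G.
  rewrite /normal join_subG (normal_sub nNG) sRG -{1}mulNH mul_subG //.
    by rewrite (subset_trans (joing_subl N R)) ?normG.
  by rewrite normsY // normal_norm.
have pNR : p.-group (N <*> R) by rewrite norm_joinEr // pgroupM (abelem_pgroup abelN).
have := minnormal_nil_cent minN nNRG (pgroup_nil pNR) (joing_subl _ _).
rewrite join_subG => /andP[_ cNR].
by apply/trivgP; rewrite -tiNH subsetI sRH andbT -cNN subsetI sRG.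
Qed.

Section Dual.

Variables (V : finZmodType) (chr : V -> Iirr N) (idx : Iirr N -> V).
Hypotheses (chrK : cancel chr idx) (idxK : cancel idx chr).
Hypothesis chrD : forall u v, ('chi_(chr (u + v)) = 'chi_(chr u) * 'chi_(chr v))%R.

Definition dual_act (v : V) (x : gT) : V := idx (conjg_Iirr (chr v) x).

Lemma chr_act v x : ('chi_(chr (dual_act v x)))%R = (('chi_(chr v))%R ^ x)%CF.
Proof. by rewrite /dual_act idxK conjg_IirrE. Qed.

Lemma chr_inj u v : ('chi_(chr u))%R = ('chi_(chr v))%R -> u = v.
Proof. by move=> /irr_inj/(can_inj chrK). Qed.

Lemma chr0 : chr 0%R = 0%R.
Proof.
have := chrD 0%R 0%R; rewrite addr0 => e.
apply/eqP; rewrite -irr_eq1; apply/eqP.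
have abN := abelem_abelian abelN; have /char_abelianP linN := abN.
have unit0 := lin_char_unitr (linN (chr 0%R)).
by apply: (mulrI unit0); rewrite mulr1.
Qed.

Lemma chr_muln v n : ('chi_(chr (v *+ n)%R))%R = ('chi_(chr v) ^+ n)%R.
Proof.
elim: n => [|n IHn]; first by rewrite mulr0n expr0 chr0 irr0.
by rewrite mulrS chrD IHn exprS.
Qed.

Lemma dual_act_add x : x \in H -> {morph dual_act^~ x : u v / (u + v)%R}.
Proof.
by move=> Hx u v; apply: chr_inj; rewrite chrD !chr_act chrD rmorphM.
Qed.

Lemma dual_actM v : {in H &, forall x y, dual_act v (x * y) = dual_act (dual_act v x) y}.
Proof.
have [_ sHG _ nNH _] := sdprod_context defG.
move=> x y Hx Hy; apply: chr_inj; rewrite !chr_act.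
exact: cfConjgMnorm (subsetP nNH x Hx) (subsetP nNH y Hy).
Qed.

Lemma dual_act1 v : dual_act v 1 = v.
Proof. by apply: chr_inj; rewrite chr_act cfConjgJ1. Qed.

Lemma stab_dualE v : stab H dual_act v = 'I_H['chi_(chr v)]%R.
Proof.
have [_ sHG _ nNH _] := sdprod_context defG.
apply/setP=> x; rewrite inE [RHS]inE; apply: andb_id2l => Hx; rewrite [RHS]inE (subsetP nNH) //=.
by rewrite -chr_act (inj_eq irr_inj) (can_eq chrK).
Qed.

Lemma dual_half u v : u <> 0%R -> v <> 0%R ->
  #|stab H dual_act u| = #|stab H dual_act v|.
Proof.
have [nNG sHG mulNH nNH tiNH] := sdprod_context defG.
move=> nz_u nz_v; rewrite !stab_dualE.
have oI t : #|'I_G['chi[N]_t]%R| = (#|N| * #|'I_H['chi_t]%R|)%N.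
  rewrite -mulNH -group_modl ?sub_inertia // TI_cardMg //.
  by apply/trivgP; rewrite -tiNH setIS ?subsetIl.
have nz w : w <> 0%R -> chr w != 0%R.
  by move=> nz_w; apply/eqP; rewrite -chr0 => /(can_inj chrK).
by apply/eqP; rewrite -(eqn_pmul2l (cardG_gt0 N)) -!oI (half (nz u nz_u) (nz v nz_v)).
Qed.

(** The commutator subgroup of [N] and [K] is normal in [G] and nontrivial, hence
    equal to [N], and it lies in the kernel of every [K]-invariant linear character. *)
Lemma dual_fpf (K : {group gT}) : K <| H -> K :!=: 1 ->
  forall v, K \subset stab H dual_act v -> v = 0%R.
Proof.
move=> nKH ntK v; have [minN nNG cNN _] := primN.
have [_ sHG mulNH nNH tiNH] := sdprod_context defG.
have abN := abelem_abelian abelN; have /char_abelianP linN := abN.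
have sKH := normal_sub nKH; have sKG := subset_trans sKH sHG.
have nNK := subset_trans sKH nNH.
rewrite stab_dualE => sKI.
have sNKN : [~: N, K] \subset N by rewrite commg_subl.
have nNKG : G \subset 'N([~: N, K]).
  rewrite -mulNH mul_subG //.
    by apply: cents_norm; rewrite (sub_abelian_cent2 abN).
  by rewrite normsR // normal_norm.
have ntNK : [~: N, K] != 1.
  apply: contra ntK => /eqP/commG1P cNK.
  by rewrite -subG1 -tiNH subsetI sKH andbT -cNN subsetI sKG centsC.
case/mingroupP: (minN) => _ /(_ [~: N, K]%G); rewrite ntNK => /(_ nNKG sNKN) defNK.
have sNker : gval N \subset cfker ('chi_(chr v))%R.
  suffices: [~: N, K] \subset cfker ('chi_(chr v))%R by rewrite defNK.
  rewrite gen_subG; apply/subsetP=> _ /imset2P[n k Nn Kk ->].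
  have Nnk : n ^ k \in N by rewrite memJ_norm // (subsetP nNK).
  rewrite /= cfkerEchar ?irr_char // inE groupM ?groupV //=.
  rewrite lin_charM ?groupV // lin_charV //.
  have /setIP[_ /inertia_valJ ->] := subsetP sKI k Kk.
  by rewrite mulVf ?lin_char_neq0 // lin_char1.
apply: (can_inj chrK); rewrite chr0; apply/eqP.
by rewrite -subGcfker.
Qed.

(** The characters of [N] separate its elements. *)
Lemma dual_faith x : x \in H -> (forall v, dual_act v x = v) -> x = 1.
Proof.
move=> Hx fix_x; have [minN nNG cNN _] := primN.
have [_ sHG mulNH nNH tiNH] := sdprod_context defG.
have abN := abelem_abelian abelN; have /char_abelianP linN := abN.
suffices : x \in N :&: H by rewrite tiNH => /set1P.
rewrite inE Hx andbT -cNN inE (subsetP sHG) //=; apply/centP=> n Nn.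
suffices: [~ x, n] \in \bigcap_i cfker ('chi[N]_i)%R.
  by rewrite TI_cfker_irr => /set1P/eqP/commgP.
apply/bigcapP=> i _; have nNx := subsetP nNH x Hx.
have Nnx : n^-1 ^ x \in N by rewrite memJ_norm ?groupV.
rewrite commgEr cfkerEchar ?irr_char // inE groupM //=.
have fix_i : (('chi_i)%R ^ x)%CF = ('chi_i)%R.
  by rewrite -(idxK i) -chr_act fix_x.
rewrite lin_charM // -{1}fix_i cfConjgEJ // -lin_charM ?groupV //.
by rewrite mulVg.
Qed.

Lemma dual_div q : prime q -> q != p -> forall v : V, (v *+ q)%R = 0%R -> v = 0%R.
Proof.
move=> pr_q neq_qp v vq0.
have v1 : ('chi_(chr v) ^+ q = 1)%R by rewrite -chr_muln vq0 chr0 irr0.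
have abN := abelem_abelian abelN; have /char_abelianP linN := abN.
have dvdN := cforder_lin_char_dvdG (linN (chr v)).
have dvdq : #[('chi_(chr v))%R]%CF %| q by rewrite dvdn_cforder v1.
have co : coprime #|N| q.
  by rewrite (pnat_coprime (abelem_pgroup abelN)) // pnatE // !inE eq_sym.
have : #[('chi_(chr v))%R]%CF %| 1 by rewrite -(eqP co) dvdn_gcd dvdN.
rewrite dvdn_cforder expr1 irr_eq1 -chr0 (can_eq chrK).
by move/eqP.
Qed.

End Dual.

Lemma half_odd_cyclic q (Q : {group gT}) :
  prime q -> odd q -> q.-group Q -> Q <| H -> cyclic Q.
Proof.
move=> pr_q odd_q qQ nQH; have [eq_qp | neq_qp] := eqVneq q p.
  by rewrite (pcore_compl_eq1 nQH) ?cyclic1 // -eq_qp.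
have [V [chr [idx [chrK idxK chrD]]]] := dual_zmodule (abelem_abelian abelN).
exact: (odd_normal_pgroup_cyclic (dual_act_add chrK idxK chrD)
  (dual_actM chrK idxK) (dual_act1 chrK idxK) (dual_faith idxK)
  (dual_fpf chrK idxK chrD) (dual_half chrK idxK chrD) pr_q (dual_div chrK chrD pr_q neq_qp)).
Qed.

Lemma half_even_abelem (E : {group gT}) :
    E <| H -> 2.-abelem E -> E :!=: 1 ->
  #|E| = 2 \/ exists I : {group gT}, [/\ I <| H, nilpotent I & nilpotent (H / I)].
Proof.
move=> nEH abE ntE; have [eq_2p | neq_2p] := eqVneq 2 p.
  by rewrite (pcore_compl_eq1 nEH) ?eqxx // -eq_2p abelem_pgroup in ntE.
have [V [chr [idx [chrK idxK chrD]]]] := dual_zmodule (abelem_abelian abelN).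
exact: (even_normal_abelem (dual_act_add chrK idxK chrD)
  (dual_actM chrK idxK) (dual_act1 chrK idxK) (dual_faith idxK)
  (dual_fpf chrK idxK chrD) (dual_half chrK idxK chrD) _ (dual_div chrK chrD _ neq_2p)).
Qed.

End HalfTransitiveDual.

(** * Kernels and degrees that are powers of 2 *)

(** Otherwise some chief factor [M / Z] of [G] has [M] in the centralizer [C] of
    [F = 'F(G)] and [Z = F :&: C].  As [M] centralizes [Z], it is nilpotent of
    class at most 2, so it is contained in [F]. *)
Lemma cent_Fitting_sub (gT : finGroupType) (G : {group gT}) :
  solvable G -> 'C_G('F(G)) \subset 'F(G).
Proof.
move=> solG; set F := 'F(G)%G; set C := 'C_G(F)%G.
have nFG : F <| G := Fitting_normal G.
have nCG : C <| G by rewrite /normal subsetIl normsI ?normG ?norms_cent ?normal_norm.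
have nZG : F :&: C <| G by apply: normalI.
apply: contraT => not_sCF.
have ntC : C / (F :&: C) != 1.
  have nZC := subset_trans (normal_sub nCG) (normal_norm nZG).
  rewrite -subG1 quotient_sub1 //.
  by rewrite /= subsetI subxx andbT.
have [Mb minM sMb] := minnormal_exists ntC (quotient_norms _ (normal_norm nCG)).
have [nMb ntM abM] := minnormal_solvable minM sMb (quotient_sol _ (solvableS (normal_sub nCG) solG)).
have nMbG : Mb <| G / (F :&: C).
  by rewrite /normal nMb (subset_trans sMb) ?quotientS ?normal_sub.
have [M defM sZM nMG] := inv_quotientN nZG nMbG.
have sMG := normal_sub nMG; have nZM := subset_trans sMG (normal_norm nZG).
have sMC : M \subset C.
  by rewrite -(quotientSGK nZM) ?subsetIr // -defM.
have [r _ abrM] := is_abelemP abM.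
have derM : [~: M, M] \subset F :&: C.
  have := abelem_abelian abrM; rewrite defM /abelian quotient_cents2 //.
have nilM : nilpotent M.
  apply/lcnP; exists 2; apply/commG1P; rewrite (subset_trans derM) // subIset //.
  by rewrite centsC (subset_trans sMC) ?subsetIr.
have sMF : M \subset F by apply: Fitting_max.
by case/eqP: ntM; apply/trivgP; rewrite defM quotient_sub1 // subsetI sMF.
Qed.

Section PrimaryWeight.

Variables (gT : finGroupType) (Y V : {group gT}) (i : Iirr Y).
Hypotheses (solY : solvable Y) (primV : primitive_pair Y V) (abV : 2.-abelem V).
Hypothesis neqYV : V :!=: Y.
Hypothesis deg2 : 2.-nat (#|cfker 'chi_i| * irr_deg i)%R%N.

Let nVY : V <| Y. Proof. by case: primV. Qed.
Let minV : minnormal V Y. Proof. by case: primV. Qed.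
Let ntV : V :!=: 1. Proof. by case/mingroupP: minV => /andP[]. Qed.
Let cVV : 'C_Y(V) = V. Proof. by case: primV. Qed.

(** Such an [R] is a normal 2-subgroup of [Y], so it centralizes [V]. *)
Lemma pcore_quo_eq1 (R : {group gT}) : R <| Y -> V \subset R -> 2.-group (R / V) -> R :=: V.
Proof.
move=> nRY sVR qRV; have nVR := normalS sVR (normal_sub nRY) nVY.
have qR : 2.-group R.
  by rewrite -(pquotient_pgroup (abelem_pgroup abV)) // normal_norm.
apply/eqP; rewrite eqEsubset sVR andbT -cVV subsetI normal_sub //.
exact: minnormal_nil_cent minV nRY (pgroup_nil qR) sVR.
Qed.

Lemma irr_deg_constt2 (D : {group gT}) (j : Iirr D) : D <| Y ->
  j \in irr_constt ('Res[D] 'chi_i)%R -> 2.-nat (irr_deg j).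
Proof.
move=> nDY Rj; have [n def_n] := dvdn_constt_Res1_irr1 nDY Rj.
apply: (@pnat_dvd _ (irr_deg i)); last by move: deg2; rewrite pnatM => /andP[].
apply/dvdnP; exists n; apply/eqP; rewrite -(eqr_nat algC) natrM -!irr_degE.
exact/eqP.
Qed.

(** The principal character of [E] is a constituent of the restriction of
    ['chi_i]. *)
Lemma normal_sub_cfker (D E : {group gT}) (mu : Iirr D) : D <| Y -> E <| Y -> E \subset D ->
  mu \in irr_constt ('Res[D] 'chi_i)%R -> E \subset cfker ('chi_mu)%R ->
  E \subset cfker ('chi_i)%R.
Proof.
move=> nDY nEY sED Rmu kerE; apply: constt0_Res_cfker => //.
rewrite -constt_Ind_Res; apply: (constt_Ind_trans sED (normal_sub nDY) (i := mu)).
  rewrite constt_Ind_Res; have [j Rj] := constt_cfRes_irr E mu.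
  suffices j0 : j = 0%R by rewrite -j0.
  apply/eqP; rewrite -subGcfker.
  apply: subset_trans (cfker_constt (cfRes_char _ (irr_char mu)) Rj).
  by rewrite cfker_Res ?irr_char // subsetI subxx.
by rewrite constt_Ind_Res.
Qed.

(** Let [D / V] be a chief factor of [Y].  It has odd order.  Let [mu] be a
    linear character of [V] under a character [nu] of [D] under ['chi_i].  The
    number of [D]-conjugates of [mu] divides both the odd number [#|D : V|] and
    the degree of [nu], a power of 2.  So [mu] is invariant in [D], and its
    kernel contains the commutator subgroup of [V] and [D], which is normal in
    [Y].  Then so does the
    kernel of ['chi_i], and [D] centralizes [V]. *)
Lemma faithful_primary_False : cfker ('chi_i)%R = 1 -> False.
Proof.
move=> ker1; have ntYV : Y / V != 1.
  rewrite -subG1 quotient_sub1 ?normal_norm //; apply: contra neqYV => sYV.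
  by rewrite eqEsubset sYV normal_sub.
have [Db minD sDb] := minnormal_exists ntYV (normG _).
have [_ ntD abD] := minnormal_solvable minD sDb (quotient_sol _ solY).
have nDb : Db <| Y / V by rewrite /normal sDb; case/mingroupP: minD => /andP[].
have [D defDb sVD nDY] := inv_quotientN nVY nDb.
have [r pr_r abelD] := is_abelemP abD; have rD := abelem_pgroup abelD.
have nVD := normalS sVD (normal_sub nDY) nVY.
have neqDV : D :!=: V.
  by apply: contraNneq ntD => eqDV; rewrite defDb eqDV trivg_quotient.
have odd_DV : 2^'.-nat #|D : V|.
  rewrite -card_quotient ?normal_norm // -defDb.
  apply: sub_in_pnat rD => s _ /eqnP->; rewrite !inE; apply: contraNneq neqDV => eq_r2.
  have q2: 2.-group (D / V) by rewrite -defDb -eq_r2 (abelem_pgroup abelD).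
  by apply/eqP; apply: pcore_quo_eq1 q2.
have [nu Rnu] := constt_cfRes_irr D i.
have [mu Rmu] := constt_cfRes_irr V nu.
have lin_mu : ('chi_mu)%R \is a linear_char.
  by have /char_abelianP linV := abelem_abelian abV; apply: linV.
have := Clifford_Res_sum_cfclass nVD Rmu; set e := '[_, _]%R => defRes.
have e_nat : (e \is a Num.nat)%R.
  by rewrite Cnat_cfdot_char ?irr_char ?cfRes_char ?irr_char.
have [n def_e] := natrP e_nat.
have deg_nu : irr_deg nu = (n * #|D : 'I_D['chi_mu]%R|)%N.
  apply/eqP; rewrite -(eqr_nat algC) -irr_degE -(cfRes1 V) defRes cfunE def_e sum_cfunE.
  rewrite big_seq (eq_bigr (fun=> 1%R)) => [|f /cfclassP[y _ ->]]; last first.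
    by rewrite cfConjg1 lin_char1.
  by rewrite -big_seq big_const_seq count_predT iter_addr_0 size_cfclass natrM.
have DI : #|D : 'I_D['chi_mu]%R| = 1%N.
  apply: (@pnat_1 2).
    have := irr_deg_constt2 nDY Rnu; rewrite deg_nu pnatM => /andP[_].
    by [].
  apply: pnat_dvd odd_DV; apply: indexgS.
  by rewrite subsetI sVD sub_inertia.
have sDI : D \subset 'I['chi_mu]%R.
  by have := index1g (subsetIl D 'I['chi_mu]%R) DI => /= <-; apply: subsetIr.
have Rmu' : mu \in irr_constt ('Res[V] 'chi_i)%R.
  rewrite -constt_Ind_Res; apply: (constt_Ind_trans sVD (normal_sub nDY) (i := nu)).
    by rewrite constt_Ind_Res.
  by rewrite constt_Ind_Res.
have sVDV : [~: V, D] \subset V by rewrite commg_subl normal_norm.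
have kerVD : [~: V, D] \subset cfker ('chi_mu)%R.
  rewrite gen_subG; apply/subsetP=> _ /imset2P[v d Vv Dd ->].
  have Vvd : v ^ d \in V by rewrite memJ_norm // (subsetP (normal_norm nVD)).
  rewrite /= cfkerEchar ?irr_char // inE groupM ?groupV //=.
  rewrite lin_charM ?groupV // lin_charV // (inertia_valJ _ (subsetP sDI d Dd)).
  by rewrite mulVf ?lin_char_neq0 // lin_char1.
have nRY : [~: V, D] <| Y.
  by rewrite /normal (subset_trans sVDV) ?normsR ?normal_norm ?normal_sub.
have := normal_sub_cfker nVY nRY sVDV Rmu' kerVD.
rewrite ker1 => /trivgP/commG1P; rewrite centsC => cDV.
case/negP: neqDV; rewrite eqEsubset sVD andbT -cVV subsetI cDV.
by rewrite normal_sub.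
Qed.

(** By the previous lemma the kernel of ['chi_i] is [V].  The Fitting subgroup
    [A / V] of [Y / V] has odd order.  A character of [A] under ['chi_i] has a
    degree that is a power of 2 and divides [#|A / V|], so it is linear, and
    [A / V] is abelian.  Now [index_part2_le] gives [#|Y|`_2 <= #|V| ^ 2]. *)
Lemma primary_weight_bound : #|Y|`_2 < 4 * (#|cfker ('chi_i)%R| * irr_deg i) ^ 2.
Proof.
have [ker1 | nt_ker] := eqVneq (cfker ('chi_i)%R) 1; first by case: faithful_primary_False.
have [_ _ _ uniqV] := primV; have sVK := uniqV _ (cfker_normal _) nt_ker.
have qK : 2.-group (cfker ('chi_i)%R) by move: deg2; rewrite pnatM => /andP[].
have defK : cfker ('chi_i)%R = V.
  exact: (pcore_quo_eq1 (cfker_normal _) sVK (quotient_pgroup _ qK)).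
have [A defA sVA nAY] := inv_quotientN nVY (Fitting_normal (Y / V)).
have nVA := normalS sVA (normal_sub nAY) nVY.
have oddA : odd #|A / V|.
  have nilA : nilpotent (A / V) by rewrite -defA Fitting_nil.
  have nO : 'O_2(A / V) <| Y / V by rewrite gFnormal_trans // quotient_normal.
  have [R defR sVR nRY] := inv_quotientN nVY nO.
  have eqRV : R :=: V.
    by apply: pcore_quo_eq1 sVR _ => //; rewrite -defR pcore_pgroup.
  have O1 : 'O_2(A / V) = 1 by rewrite /= defR eqRV trivg_quotient.
  rewrite odd_2'nat; have := nilpotent_pcore_Hall 2 nilA; rewrite O1.
  by case/and3P; rewrite indexg1.
have abA : abelian (A / V).
  have [j Rj] := constt_cfRes_irr A i.
  have deg_j := irr_deg_constt2 nAY Rj.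
  have kerj : V \subset cfker ('chi_j)%R.
    apply: subset_trans (cfker_constt (cfRes_char _ (irr_char i)) Rj).
    by rewrite cfker_Res ?irr_char ?(normal_sub nAY) // defK subsetI sVA /=.
  have odd_j : irr_deg j %| #|A / V|.
    have := dvd_irr1_cardG (quo_Iirr V j).
    rewrite quo_IirrE // cfQuo1 irr_degE dvdC_nat.
    by [].
  have lin_j : irr_deg j = 1%N.
    apply: (pnat_1 deg_j); apply: pnat_dvd odd_j _.
    by rewrite -odd_2'nat.
  apply: sub_der1_abelian; rewrite -defK.
  apply: (normal_sub_cfker nAY _ (der_sub 1 A) Rj); first exact: gFnormal_trans.
  by rewrite -lin_irr_der1 qualifE /= irr_char irr_degE lin_j eqxx.
have cA : 'C_(Y / V)(A / V) \subset A / V.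
  by rewrite -defA; apply: cent_Fitting_sub; apply: quotient_sol.
have sCV : 'C_Y(V) \subset V by rewrite cVV.
have le1 := index_part2_le nAY nVY sVA abV ntV sCV abA oddA cA.
rewrite -(Lagrange (normal_sub nVY)) partnM // (part_pnat_id (abelem_pgroup abV)) defK.
apply: leq_ltn_trans (leq_mul (leqnn _) le1) _; rewrite mulnn expnMn mulnA.
apply: leq_trans (leq_pmulr _ _); last by rewrite expn_gt0 irr_deg_gt0.
by rewrite ltn_Pmull // expn_gt0 cardG_gt0.
Qed.

End PrimaryWeight.

(** * Codegrees of a group with restricted normal 2-subgroups *)

Section CodegreeSubset.

Variables (gT : finGroupType) (H M : {group gT}).
Hypotheses (solH : solvable H) (hH : 2 < fitting_height H).
Hypothesis oddH : forall q (Q : {group gT}),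
  prime q -> odd q -> q.-group Q -> Q <| H -> cyclic Q.
Hypothesis evenH : forall E : {group gT}, E <| H -> 2.-abelem E -> E :!=: 1 ->
  #|E| = 2 \/ exists I : {group gT}, [/\ I <| H, nilpotent I & nilpotent (H / I)].
Hypothesis nMH : M <| H.
Hypothesis hM : fitting_height (H / M) = fitting_height H.
Hypothesis subcod : {subset codegrees H <= codegrees (H / M)}.

Variables (V C : {group coset_of M}).
Hypotheses (primV : primitive_pair (H / M) V) (defHM : V ><| C = H / M).
Hypothesis hC : fitting_height (H / M) = (fitting_height C).+1.

Let solHM : solvable (H / M). Proof. exact: quotient_sol. Qed.
Let nVHM : V <| H / M. Proof. by case: primV. Qed.
Let minV : minnormal V (H / M). Proof. by case: primV. Qed.
Let ntV : V :!=: 1. Proof. by case/mingroupP: minV => /andP[]. Qed.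
Let cVV : 'C_(H / M)(V) = V. Proof. by case: primV. Qed.
Let nMH' := normal_norm nMH.

Let min_normal (K : {group coset_of M}) :
  K \subset V -> K :!=: 1 -> H / M \subset 'N(K) -> K :=: V.
Proof. by move=> sKV ntK nK; case/mingroupP: minV => _; apply; rewrite ?ntK. Qed.

(** Otherwise [C], which acts faithfully on [V], would be isomorphic to a
    subgroup of the abelian group [Aut V], and the height of [H] would be at
    most 2. *)
Lemma socle_ncyclic : ~~ cyclic V.
Proof.
apply: contraTN hH => cycV; rewrite -leqNgt -hM hC ltnS.
have [_ sCY _ nVC tiVC] := sdprod_context defHM.
apply: fitting_height_nil; apply: abelian_nil; apply/centsP=> x Cx y Cy.
apply/commgP; rewrite -in_set1; suffices: [~ x, y] \in V :&: C by rewrite tiVC.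
rewrite inE (groupR Cx Cy) andbT -cVV inE groupR ?(subsetP sCY) //=.
have [nVx nVy] := (subsetP nVC x Cx, subsetP nVC y Cy).
rewrite -(ker_conj_aut V); apply/kerP; rewrite ?groupR //= morphR //.
apply/eqP/commgP; apply: (centsP (Aut_cyclic_abelian cycV)); exact: Aut_aut.
Qed.

Lemma quo_Fitting_sub : 'F(H) / M \subset V.
Proof.
rewrite -cVV subsetI quotientS ?Fitting_sub //=.
have nilF : nilpotent ('F(H) / M) by rewrite quotient_nil // Fitting_nil.
have sFF : 'F(H) / M \subset 'F(H / M).
  by apply: Fitting_max => //; rewrite quotient_normal // Fitting_normal.
apply: subset_trans sFF _.
apply: minnormal_nil_cent minV (Fitting_normal _) (Fitting_nil _) _.
have [_ _ abV] := minnormal_solvable minV (normal_sub nVHM) solHM.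
have [r _ abrV] := is_abelemP abV.
exact: Fitting_max nVHM (abelian_nil (abelem_abelian abrV)).
Qed.

Lemma Fitting_nsub : ~~ ('F(H) \subset M).
Proof.
apply/negP=> sFM; have := leqnn (fitting_height H).
case def_n: (fitting_height H) hH => [|n] // _.
have le_n : fitting_height H <= n.+1 by rewrite def_n.
have /(fitting_height_quo_leP _ solH (Fitting_normal H) (leqnn _)) sLF :=
  fitting_height_quo_Fitting solH le_n.
suffices : fitting_height (H / M) <= n by rewrite hM def_n ltnn.
apply/(fitting_height_quo_leP _ solH nMH (leqnn _)).
exact: subset_trans sLF sFM.
Qed.

(** The Fitting subgroup of [H] is not contained in [M] because the height of
    [H] would drop modulo [M].  Its image lies in ['F(H / M) = V], a
    [q]-group, so the image of its [q]-part is not trivial. *)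
Lemma pcore_covers q : prime q -> q.-abelem V -> 'O_q(H) / M = V.
Proof.
move=> pr_q abV; have sQF : 'O_q(H) \subset 'F(H) by rewrite -p_core_Fitting pcore_sub.
apply: min_normal; first exact: subset_trans (quotientS M sQF) quo_Fitting_sub.
  apply: contra Fitting_nsub => /eqP Q1.
  have [_ defF _ _] := dprodP (nilpotent_pcoreC q (Fitting_nil H)).
  rewrite -defF mul_subG // -quotient_sub1 ?(subset_trans _ nMH') //.
  - by rewrite p_core_Fitting Q1.
  - by rewrite (subset_trans (pcore_sub _ _)) ?Fitting_sub.
  - rewrite -(@coprime_TIg _ V ('O_q^'('F(H)) / M)) ?subsetI ?subxx ?andbT.
      by apply: subset_trans quo_Fitting_sub; rewrite quotientS ?pcore_sub.
    exact: pnat_coprime (abelem_pgroup abV) (quotient_pgroup M (pcore_pgroup q^' _)).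
  by rewrite (subset_trans (pcore_sub _ _)) ?Fitting_sub.
by rewrite quotient_norms // gFnorm.
Qed.

(** If [V] is a [q]-group for an odd [q], it is an image of the cyclic group
    ['O_q(H)]. *)
Lemma abelem_socle2 : 2.-abelem V.
Proof.
have [_ _ abV] := minnormal_solvable minV (normal_sub nVHM) solHM.
have [q pr_q abqV] := is_abelemP abV.
have [q2 | odd_q] := even_prime pr_q; first by rewrite q2 in abqV.
case/negP: socle_ncyclic; rewrite -(pcore_covers pr_q abqV) quotient_cyclic //.
exact: oddH pr_q odd_q (pcore_pgroup _ _) (pcore_normal _ _).
Qed.

Let Q := 'O_2(H)%G.
Let E := 'Ohm_1('Z(Q))%G.

Let q2Q : 2.-group Q. Proof. exact: pcore_pgroup. Qed.
Let nQH : Q <| H. Proof. exact: pcore_normal. Qed.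
Let defQM : Q / M = V. Proof. exact: pcore_covers abelem_socle2. Qed.
Let sEQ : E \subset Q. Proof. exact: subset_trans (Ohm_sub _ _) (center_sub _). Qed.

Let nEH : E <| H.
Proof. by do 2!apply: gFnormal_trans; exact: nQH. Qed.

Let ntQ : Q :!=: 1.
Proof. by apply: contraNneq ntV => Q1; rewrite -defQM Q1 quotient1. Qed.

Let ntE : E :!=: 1.
Proof. by rewrite Ohm1_eq1 (center_nil_eq1 (pgroup_nil q2Q)). Qed.

Let abE : 2.-abelem E.
Proof. by rewrite Ohm1_abelem ?center_abelian // (pgroupS (center_sub _)). Qed.

Lemma card_Ohm1_center : #|E| = 2.
Proof.
have [// | [I [nIH nilI nilHI]]] := evenH nEH abE ntE.
have := fitting_height_quo_nil solH nIH nilI (fitting_height_nil nilHI).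
by rewrite leqNgt hH.
Qed.

(** The normal subgroup [K :&: Q] of [Q] meets ['Z(Q)], hence the subgroup [E] of
    order 2 that contains all involutions of ['Z(Q)]. *)
Lemma Ohm1_sub_normal (K : {group gT}) : K <| H -> K :&: Q != 1 -> E \subset K.
Proof.
move=> nKH ntKQ; have sQH := normal_sub nQH.
have nKQ : K :&: Q <| Q by rewrite /normal subsetIr normsI ?normG ?(subset_trans sQH) ?normal_norm.
have ntKZ : K :&: Q :&: 'Z(Q) != 1 := meet_center_nil (pgroup_nil q2Q) nKQ ntKQ.
rewrite prime_meetG ?card_Ohm1_center //.
rewrite -(Ohm1_eq1 [group of K :&: Q :&: 'Z(Q)]) in ntKZ.
apply: contra ntKZ => /eqP tiEK; rewrite -subG1 -tiEK subsetI.
rewrite OhmS ?subsetIr //= (subset_trans (Ohm_sub _ _)) //.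
by rewrite /= -setIA subsetIl.
Qed.

(** Otherwise [Q] would be isomorphic to [V], so elementary abelian, and [E = Q]
    would have order 2; but [V] is not cyclic. *)
Lemma Ohm1_sub : E \subset M.
Proof.
apply: Ohm1_sub_normal => //; apply: contra socle_ncyclic => /eqP tiMQ.
have sQH := normal_sub nQH.
have isoQ : Q \isog V by rewrite -defQM quotient_isog // (subset_trans sQH).
have abQ : 2.-abelem Q by rewrite (isog_abelem isoQ) abelem_socle2.
have oQ : #|Q| = 2.
  rewrite -card_Ohm1_center /E /= (center_idP (abelem_abelian abQ)).
  by rewrite (Ohm1_id abQ).
by rewrite prime_cyclic // -(card_isog isoQ) oQ.
Qed.

Lemma Ohm1_central : H \subset 'C(E).
Proof.
apply/centsP=> h Hh e Ee; have [-> | nte] := eqVneq e 1; first exact: commute1.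
apply: commute_sym; apply/commgP/conjg_fixP; apply: (card2_eq card_Ohm1_center) => //.
  by rewrite memJ_norm // (subsetP (normal_norm nEH)).
by rewrite conjg_eq1.
Qed.

Section Avoid.

Variable L : {group gT}.
Hypotheses (nLH : L <| H) (not_sEL : ~~ (E \subset L)).

Lemma avoid_tiQ : L :&: Q = 1.
Proof. by apply/eqP; apply: contraNT not_sEL; apply: Ohm1_sub_normal. Qed.

(** As [L] meets [Q] trivially, it centralizes [Q], and [L / M] centralizes
    [V = Q / M].  If [L] is not contained in [M], then [L / M = V].  Let [J] be
    the second last nontrivial term of the residual series of [H].  It does not
    centralize [V], so all iterated commutators [D i] of [L] with [J] still
    cover [V].  They lie in [L], and finally also in the last nontrivial term
    ['L_m(J)], which is nilpotent.  So [L :&: 'L_m(J)] is nilpotent and its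
    image modulo [M] contains the 2-group [V].  Hence it has a nontrivial
    2-core, which lies in [Q]. *)
Lemma avoid_sub : L \subset M.
Proof.
apply: contraT => not_sLM; have [sLH nLH'] := andP nLH; have sQH := normal_sub nQH.
have cLQ : L \subset 'C(Q).
  apply/commG1P/trivgP; rewrite -avoid_tiQ subsetI commg_subl commg_subr.
  by rewrite (subset_trans sQH nLH') (subset_trans sLH (normal_norm nQH)).
have sLV : L / M \subset V.
  by rewrite -cVV subsetI quotientS //= -defQM quotient_cents.
have defV : L / M = V.
  apply: min_normal => //; last by rewrite quotient_norms.
  by rewrite -subG1 quotient_sub1 // (subset_trans sLH).
have := leqnn (fitting_height H); case def_k: (fitting_height H) (hH) => [|[|k]] // _ _.
have leHk : fitting_height H <= k.+2 by rewrite def_k.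
pose m := #|H|; pose J := nil_series_group m k H.
have m_gt0 : 0 < m by apply: cardG_gt0.
have nJH : J <| H by rewrite char_normal // nil_series_char.
have nilJ : nilpotent 'L_m(J).
  apply: (@lcn1_nil _ m).
  by have /(fitting_height_leP _ solH (leqnn _)) := leHk.
have not_sJV : ~~ (J / M \subset V).
  rewrite nil_series_quo //; apply/negP=> sJV.
  have leY : #|H / M| <= m by apply: leq_quotient.
  have := introT (fitting_height_quo_leP k solHM nVHM leY) sJV.
  have [_ sCY _ _ _] := sdprod_context defHM.
  rewrite -(fitting_height_isog (solvableS sCY solHM) (sdprod_isog defHM)).
  by rewrite -ltnS -hC hM def_k ltnn.
pose D := fix D i : {group gT} := if i is i'.+1 then [~: D i', J]%G else L.
have sDL i : D i \subset L.
  elim: i => //= i IHi; apply: subset_trans (commSg _ IHi) _.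
  by rewrite commg_subl (subset_trans (normal_sub nJH)).
have sDJ i : D i.+1 \subset 'L_i.+1(J).
  elim: i => [|i IHi] /=; last by rewrite lcnSn commSg.
  by rewrite lcn1 commg_subr (subset_trans sLH) ?normal_norm.
have nM K : K \subset H -> K \subset 'N(M) := fun s => subset_trans s nMH'.
have defDV i : D i / M = V.
  elim: i => //= i IHi; have sDH := subset_trans (sDL i) sLH.
  have -> : [~: D i, J] / M = [~: V, J / M].
    by rewrite -IHi; apply: quotientR; apply: nM => //; apply: normal_sub nJH.
  have nJY : H / M \subset 'N(J / M) by rewrite quotient_norms ?normal_norm.
  apply: (@min_normal [~: V, J / M]%G).
  - by rewrite commg_subl (subset_trans _ (normal_norm nVHM)) ?quotientS ?normal_sub.
  - apply: contra not_sJV => /eqP/commG1P; rewrite centsC => cVJ.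
    by rewrite -cVV subsetI cVJ quotientS ?normal_sub.
  by rewrite normsR // normal_norm.
pose W := (L :&: 'L_m(J))%G.
have nWH : W <| H.
  by rewrite normalI // (gFnormal_trans _ nJH).
have nilW : nilpotent W by rewrite (nilpotentS (subsetIr _ _)).
have sVW : V \subset W / M.
  rewrite -(defDV m) quotientS // subsetI sDL.
  by rewrite -(prednK m_gt0) sDJ.
case/negP: ntV; rewrite -subG1.
have O1 : 'O_2(W) = 1.
  apply/trivgP; rewrite -avoid_tiQ subsetI (subset_trans (pcore_sub _ _)) ?subsetIl //=.
  by rewrite pcore_max ?pcore_pgroup // (gFnormal_trans _ nWH).
have W2' : 2^'.-group W.
  have := nilpotent_pcore_Hall 2 nilW; rewrite O1.
  by case/and3P; rewrite indexg1.
have co : coprime #|V| #|V|.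
  apply: pnat_coprime (abelem_pgroup abelem_socle2) _.
  exact: pgroupS sVW (quotient_pgroup M W2').
by rewrite -{1}(setIid V) (coprime_TIg co).
Qed.

End Avoid.

(** Let [L] be maximal among the normal subgroups without [E].  A nonprincipal
    character of the central subgroup [Z = E / L] of [H / L] lies under a
    character [c] whose degree is a power of 2 with square at most
    [#|H / L : Z|`_2].  It is faithful by the choice of [L].  If ['chi_i] is a
    character of [H / M] with the same codegree, then the degree of [c] is
    [#|M : L|] times the product [g] of degree and kernel order of ['chi_i].
    As [E] lies in [M], [#|M : L|] is at least 2, and [4 * g ^ 2] is at most
    [#|H / M|`_2], against [primary_weight_bound]. *)
Lemma not_codegrees_sub : False.
Proof.
have gP1 : (1%G <| H) && ~~ (E \subset 1%G) by rewrite normal1 subG1.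
have [L maxL] : {L : {group gT} | maxgroup L (fun L => (L <| H) && ~~ (E \subset L))}.
  by apply: ex_maxgroup; exists 1%G.
have [/andP[nLH not_sEL] maxL'] := maxgroupP maxL.
have nLH' := normal_norm nLH; have sLM := avoid_sub nLH not_sEL.
pose Z := (E / L)%G.
have nZ : Z <| H / L by apply: quotient_normal.
have oZ : #|Z| = 2.
  rewrite -card_Ohm1_center; apply/esym/card_isog/quotient_isog.
    exact: subset_trans (normal_sub nEH) nLH'.
  rewrite setIC; apply/eqP; apply: contraNT not_sEL => ntEL.
  by rewrite prime_meetG ?card_Ohm1_center.
have abZ : abelian Z by rewrite cyclic_abelian // prime_cyclic ?oZ.
have /char_abelianP linZ := abZ.
have [t nz_t] : exists t : Iirr Z, t != 0%R.
  by apply: exists_nonprincipal; rewrite -cardG_gt1 oZ.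
have It : H / L \subset 'I['chi_t]%R.
  apply: subset_trans (cent_sub_inertia _).
  by rewrite quotient_cents // Ohm1_central.
have dt : irr_deg t = 1%N.
  by apply/eqP; rewrite -(eqr_nat algC) -irr_degE lin_char1 ?linZ.
have dett : 2.-nat 'o(('chi_t)%R)%CF.
  apply: (@pnat_dvd _ #|Z|); last by rewrite oZ.
  by rewrite /cfDet_order cfDet_id ?linZ // cforder_lin_char_dvdG.
have [||c [Ic deg_c le_c]] := small_primary_degree (isT : prime 2) (leqnn _)
  (quotient_sol L solH) nZ It; rewrite ?dt //.
rewrite dt exp1n mul1n in le_c.
have ker_c : cfker ('chi_c)%R = 1.
  have [K defK sLK nKH] := inv_quotientN nLH (cfker_normal ('chi_c)%R).
  have [sEK | not_sEK] := boolP (E \subset K).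
    case/eqP: nz_t; apply/eqP; rewrite -subGcfker.
    rewrite constt_Ind_Res in Ic.
    apply: subset_trans (cfker_constt (cfRes_char _ (irr_char c)) Ic).
    rewrite cfker_Res ?irr_char ?(normal_sub nZ) // subsetI subxx /=.
    by have /= -> := defK; apply: quotientS.
  have eqK := maxL' K; rewrite nKH not_sEK in eqK.
  by have /= -> := defK; rewrite (eqK isT sLK) trivg_quotient.
have [i def_i] := codegreesP _ _ (subcod (codegrees_quo nLH (codegree_in c))).
set g := (#|cfker ('chi_i)%R| * irr_deg i)%N.
pose m := #|M : L|.
have oHL : #|H / L| = (#|H / M| * m)%N.
  by rewrite !card_quotient // Lagrange_index // normal_sub.
have deg_eq : irr_deg c = (m * g)%N.
  apply/eqP; rewrite -(eqn_pmul2l (cardG_gt0 (H / M))).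
  move: def_i; rewrite /codegree ker_c indexg1 !irr_degE => /eqP.
  rewrite eqr_div ?pnatr_eq0 -?lt0n ?irr_deg_gt0 // -!natrM eqr_nat oHL => /eqP e.
  rewrite -{1}(Lagrange (cfker_sub ('chi_i)%R)) -mulnA -e /g.
  apply/eqP; rewrite /=; ring.
have deg2 : 2.-nat (m * g)%N by rewrite -deg_eq.
have [m2 g2] : 2.-nat m /\ 2.-nat g by move: deg2; rewrite pnatM => /andP[].
have neqYV : V :!=: H / M.
  apply: contraTneq hH => defV; rewrite -leqNgt -hM -defV.
  by rewrite (leq_trans (fitting_height_nil (abelian_nil (abelem_abelian abelem_socle2)))).
have lt_Y := primary_weight_bound solHM primV abelem_socle2 neqYV g2.
have m_gt1 : 1 < m.
  rewrite indexg_gt1; apply: contra not_sEL => sML; exact: subset_trans Ohm1_sub sML.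
have : 2 * irr_deg c ^ 2 <= #|H / L|`_2.
  by rewrite -(Lagrange (normal_sub nZ)) partnM // oZ part_pnat_id // leq_mul.
rewrite /= oHL partnM ?indexg_gt0 // (part_pnat_id m2) deg_eq.
move: lt_Y; rewrite -/g; move: (partn _ _) => y lt_y le_y.
have m_gt0 : 0 < m := ltnW m_gt1.
have g_gt0 : 0 < g by rewrite muln_gt0 cardG_gt0 irr_deg_gt0.
have lt_ym : (y * m < 4 * g ^ 2 * m)%N by rewrite ltn_pmul2r.
have := leq_ltn_trans le_y lt_ym.
have -> : (2 * (m * g) ^ 2 = 2 * m * (g ^ 2 * m))%N by ring.
have -> : (4 * g ^ 2 * m = 4 * (g ^ 2 * m))%N by ring.
have gm_gt0 : 0 < (g ^ 2 * m)%N by rewrite muln_gt0 expn_gt0 g_gt0.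
rewrite (ltn_pmul2r gm_gt0).
by rewrite ltnNge (leq_mul (leqnn 2) m_gt1).
Qed.

End CodegreeSubset.

(** * The bound *)

Lemma size_codegrees_subset (gT rT : finGroupType) (G : {group gT}) (R : {group rT}) :
  {subset codegrees G <= codegrees R} -> size (codegrees G) <= size (codegrees R).
Proof. exact/uniq_leq_size/codegrees_uniq. Qed.

Lemma size_codegrees_gt1 (gT : finGroupType) (G : {group gT}) :
  solvable G -> G :!=: 1 -> 1 < size (codegrees G).
Proof.
move=> solG ntG; have [i lin_i nt_i] := solvable_has_lin_char ntG solG.
apply: (@uniq_leq_size _ [:: codegree ('chi[G]_0)%R; codegree ('chi_i)%R]).
  rewrite /= inE andbT /codegree irr0 cfker_cfun1 indexgg cfun11 lin_char1 //.
  rewrite !divr1 eqr_nat eq_sym indexg_eq1 subGcfker.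
  by apply: contra nt_i => /eqP ->; rewrite irr0.
by move=> x; rewrite !inE => /orP[] /eqP->; apply: codegree_in.
Qed.

Lemma exists_max_quotient (gT : finGroupType) (H : {group gT}) : solvable H ->
  exists2 M : {group gT}, M <| H /\ fitting_height (H / M) = fitting_height H
    & forall K : {group coset_of M}, K <| H / M -> K :!=: 1 ->
      fitting_height (H / M / K) < fitting_height (H / M).
Proof.
move=> solH; pose gP (K : {group gT}) := (K <| H) && (fitting_height (H / K) == fitting_height H).
have [M maxM] : {M : {group gT} | maxgroup M gP}.
  apply: ex_maxgroup; exists 1%G; rewrite /gP normal1 /=.
  by rewrite (fitting_height_isog solH (quotient1_isog H)).
have [/andP[nMH /eqP hM] maxM'] := maxgroupP maxM.
exists M => // Kb nKb ntK; have [K defK sMK nKH] := inv_quotientN nMH nKb.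
rewrite hM defK (fitting_height_isog _ (third_isog sMK nMH nKH)) ?quotient_sol //.
rewrite ltn_neqAle fitting_height_quo // andbT; apply: contraNN ntK => eqK.
by rewrite defK (maxM' K) ?trivg_quotient // /gP nKH.
Qed.

(** The second part is what starts the induction: with the complement [H] of
    height at most 2, one new codegree is enough. *)
Lemma codegree_bound n (gT : finGroupType) (G : {group gT}) : #|G| <= n -> solvable G ->
  2 * fitting_height G <= size (codegrees G) + 2 /\
  (fitting_height G <= 3 -> fitting_height G < size (codegrees G)).
Proof.
elim: n gT G => [|n IHn] gT G; first by rewrite leqNgt cardG_gt0.
move=> leG solG.
have [/existsP[K /and3P[nKG ntK /eqP hK]] | noK] :=
  boolP [exists K : {group gT}, [&& K <| G, K :!=: 1 & fitting_height (G / K) == fitting_height G]].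
  have ltK : #|G / K| <= n by rewrite -ltnS (leq_trans _ leG) // ltn_quotient ?normal_sub.
  have [h1 h2] := IHn _ _ ltK (quotient_sol K solG).
  have le_s := size_codegrees_subset (codegrees_quo nKG).
  rewrite hK in h1 h2; split; first by rewrite (leq_trans h1) // leq_add2r.
  by move/h2=> lt_s; apply: leq_trans lt_s le_s.
have minG (K : {group gT}) : K <| G -> K :!=: 1 -> fitting_height (G / K) < fitting_height G.
  move=> nKG ntK; rewrite ltn_neqAle fitting_height_quo // andbT.
  by apply: contra noK => hK; apply/existsP; exists K; rewrite nKG ntK.
case: (ltnP 1 (fitting_height G)) => [gt1 | le1]; last first.
  suffices lt_s : fitting_height G < size (codegrees G) by split=> [|_ //]; move: le1 lt_s; clear; lia.
  move: le1; rewrite leq_eqVlt => /orP[/eqP h1 | ].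
    by rewrite h1 size_codegrees_gt1 // -fitting_height_eq0 // h1.
  by rewrite ltnS leqn0 => /eqP->; apply: size_codegrees_gt0.
have [N [H [primN defG hG]]] := primitive_structure solG gt1 minG.
have [minN nNG _ _] := primN; have [_ sHG _ _ _] := sdprod_context defG.
have [_ ntN abN] := minnormal_solvable minN (normal_sub nNG) solG.
have [p pr_p abpN] := is_abelemP abN; have abelN := abelem_abelian abpN.
have ltH : #|H| < #|G|.
  by rewrite -(sdprod_card defG) ltn_Pmull ?cardG_gt0 // cardG_gt1.
have solH := solvableS sHG solG.
have leH : #|H| <= n by rewrite -ltnS (leq_trans ltH).
have [h1 h2] := IHn _ _ leH solH.
have lt_s := size_codegrees_compl primN defG abelN.
have part2 : fitting_height G <= 3 -> fitting_height G < size (codegrees G).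
  by rewrite hG => /ltnW/h2 lt_sH; apply: leq_ltn_trans lt_sH lt_s.
split=> //; case: (leqP (fitting_height G) 3) => [le3 | gt3]; first by have := part2 le3; move: le3; clear; lia.
rewrite hG in gt3 *.
have [/existsP[t /existsP[u /and3P[nz_t nz_u neq_tu]]] | no_tu] :=
  boolP [exists t : Iirr N, [exists u : Iirr N, [&& t != 0%R, u != 0%R &
    #|'I_G['chi_t]%R| != #|'I_G['chi_u]%R|]]].
  move: h1 (size_codegrees_compl2 primN defG abelN nz_t nz_u neq_tu); clear; lia.
have half t u : t != 0%R -> u != 0%R -> #|'I_G['chi[N]_t]%R| = #|'I_G['chi[N]_u]%R|.
  move=> nz_t nz_u; apply/eqP; apply: contraNT no_tu => neq_tu.
  by apply/existsP; exists t; apply/existsP; exists u; rewrite nz_t nz_u.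
have [M [nMH hM] minM] := exists_max_quotient solH.
have gt1M : 1 < fitting_height (H / M) by rewrite hM; apply: (@leq_trans 3).
have [V [C [primV defHM hC]]] := primitive_structure (quotient_sol M solH) gt1M minM.
have [/allP sub | /allPn[x Hx Mx]] :=
  boolP (all [in codegrees (H / M)] (codegrees H)).
  case: (not_codegrees_sub solH gt3 _ _ nMH hM sub primV defHM hC) => [q Q pr_q odd_q qQ nQH|E].
    exact: (half_odd_cyclic primN defG abpN half pr_q odd_q qQ nQH).
  exact: (half_even_abelem primN defG abpN half).
have lt_s' : size (codegrees (H / M)) < size (codegrees H).
  apply: (@uniq_leq_size _ (x :: codegrees (H / M))).
    by rewrite /= Mx codegrees_uniq.
  by move=> y; rewrite inE => /predU1P[-> // | ]; apply: codegrees_quo.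
have leM : #|H / M| <= n := leq_trans (leq_quotient _ _) leH.
have [h3 _] := IHn _ _ leM (quotient_sol M solH).
rewrite hM in h3; rewrite mulnS (leq_trans (leq_add (leqnn 2) h3)) // addnA leq_add2r add2n.
by apply: leq_trans lt_s; rewrite ltnS.
Qed.

Theorem proposition1p3 (gT : finGroupType) (G : {group gT}) (solG : solvable G) :
  ((fitting_height G)%:R <= 1 / 2 * ((size (codegrees G))%:R + 2) :> rat)%R.
Proof.
have [bound _] := codegree_bound (leqnn _) solG.
move: bound; rewrite -(ler_nat rat) natrM natrD; lra.
Qed.
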